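(* Let $n>m\ge1$ be integers, $k\ge1$, and $t=m(n-m)$. Let \[ \eta=\begin{cases}\frac{1}{t!}\prod_{i=1}^{m}\frac{(n-i)!}{(m-i)!} & \text{if } 1\le m\le \frac{n}{2},\\[2pt] \frac{1}{t!}\prod_{i=1}^{n-m}\frac{(n-i)!}{(n-m-i)!} & \text{if } \frac{n}{2}\le m\le n.\end{cases} \] Let $Q^{(k)}$ be uniformly distributed on the composite Grassmann manifold $\mathcal{G}^{(k)}_{n,m}(\mathbb{C})$, and for a positive integer $K$ define the distortion rate function \[ D^*(K)=\inf_{\mathcal{C}\subset\mathcal{G}^{(k)}_{n,m}(\mathbb{C}),\ |\mathcal{C}|=K}\ \mathrm{E}\left[\min_{P^{(k)}\in\mathcal{C}}d_c^2\left(P^{(k)},Q^{(k)}\right)\right]. \] Then, with $A=\left(\frac{\Gamma^{k}(t+1)}{\Gamma(kt+1)}\eta^{k}\right)^{-\frac{1}{kt}}$, \[ \frac{kt}{kt+1}\,A\,2^{-\frac{\log_2K}{kt}}\ \lesssim\ D^*(K)\ \lesssim\ \frac{\Gamma\left(\frac{1}{kt}\right)}{kt}\,A\,2^{-\frac{\log_2K}{kt}}, \] where $f(K)\lesssim g(K)$ means $\limsup_{K\to+\infty}\frac{f(K)}{g(K)}\le 1$.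
   Context: The Grassmann manifold $\mathcal{G}_{n,m}(\mathbb{C})$ is the set of $m$-dimensional subspaces of $\mathbb{C}^n$. A generator matrix $\mathbf{P}\in\mathbb{C}^{n\times m}$ of $P\in\mathcal{G}_{n,m}(\mathbb{C})$ has orthonormal columns spanning $P$. The chordal distance is $d_c(P_1,P_2)=\frac{1}{\sqrt2}\|\mathbf{P}_1\mathbf{P}_1^{\dagger}-\mathbf{P}_2\mathbf{P}_2^{\dagger}\|_F$. The $k$-composite Grassmann manifold $\mathcal{G}^{(k)}_{n,m}(\mathbb{C})$ is the Cartesian product of $k$ copies of $\mathcal{G}_{n,m}(\mathbb{C})$, with elements $P^{(k)}=(P_1,\dots,P_k)$, and chordal distance $d_c(P^{(k)}_1,P^{(k)}_2)=\sqrt{\sum_{i=1}^{k}d_c^2(P_{1,i},P_{2,i})}$. The uniform distribution on $\mathcal{G}^{(k)}_{n,m}(\mathbb{C})$ is the product of the (unitarily invariant) uniform distributions on each factor. *)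

(* Defs.v *)
From HB Require Import structures.
From mathcomp Require Import all_boot all_order all_algebra.
From mathcomp Require Import all_classical all_reals all_analysis.
From mathcomp Require Import complex.
Unset Printing Implicit Defensive.
Import Order.TTheory GRing.Theory Num.Theory.
Local Open Scope classical_set_scope.
Local Open Scope ring_scope.

Definition ctuple (R : realType) (k n : nat) := {ffun 'I_k -> 'M[R[i]]_n}.
HB.instance Definition _ (R : realType) (k n : nat) := Choice.on (ctuple R k n).
HB.instance Definition _ (R : realType) (k n : nat) :=
  isPointed.Build (ctuple R k n) [ffun=> 0].

Section Grassmann.
Variable R : realType.

Definition adjmx {p q : nat} (A : 'M[R[i]]_(p, q)) : 'M[R[i]]_(q, p) :=
  (map_mx Num.conj A)^T.

Definition frob2 {p q : nat} (A : 'M[R[i]]_(p, q)) : R :=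
  \sum_(a < p) \sum_(b < q) (complex.Re (A a b) ^+ 2 + complex.Im (A a b) ^+ 2).

Definition unitary {n : nat} (U : 'M[R[i]]_n) : Prop := adjmx U *m U = 1%:M.

(* A point P of G_{n,m}(C) is represented by the orthogonal projector
   P P^dagger onto it, where P : 'M_(n,m) is a generator matrix (orthonormal
   columns).  This representation is a bijection with the set of
   m-dimensional subspaces of C^n. *)
Definition grass (n m : nat) : set 'M[R[i]]_n :=
  [set Pi | exists P : 'M[R[i]]_(n, m), adjmx P *m P = 1%:M /\ Pi = P *m adjmx P].


Definition grassk (k n m : nat) : set (ctuple R k n) :=
  [set x | forall i, grass n m (x i)].

(* squared chordal distance d_c^2(P1,P2) = 1/2 ||P1 P1^+ - P2 P2^+||_F^2 on
   each factor, summed over the k factors (composite chordal distance^2).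
   On the ambient space it is the (halved) squared Frobenius distance. *)
Definition dc2 {k n : nat} (x y : ctuple R k n) : R :=
  \sum_(i < k) (frob2 (x i - y i) / 2).

(* Borel sigma-algebra of the ambient space C^{k n^2}, generated by the
   open balls of the (Frobenius) metric *)
Definition dc_balls (k n : nat) : set (set (ctuple R k n)) :=
  [set B | exists (x : ctuple R k n) (r : R), B = [set y | dc2 x y < r]].

Definition GT (k n : nat) := g_sigma_algebraType (dc_balls k n).

Definition uact {k n : nat} (U : 'I_k -> 'M[R[i]]_n) (x : GT k n) : GT k n :=
  [ffun i => U i *m x i *m adjmx (U i)].

(* uniform distribution on G^(k)_{n,m}(C): a probability measure on the
   ambient space, concentrated on G^(k)_{n,m}(C), and invariant under the
   action of U(n)^k (product of the unitarily invariant measures) *)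
Definition uniform_grassk (k n m : nat) (mu : probability (GT k n) R) : Prop :=
  mu (grassk k n m) = 1%E /\
  forall U : 'I_k -> 'M[R[i]]_n, (forall i, unitary (U i)) ->
    forall A, measurable A -> mu (uact U @^-1` A) = mu A.

Definition distortion (k n m : nat) (mu : probability (GT k n) R) (K : nat)
  : \bar R :=
  ereal_inf [set (\int[mu]_(x in grassk k n m)
                    \big[Order.min/+oo%E]_(j < K) (dc2 (c j) x)%:E)%E
            | c in [set c : 'I_K -> GT k n |
                      injective c /\ forall j, grassk k n m (c j)]].

Definition Gamma (s : R) : R :=
  fine (\int[lebesgue_measure]_(x in [set x : R | (0 < x)%R])
          (powR x (s - 1) * expR (- x))%R%:E)%E.

Definition log2 (x : R) : R := ln x / ln 2.

Definition eta_gr (n m : nat) : R :=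
  let t := (m * (n - m))%N in
  if (2 * m <= n)%N then
    (t`!%:R)^-1 * \prod_(1 <= i < m.+1) ((n - i)`!%:R / (m - i)`!%:R)
  else
    (t`!%:R)^-1 * \prod_(1 <= i < (n - m).+1) ((n - i)`!%:R / (n - m - i)`!%:R).

End Grassmann.

(* Main.v *)
(* Let tau = kt, let F(r) be the mass of the set of points at squared
   distance at most r from a fixed point (it does not depend on the point, by
   invariance), and let D be the product over the k factors of the leading
   principal m x m minor of the projector.

   Volume of small balls.  If d is the squared distance to the span of the first
   m basis vectors, the spectral theorem gives 1 - d <= D <= exp(-d), so that
   F(r) is governed by the law of D near 1.  Differentiating the invariance of
   the measure under plane rotations at angle 0, and combining the result with
   Plucker-type relations between minors of a rank m matrix, yields a recursion
   for E[D^s]; hence E[D^s] s^tau tends to an explicit constant C.  Karamata's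
   Tauberian argument, run in comparison with the Beta(1, tau) law, turns this
   into F(r) ~ C r^tau / tau!.

   Lower bound.  For a code of size K, P(min d > r) >= 1 - K F(r); integrate up
   to the radius where K F(r) = 1.

   Upper bound.  For K independent uniform codewords, E[min d] is the integral
   of (1 - F)^K <= exp(-K F), and the integral of exp(-a r^tau) is
   Gamma(1/tau) a^(-1/tau) / tau.  A random code is replaced by a greedy one,
   one codeword at a time, with layer-cake sums in place of integrals.  *)
Require Import Defs.
From HB Require Import structures.
From mathcomp Require Import all_boot all_order all_algebra fingroup perm.
From mathcomp Require Import all_classical all_reals all_analysis.
From mathcomp Require Import complex measurable_realfun.
From mathcomp Require Import ring lra zify.
Import Order.TTheory GRing.Theory Num.Theory.
Import numFieldNormedType.Exports.
Local Open Scope classical_set_scope.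
Local Open Scope ring_scope.
Set Implicit Arguments.
Unset Strict Implicit.
Unset Printing Implicit Defensive.

(** * The Grassmannian as a set of projectors *)

(** The uniform law enters only through its invariance under [U(n)^k]; neither a density nor a
    product decomposition of [mu] is at hand. This is why the minor [D] replaces the distance: its
    moments obey an exact recursion that follows from invariance alone. The k factors are separated
    by a weight [h] that is blind to the factor being rotated, which does the work of independence.
    The constants: [E[D^s]] is [ratio s ^+ k], where each of the m rows decays like [s^-(n-m)],
    whence tau = k m (n-m), and the limit is C = (t! eta)^k with t = m (n-m). The Beta(1, tau) law
    has explicit tails [(1-c)^tau] and moments of order [tau! s^-tau], so comparing with it avoids
    any inversion of a transform, and the tau! in F is the quotient of the two limits. As Gamma(t+1)
    = t!, C / tau! is the base of the power in A. A code must have exactly K distinct words. The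
    greedy choice needs Fubini for pairs of points only, and each new word can avoid the earlier
    ones at arbitrarily small cost because small balls have small mass. *)

Section ComplexFacts.
Variable R : realType.
Local Notation C := R[i].
Local Notation cRe := (@complex.Re R).
Local Notation cIm := (@complex.Im R).
Local Notation toC := (real_complex R).

Lemma cRe_conj (z : C) : cRe (Num.conj z) = cRe z. Proof. by case: z. Qed.
Lemma cIm_conj (z : C) : cIm (Num.conj z) = - cIm z. Proof. by case: z. Qed.
Lemma cReD (x y : C) : cRe (x + y) = cRe x + cRe y. Proof. by case: x; case: y. Qed.
Lemma cImD (x y : C) : cIm (x + y) = cIm x + cIm y. Proof. by case: x; case: y. Qed.
Lemma cReN (x : C) : cRe (- x) = - cRe x. Proof. by case: x. Qed.
Lemma cImN (x : C) : cIm (- x) = - cIm x. Proof. by case: x. Qed.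
Lemma cReM (x y : C) : cRe (x * y) = cRe x * cRe y - cIm x * cIm y.
Proof. by case: x; case: y. Qed.
Lemma cImM (x y : C) : cIm (x * y) = cRe x * cIm y + cIm x * cRe y.
Proof. by case: x => a b; case: y => c d /=; rewrite [b * c]mulrC. Qed.
Lemma cRe_real (x : R) : cRe (toC x) = x. Proof. by []. Qed.
Lemma cIm_real (x : R) : cIm (toC x) = 0. Proof. by []. Qed.
Lemma cRe_sum (I : Type) (r : seq I) (P : pred I) (F : I -> C) :
  cRe (\sum_(i <- r | P i) F i) = \sum_(i <- r | P i) cRe (F i).
Proof. by elim/big_rec2 : _ => // i y1 y2 _ <-; rewrite cReD. Qed.
Lemma eqcP (x y : C) : cRe x = cRe y -> cIm x = cIm y -> x = y.
Proof. by case: x; case: y => a b c d /= -> ->. Qed.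
Lemma toCM (x y : R) : toC (x * y) = toC x * toC y. Proof. exact: rmorphM. Qed.
Lemma mul_conj (z : C) : z * Num.conj z = toC (cRe z ^+ 2 + cIm z ^+ 2).
Proof. by apply: eqcP; rewrite (cReM, cImM) cRe_conj cIm_conj /=; ring. Qed.
Lemma conj_toC (x : R) : Num.conj (toC x) = toC x.
Proof. by apply: eqcP; rewrite ?cRe_conj ?cIm_conj //= oppr0. Qed.

Lemma adjmxE p q (A : 'M[C]_(p, q)) : adjmx R A = (A ^t*)%sesqui.
Proof. by rewrite /adjmx map_trmx. Qed.
Lemma adjmxK p q (A : 'M[C]_(p, q)) : adjmx R (adjmx R A) = A.
Proof. by rewrite !adjmxE trmxCK. Qed.
Lemma adjmxM p q r (A : 'M[C]_(p, q)) (B : 'M[C]_(q, r)) :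
  adjmx R (A *m B) = adjmx R B *m adjmx R A.
Proof. by rewrite /adjmx map_mxM trmx_mul. Qed.
Lemma adjmxB p q (A B : 'M[C]_(p, q)) : adjmx R (A - B) = adjmx R A - adjmx R B.
Proof. by rewrite /adjmx map_mxB linearB. Qed.
Lemma adjmx1 n : adjmx R (1%:M : 'M[C]_n) = 1%:M.
Proof. by rewrite /adjmx map_mx1 trmx1. Qed.
Lemma adjmx_ij p q (A : 'M[C]_(p, q)) i j : adjmx R A i j = Num.conj (A j i).
Proof. by rewrite !mxE. Qed.
Lemma frob2E p q (A : 'M[C]_(p, q)) : toC (frob2 R A) = \tr (A *m adjmx R A).
Proof.
rewrite /frob2 rmorph_sum; apply: eq_bigr => i _; rewrite rmorph_sum mxE.
by apply: eq_bigr => j _; rewrite adjmx_ij mul_conj.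
Qed.
Lemma toC_inj : injective toC. Proof. by move=> x y [->]. Qed.

Lemma unitaryP n (U : 'M[C]_n) : unitary R U -> U *m adjmx R U = 1%:M.
Proof. by move=> h; apply: mulmx1C. Qed.
Lemma unitary_adj n (U : 'M[C]_n) : unitary R U -> unitary R (adjmx R U).
Proof. by move=> h; rewrite /unitary adjmxK; exact: unitaryP. Qed.
Lemma unitary1 n : unitary R (1%:M : 'M[C]_n).
Proof. by rewrite /unitary adjmx1 mulmx1. Qed.

Lemma frob2_unitary n (U A : 'M[C]_n) : unitary R U ->
  frob2 R (U *m A *m adjmx R U) = frob2 R A.
Proof.
move=> hU; apply: toC_inj; rewrite !frob2E !adjmxM adjmxK.
rewrite !mulmxA -(mulmxA _ _ U) hU mulmx1 mxtrace_mulC !mulmxA hU mul1mx.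
by [].
Qed.

Lemma grass_hermitian n m (P : 'M[C]_n) : grass R n m P ->
  [/\ adjmx R P = P, P *m P = P & \tr P = m%:R].
Proof.
move=> [Y [hY ->]]; split.
- by rewrite adjmxM adjmxK.
- by rewrite mulmxA -(mulmxA _ _ Y) hY mulmx1.
- by rewrite mxtrace_mulC hY mxtrace1.
Qed.

Definition proj0 n m : 'M[C]_n := pid_mx m.

Lemma adj_pid p q r : adjmx R (pid_mx r : 'M[C]_(p, q)) = pid_mx r.
Proof. by rewrite /adjmx map_pid_mx tr_pid_mx. Qed.

Lemma grass_proj0 n m : (m <= n)%N -> grass R n m (proj0 n m).
Proof.
move=> mn; exists (pid_mx m); rewrite adj_pid !mul_pid_mx; split.
  by rewrite minnn (minn_idPr _) // pid_mx_1.
by rewrite /proj0 !minnn.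
Qed.

Lemma grass_act n m (U P : 'M[C]_n) : unitary R U -> grass R n m P ->
  grass R n m (U *m P *m adjmx R U).
Proof.
move=> hU [Y [hY ->]]; exists (U *m Y); split.
  by rewrite adjmxM mulmxA -(mulmxA _ _ U) hU mulmx1.
by rewrite adjmxM !mulmxA.
Qed.

(** Equal numbers of [true] force equal numbers of [false], so the two tuples are permutations of
    each other. This reorders the 0/1 spectrum of a projector. *)
Lemma bool_perm n (b c : 'I_n -> bool) : (\sum_i b i = \sum_i c i)%N ->
  exists s : 'S_n, forall i, b (s i) = c i.
Proof.
move=> h.
have /tuple_permP[s hs] : perm_eq [tuple c i | i < n] [tuple b i | i < n].
  have H (f : 'I_n -> bool) : count_mem true [tuple f i | i < n] = (\sum_i f i)%N.
    rewrite -sum1_count big_tuple big_mkcond /=; apply: eq_bigr => i _.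
    by rewrite tnth_mktuple; case: (f i).
  have H' (f : 'I_n -> bool) :
      count_mem false [tuple f i | i < n] = (n - \sum_i f i)%N.
    rewrite -H -[X in (X - _)%N](size_tuple [tuple f i | i < n]).
    rewrite -(count_predC (pred1 true)) addKn; apply: eq_count => -[] //.
  by apply/allP => -[] _ /=; rewrite ?H ?H' h eqxx.
exists s => i.
have -> : c i = tnth [tuple c i | i < n] i by rewrite tnth_mktuple.
rewrite (tnth_nth false) hs -tnth_nth tnth_mktuple tnth_mktuple //.
Qed.

(** In a unitary eigenbasis idempotence forces eigenvalues 0 or 1, the trace counts the ones, and a
    permutation matrix moves them to the front. This is the transitivity of the unitary action. *)
Lemma hermitian_idem_trans n m (P : 'M[C]_n) : (m <= n)%N ->
  adjmx R P = P -> P *m P = P -> \tr P = m%:R ->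
  exists2 U, unitary R U & P = U *m proj0 n m *m adjmx R U.
Proof.
move=> mn hP PP trP.
have nP : P \is normalmx by apply/normalmxP; rewrite -adjmxE hP.
have /orthomx_spectralP := nP; set V := spectralmx P; set d := spectral_diag P => eP.
have Vu : V \is unitarymx := spectral_unitarymx P.
have Vun : V \in unitmx by apply: unitarymx_unit.
have eV : invmx V = adjmx R V by rewrite invmx_unitary // adjmxE.
clearbody V d.
have dd i : d 0 i * d 0 i = d 0 i.
  have : diag_mx d *m diag_mx d = diag_mx d.
    have e1 : diag_mx d = V *m P *m invmx V.
      by rewrite eP !mulmxA mulmxV // mul1mx -mulmxA mulmxV // mulmx1.
    rewrite e1 !mulmxA -(mulmxA _ _ V) mulVmx // mulmx1 -(mulmxA _ P P) PP //.
  by move=> /matrixP/(_ i i); rewrite mulmx_diag !mxE eqxx.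
have d01 i : d 0 i = (d 0 i != 0)%:R.
  have [->//|d0] := eqVneq (d 0 i) 0.
  by apply: (mulfI d0); rewrite dd mulr1.
have sumd : (\sum_i (d 0%R i != 0%R) = m)%N.
  have : \tr P = \sum_i d 0 i by rewrite eP mxtrace_mulC mulmxA mulmxV // mul1mx mxtrace_diag.
  rewrite trP (eq_bigr _ (fun i _ => d01 i)) -natr_sum => /eqP.
  by rewrite eqr_nat => /eqP.
have [s hs] : exists s : 'S_n, forall i, (d 0 (s i) != 0) = (i < m)%N.
  apply: (bool_perm (b := fun i => d 0 i != 0) (c := fun i => (i < m)%N)).
  rewrite sumd -(big_mkord xpredT (fun i => (i < m)%N : nat)).
  rewrite (big_cat_nat (n := m)) //= big_nat (eq_bigr (fun=> 1%N)); last first.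
    by move=> i /andP[_ ->].
  rewrite -big_nat sum_nat_const_nat subn0 muln1 big_nat big1 ?addn0 // => i /andP[mi _].
  by rewrite ltnNge mi.
exists (adjmx R V *m perm_mx s^-1).
  rewrite /unitary adjmxM adjmxK mulmxA -(mulmxA _ V).
  have -> : V *m adjmx R V = 1%:M by rewrite adjmxE; exact/unitarymxP.
  rewrite mulmx1 /adjmx map_perm_mx tr_perm_mx invgK -perm_mxM mulgV perm_mx1 //.
have -> : proj0 n m = perm_mx s *m diag_mx d *m perm_mx s^-1.
  rewrite -row_permE -col_permE; apply/matrixP => i j; rewrite !mxE.
  by rewrite (inj_eq perm_inj) [d 0 (s i)]d01 hs -mulr_natr val_eqE;
    case: (i == j); case: (_ < _)%N; rewrite ?mulr1 ?mulr0.
rewrite adjmxM adjmxK [adjmx R (perm_mx _)]/adjmx map_perm_mx tr_perm_mx invgK !mulmxA.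
have ss : perm_mx s^-1 *m perm_mx s = 1%:M :> 'M[C]_n by rewrite -perm_mxM mulVg perm_mx1.
by rewrite -!(mulmxA _ (perm_mx s^-1) (perm_mx s)) ss !mulmx1 {1}eP eV.
Qed.

(** Trades the existential over generator matrices for polynomial equations in the entries, from
    which measurability of the Grassmannian follows. *)
Lemma grassP n m (P : 'M[C]_n) : (m <= n)%N -> grass R n m P <->
  [/\ adjmx R P = P, P *m P = P & \tr P = m%:R].
Proof.
move=> mn; split; first exact: grass_hermitian.
move=> [h1 h2 h3]; have [U hU ->] := hermitian_idem_trans mn h1 h2 h3.
exact/grass_act/grass_proj0.
Qed.

Lemma grass_trans n m (P : 'M[C]_n) : (m <= n)%N -> grass R n m P ->
  exists2 U, unitary R U & P = U *m proj0 n m *m adjmx R U.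
Proof. by move=> mn /grass_hermitian[]; exact: hermitian_idem_trans. Qed.

Lemma frob2_proj n m (P Q : 'M[C]_n) : grass R n m P -> grass R n m Q ->
  frob2 R (P - Q) / 2 = m%:R - cRe (\tr (P *m Q)).
Proof.
move=> /grass_hermitian[aP PP tP] /grass_hermitian[aQ QQ tQ].
have : toC (frob2 R (P - Q)) = toC (2 * m%:R) - 2 * \tr (P *m Q).
  rewrite frob2E adjmxB aP aQ mulmxBl !mulmxBr PP QQ !linearB /= tP tQ.
  by rewrite (mxtrace_mulC Q P) toCM !rmorph_nat; ring.
move=> /(congr1 cRe); rewrite cReD cReN cReM cRe_real /= => ->.
by lra.
Qed.

Lemma mulmx_adj_ge0 p q (A : 'M[C]_(p, q)) i :
  exists2 x : R, 0 <= x & (A *m adjmx R A) i i = toC x.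
Proof.
exists (\sum_j (cRe (A i j) ^+ 2 + cIm (A i j) ^+ 2)).
  by apply: sumr_ge0 => j _; rewrite addr_ge0 ?sqr_ge0.
by rewrite mxE rmorph_sum; apply: eq_bigr => j _; rewrite adjmx_ij mul_conj.
Qed.

Lemma adjmx_sub p q p' q' (f : 'I_p' -> 'I_p) (g : 'I_q' -> 'I_q) (A : 'M[C]_(p, q)) :
  adjmx R (mxsub f g A) = mxsub g f (adjmx R A).
Proof. by apply/matrixP => i j; rewrite !mxE. Qed.

Lemma compress_psd n m (w : 'I_m -> 'I_n) (P : 'M[C]_n) :
  adjmx R P = P -> P *m P = P ->
  mxsub w w P = mxsub w id P *m adjmx R (mxsub w id P).
Proof. by move=> aP PP; rewrite adjmx_sub -mxsub_mul aP PP. Qed.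

(** The principal submatrices of [P] and of [1 - P] are both Gram matrices ([compress_psd]) and add
    up to the identity, so the eigenvalues [r i] lie in [0, 1]. For [P] of rank m they are the
    squared cosines of the principal angles with the coordinate subspace selected by [w]. *)
Lemma compress_spectrum n m (w : 'I_m -> 'I_n) (P : 'M[C]_n) : injective w ->
  adjmx R P = P -> P *m P = P ->
  exists r : 'I_m -> R, [/\ forall i, 0 <= r i <= 1,
    \det (mxsub w w P) = toC (\prod_i r i) &
    \tr (mxsub w w P) = toC (\sum_i r i)].
Proof.
move=> wi aP PP; set N := mxsub w w P.
have aP' : adjmx R (1%:M - P) = 1%:M - P by rewrite adjmxB adjmx1 aP.
have PP' : (1%:M - P) *m (1%:M - P) = 1%:M - P.
  by rewrite mulmxBl !mulmxBr !mulmx1 !mul1mx PP subrr subr0.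
have N' : mxsub w w (1%:M - P) = 1%:M - N.
  by apply/matrixP => i j; rewrite !mxE (inj_eq wi).
have aN : adjmx R N = N by rewrite adjmx_sub aP.
have nN : N \is normalmx by apply/normalmxP; rewrite -adjmxE aN.
have /orthomx_spectralP := nN; set V := spectralmx N; set d := spectral_diag N => eN.
have Vu : V \is unitarymx := spectral_unitarymx N.
have Vun : V \in unitmx by apply: unitarymx_unit.
have eV : invmx V = adjmx R V by rewrite invmx_unitary // adjmxE.
clearbody V d.
have VV : V *m adjmx R V = 1%:M by rewrite adjmxE; exact/unitarymxP.
have eD : diag_mx d = V *m N *m adjmx R V.
  by rewrite eN eV !mulmxA VV mul1mx -mulmxA VV mulmx1.
have h0 i : exists2 x : R, 0 <= x & d 0 i = toC x.
  have -> : d 0 i = diag_mx d i i by rewrite mxE eqxx.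
  rewrite eD /N compress_psd // !mulmxA -mulmxA -adjmxM.
  exact: mulmx_adj_ge0.
have h1 i : exists2 x : R, 0 <= x & 1 - d 0 i = toC x.
  have -> : 1 - d 0 i = (V *m (1%:M - N) *m adjmx R V) i i.
    by rewrite mulmxBr mulmx1 mulmxBl VV -eD !mxE eqxx.
  rewrite -N' compress_psd // !mulmxA -mulmxA -adjmxM.
  exact: mulmx_adj_ge0.
exists (fun i => cRe (d 0 i)); split.
- move=> i; have [x x0 ex] := h0 i; have [y y0] := h1 i.
  by rewrite ex => /(congr1 cRe); rewrite cReD cReN !cRe_real /=; lra.
- rewrite eN !det_mulmx mulrAC -det_mulmx mulVmx // det1 mul1r det_diag rmorph_prod.
  by apply: eq_bigr => i _ /=; have [x _ ->] := h0 i.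
- rewrite eN mxtrace_mulC mulmxA mulmxV // mul1mx mxtrace_diag rmorph_sum.
  by apply: eq_bigr => i _ /=; have [x _ ->] := h0 i.
Qed.

(** Applied to the [r i] of [compress_spectrum], it links minor and distance: the product is the
    determinant, the sum of the [1 - r i] is the squared chordal distance. *)
Lemma prod_ge_1sub (I : Type) (s : seq I) (r : I -> R) :
  (forall i, 0 <= r i <= 1) ->
  1 - \sum_(i <- s) (1 - r i) <= \prod_(i <- s) r i <= expR (- \sum_(i <- s) (1 - r i)).
Proof.
move=> h; elim: s => [|i s /andP[ih1 ih2]]; first by rewrite !big_nil subr0 oppr0 expR0 lexx.
have h0 : 0 <= \prod_(i <- s) r i by apply: prodr_ge0 => j _; case/andP: (h j).
have h1 : \prod_(i <- s) r i <= 1.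
  by apply: prodr_ile1 => j _; exact: h.
rewrite !big_cons; have /andP[ri0 ri1] := h i.
set S := \sum_(j <- s) _ in ih1 ih2 *; set p := \prod_(j <- s) _ in h0 h1 ih1 ih2 *.
apply/andP; split; first by nra.
rewrite opprD expRD; apply: ler_pM => //.
by have := expR_ge1Dx (- (1 - r i)); lra.
Qed.

End ComplexFacts.

(** * Expectations of bounded random variables *)

Section Expectation.
Context d (T : measurableType d) (R : realType) (P : probability T R) (S : set T).
Hypotheses (mS : measurable S) (PS : P S = 1%E).
Implicit Types f g : T -> R.

(** Bounded measurable functions: closed under sums and products and integrable for any probability,
    which settles integrability of all polynomial expressions at once. *)
Definition good f := measurable_fun S f /\ exists M : R, forall x, S x -> `|f x| <= M.
Definition Ex f : R := \int[P]_(x in S) f x.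

Lemma good_cst c : good (fun=> c).
Proof. by split; [exact: measurable_cst|exists `|c| => x _]. Qed.
Lemma goodD f g : good f -> good g -> good (fun x => f x + g x).
Proof.
move=> [mf [M hM]] [mg [N hN]]; split; first exact: measurable_funD.
exists (M + N) => x Sx; apply: le_trans (ler_normD _ _) _; apply: lerD; auto.
Qed.
Lemma goodM f g : good f -> good g -> good (fun x => f x * g x).
Proof.
move=> [mf [M hM]] [mg [N hN]]; split; first exact: measurable_funM.
by exists (M * N) => x Sx; rewrite normrM; apply: ler_pM => //; auto.
Qed.
Lemma good_ext f g : (forall x, S x -> f x = g x) -> good f -> good g.
Proof.
move=> fg [mf [M hM]]; split; last by exists M => x Sx; rewrite -fg //; exact: hM.
by apply: eq_measurable_fun mf => x; rewrite inE; exact: fg.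
Qed.
Lemma goodZ c f : good f -> good (fun x => c * f x).
Proof. exact: goodM (good_cst c). Qed.
Lemma goodN f : good f -> good (fun x => - f x).
Proof. by move=> /(goodZ (-1)); apply: good_ext => x _; rewrite mulN1r. Qed.
Lemma goodB f g : good f -> good g -> good (fun x => f x - g x).
Proof. by move=> gf gg; apply: goodD => //; exact: goodN. Qed.
Lemma good_sum (I : Type) (s : seq I) (Q : pred I) (F : I -> T -> R) :
  (forall i, good (F i)) -> good (fun x => \sum_(i <- s | Q i) F i x).
Proof.
move=> h; elim: s => [|i s ih].
  by apply: good_ext (good_cst 0) => x _; rewrite big_nil.
case Qi : (Q i).
  by apply: good_ext (goodD (h i) ih) => x _; rewrite big_cons Qi.
by apply: good_ext ih => x _; rewrite big_cons Qi.
Qed.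
Lemma good_prod (I : Type) (s : seq I) (Q : pred I) (F : I -> T -> R) :
  (forall i, good (F i)) -> good (fun x => \prod_(i <- s | Q i) F i x).
Proof.
move=> h; elim: s => [|i s ih].
  by apply: good_ext (good_cst 1) => x _; rewrite big_nil.
case Qi : (Q i).
  by apply: good_ext (goodM (h i) ih) => x _; rewrite big_cons Qi.
by apply: good_ext ih => x _; rewrite big_cons Qi.
Qed.
Lemma goodX f p : good f -> good (fun x => f x ^+ p).
Proof.
move=> gf; elim: p => [|p ih]; first by apply: good_ext (good_cst 1) => x _; rewrite expr0.
by apply: good_ext (goodM gf ih) => x _; rewrite exprS.
Qed.
Lemma good_indic (A : set T) : measurable (A `&` S) -> good (\1_A).
Proof.
move=> mA; split.
  apply: (eq_measurable_fun (\1_(A `&` S) : T -> R)).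
    by move=> x; rewrite inE => Sx; rewrite !indicE in_setI [x \in S]mem_set ?andbT.
  exact: measurable_indic.
by exists 1 => x _; rewrite indicE; case: (_ \in _); rewrite ?normr1 ?normr0.
Qed.

Lemma good_intg f : good f -> P.-integrable S (EFin \o f).
Proof.
move=> [mf [M hM]]; apply: measurable_bounded_integrable => //.
  exact: (le_lt_trans (probability_le1 P mS) (ltry _)).
by exists M; split; [exact: num_real|move=> y My x Sx /=; exact: le_trans (hM _ Sx) (ltW My)].
Qed.
Lemma Ex_cst c : Ex (fun=> c) = c.
Proof. by rewrite /Ex Rintegral_cst // [X in fine X](_ : _ = 1%E) ?mulr1 //; exact: PS. Qed.
Lemma ExD f g : good f -> good g -> Ex (fun x => f x + g x) = Ex f + Ex g.
Proof. by move=> gf gg; rewrite /Ex RintegralD //; exact: good_intg. Qed.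
Lemma ExB f g : good f -> good g -> Ex (fun x => f x - g x) = Ex f - Ex g.
Proof. by move=> gf gg; rewrite /Ex RintegralB //; exact: good_intg. Qed.
Lemma ExZ c f : good f -> Ex (fun x => c * f x) = c * Ex f.
Proof. by move=> gf; rewrite /Ex RintegralZl //; exact: good_intg. Qed.
Lemma eq_Ex f g : (forall x, S x -> f x = g x) -> Ex f = Ex g.
Proof. by move=> fg; apply: eq_Rintegral => x; rewrite inE; exact: fg. Qed.
Lemma le_Ex f g : good f -> good g -> (forall x, S x -> f x <= g x) -> Ex f <= Ex g.
Proof. by move=> gf gg fg; apply: le_Rintegral => //; exact: good_intg. Qed.
Lemma Ex_sum (I : Type) (s : seq I) (Q : pred I) (F : I -> T -> R) :
  (forall i, good (F i)) ->
  Ex (fun x => \sum_(i <- s | Q i) F i x) = \sum_(i <- s | Q i) Ex (F i).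
Proof.
move=> h; elim: s => [|i s ih].
  by rewrite big_nil -[RHS](Ex_cst 0); apply: eq_Ex => x _; rewrite big_nil.
rewrite big_cons; case Qi : (Q i); last by rewrite -ih; apply: eq_Ex => x _; rewrite big_cons Qi.
rewrite -ih -ExD //; last exact: good_sum.
by apply: eq_Ex => x _; rewrite big_cons Qi.
Qed.
Lemma Ex_indic (A : set T) : measurable (A `&` S) -> Ex (\1_A) = fine (P (A `&` S)).
Proof.
move=> mA; rewrite /Ex (@eq_Rintegral _ _ _ P S (\1_(A `&` S))).
  by rewrite /Rintegral integral_indic // -setIA setIid.
by move=> x Sx; rewrite !indicE in_setI Sx andbT.
Qed.
Lemma Ex_norm_le f c : good f -> (forall x, S x -> `|f x| <= c) -> `|Ex f| <= c.
Proof.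
move=> gf h; rewrite ler_norml; apply/andP; split.
  by rewrite -(Ex_cst (- c)); apply: le_Ex => // [|x /h]; [exact: good_cst|rewrite ler_norml => /andP[]].
by rewrite -(Ex_cst c); apply: le_Ex => // [|x /h]; [exact: good_cst|rewrite ler_norml => /andP[]].
Qed.
Lemma Ex_ge0 f : (forall x, S x -> 0 <= f x) -> 0 <= Ex f.
Proof. exact: Rintegral_ge0. Qed.

(** Random polynomials with a deterministic degree bound, so that expectation commutes with the
    finite sum over coefficients. *)
Definition goodp (q : T -> {poly R}) :=
  (exists N, forall x, (size (q x) <= N)%N) /\ forall i, good (fun x => (q x)`_i).

Lemma goodp_cst c : good c -> goodp (fun x => (c x)%:P).
Proof.
move=> gc; split; first by exists 1%N => x; exact: size_polyC_leq1.
move=> [|i]; first by apply: good_ext gc => x _; rewrite coefC.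
by apply: good_ext (good_cst 0) => x _; rewrite coefC.
Qed.
Lemma goodp_poly (p : {poly R}) : goodp (fun=> p).
Proof. by split; [exists (size p)|move=> i; exact: good_cst]. Qed.
Lemma goodpD p q : goodp p -> goodp q -> goodp (fun x => p x + q x).
Proof.
move=> [[N hN] gp] [[M hM] gq]; split.
  exists (maxn N M) => x; apply: leq_trans (size_polyD _ _) _.
  by rewrite geq_max (leq_trans (hN x)) ?leq_maxl // (leq_trans (hM x)) ?leq_maxr.
by move=> i; apply: good_ext (goodD (gp i) (gq i)) => x _; rewrite coefD.
Qed.
Lemma goodpM p q : goodp p -> goodp q -> goodp (fun x => p x * q x).
Proof.
move=> [[N hN] gp] [[M hM] gq]; split.
  exists (N + M)%N => x; apply: leq_trans (size_polyMleq _ _) _.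
  by rewrite (leq_trans (leq_pred _)) // leq_add.
move=> i; have h (j : 'I_i.+1) := goodM (gp j) (gq (i - j)%N).
by apply: good_ext (good_sum (index_enum _) xpredT h) => x _; rewrite coefM.
Qed.
Lemma goodpX p e : goodp p -> goodp (fun x => p x ^+ e).
Proof.
move=> gp; elim: e => [|e ih].
  rewrite (_ : (fun _ => _) = fun=> 1); first exact: goodp_poly.
  by apply/funext => x; rewrite expr0.
rewrite (_ : (fun _ => _) = fun x => p x * p x ^+ e); first exact: goodpM.
by apply/funext => x; rewrite exprS.
Qed.
Lemma poly_eq_horner (p q : {poly R}) : (forall x, p.[x] = q.[x]) -> p = q.
Proof.
move=> h; apply/eqP; rewrite -subr_eq0; apply/eqP.
apply: (@roots_geq_poly_eq0 _ _ [seq i%:R | i <- iota 0 (size (p - q))]).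
- by apply/allP => x _; rewrite /root !hornerE h subrr.
- by rewrite map_inj_uniq ?iota_uniq // => x y /eqP; rewrite eqr_nat => /eqP.
- by rewrite size_map size_iota.
Qed.
(** Both sides are polynomials in [th] that agree everywhere, hence coefficientwise. Used with
    [i := 1], it performs the differentiation at angle 0 without differentiating under the
    integral. *)
Lemma Ex_coef q (r : {poly R}) i : goodp q ->
  (forall th, Ex (fun x => (q x).[th]) = r.[th]) -> Ex (fun x => (q x)`_i) = r`_i.
Proof.
move=> [[N hN] gq] h.
have -> : r = \poly_(j < N) Ex (fun x => (q x)`_j).
  apply: poly_eq_horner => th; rewrite -h horner_poly.
  have h' (j : 'I_N) := goodZ (th ^+ j) (gq j).
  transitivity (Ex (fun x => \sum_(j < N) th ^+ j * (q x)`_j)).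
    apply: eq_Ex => x _; rewrite (horner_coef_wide _ (hN x)).
    by apply: eq_bigr => j _; rewrite mulrC.
  by rewrite Ex_sum //; apply: eq_bigr => j _; rewrite ExZ // mulrC.
rewrite coef_poly; case: ltnP => // Ni.
transitivity (Ex (fun=> 0)); last exact: Ex_cst.
by apply: eq_Ex => x _; rewrite nth_default // (leq_trans (hN x)).
Qed.

End Expectation.
Arguments good_intg {d T R P S} mS {f}.
Arguments Ex_cst {d T R P S} mS PS c.
Arguments ExD {d T R P S} mS {f g}.
Arguments ExB {d T R P S} mS {f g}.
Arguments ExZ {d T R P S} mS c {f}.
Arguments le_Ex {d T R P S} mS {f g}.
Arguments Ex_sum {d T R P S} mS PS {I} s Q F.
Arguments Ex_norm_le {d T R P S} mS PS {f c}.
Arguments Ex_coef {d T R P S} mS PS {q r i}.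

(** * Minors of matrices of rank m and plane rotations *)

Section Minors.
Variable F : fieldType.

(** If the corner block is nonsingular, elimination by a block triangular matrix gives the formula.
    In general [A] is replaced by [A + 'X], whose determinant is a characteristic polynomial, hence
    monic and nonzero, and the resulting polynomial identity is evaluated at 0. *)
Lemma det_bordered j (A : 'M[F]_j) (b : 'M[F]_(j, 1)) (c : 'M[F]_(1, j)) (d : 'M[F]_1) :
  \det (block_mx A b c d) = d 0 0 * \det A - (c *m \adj A *m b) 0 0.
Proof.
have key (K : idomainType) (A' : 'M[K]_j) (b' : 'M[K]_(j, 1)) (c' : 'M[K]_(1, j))
    (d' : 'M[K]_1) : \det A' != 0 ->
    \det (block_mx A' b' c' d') = d' 0 0 * \det A' - (c' *m \adj A' *m b') 0 0.
  move=> dA; apply: (mulfI dA).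
  have := det_mulmx (block_mx 1%:M 0 (- (c' *m \adj A')) (\det A')%:M) (block_mx A' b' c' d').
  rewrite mulmx_block det_lblock det1 mul1r det_scalar1 => <-.
  rewrite !mul1mx !mul0mx !addr0 !mulNmx -(mulmxA c' (\adj A') A') mul_adj_mx mul_mx_scalar mul_scalar_mx addNr.
  rewrite det_ublock det_mx11 !mxE; congr (_ * _).
  rewrite addrC; congr (_ - _).
  by rewrite big_ord1 !mxE eqxx mulr1n mulrC.
pose A' := map_mx polyC A + 'X%:M.
have dA' : \det A' != 0.
  have -> : A' = char_poly_mx (- A).
    by rewrite /char_poly_mx map_mxN opprK addrC.
  by apply: monic_neq0; exact: char_poly_monic.
have := key _ A' (map_mx polyC b) (map_mx polyC c) (map_mx polyC d) dA'.
move=> /(congr1 (horner_eval 0)).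
have evC p q (B : 'M[F]_(p, q)) : map_mx (horner_eval 0) (map_mx polyC B) = B.
  by apply/matrixP => x y; rewrite !mxE /horner_eval hornerC.
have evA : map_mx (horner_eval 0) A' = A.
  by apply/matrixP => x y; rewrite !mxE /horner_eval !hornerE hornerMn hornerX mul0rn addr0.
rewrite -det_map_mx map_block_mx !evC evA => ->.
rewrite rmorphB rmorphM /= -det_map_mx evA mxE /horner_eval hornerC; congr (_ - _).
transitivity (map_mx (horner_eval 0) (map_mx polyC c *m \adj A' *m map_mx polyC b) 0 0).
  by rewrite [RHS]mxE.
by rewrite !map_mxM map_mx_adj !evC evA.
Qed.

Definition ext j n (w : 'I_j -> 'I_n) (u : 'I_n) (i : 'I_(j + 1)) : 'I_n :=
  match fintype.split i with inl a => w a | inr _ => u end.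

(** The minor with rows [w, u] and columns [w, v] (see [det_ext]), in a form that is visibly linear
    in the border row and in the border column. *)
Definition bminor j n (w : 'I_j -> 'I_n) (P : 'M[F]_n) (u v : 'I_n) : F :=
  P u v * \det (mxsub w w P) -
  \sum_a \sum_b P u (w a) * \adj (mxsub w w P) a b * P (w b) v.

Lemma det_ext j n (w : 'I_j -> 'I_n) (P : 'M[F]_n) u v :
  \det (mxsub (ext w u) (ext w v) P) = bminor w P u v.
Proof.
have -> : mxsub (ext w u) (ext w v) P =
    block_mx (mxsub w w P) (mxsub w (fun=> v) P) (mxsub (fun=> u) w P) (mxsub (fun=> u) (fun=> v) P).
  apply/matrixP => a b; rewrite -[a]splitK -[b]splitK.
  by case: (fintype.split a) => a'; case: (fintype.split b) => b';
    rewrite [LHS]mxE /ext !unsplitK /= ?block_mxEul ?block_mxEur ?block_mxEdl ?block_mxEdr !mxE.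
rewrite det_bordered mxE /bminor; congr (_ - _).
rewrite -mulmxA mxE; apply: eq_bigr => a _; rewrite !mxE big_distrr /=.
by apply: eq_bigr => b _; rewrite !mxE mulrA.
Qed.

Lemma det_widenS j j' n (h : (j' <= n)%N) (h' : (j <= n)%N) (P : 'M[F]_n) (u : 'I_n) :
  (j' = j + 1)%N -> u = j :> nat ->
  \det (mxsub (widen_ord h) (widen_ord h) P) = bminor (widen_ord h') P u u.
Proof.
move=> e; subst j' => uj; rewrite -det_ext.
have e' : widen_ord h =1 ext (widen_ord h') u.
  move=> i; apply/val_inj; rewrite /ext /=.
  by case: splitP => a /= ->; rewrite ?ord1 /= ?addn0 ?uj.
by congr (\det _); apply/matrixP => a b; rewrite !mxE !e'.
Qed.

Lemma det_mul_thin p q (A : 'M[F]_(p, q)) (B : 'M[F]_(q, p)) : (q < p)%N ->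
  \det (A *m B) = 0.
Proof.
move=> qp; apply/eqP; apply: contraTT qp => d0.
have : \rank (A *m B) = p by apply: mxrank_unit; rewrite unitmxE unitfE.
by rewrite -leqNgt => {1}<-; rewrite (leq_trans (mxrankM_maxl _ _)) // rank_leq_col.
Qed.

Lemma bminor_rank n m (w : 'I_m -> 'I_n) (Y : 'M[F]_(n, m)) (Z : 'M[F]_(m, n)) u v :
  bminor w (Y *m Z) u v = 0.
Proof. by rewrite -det_ext mxsub_mul det_mul_thin // addn1. Qed.

(** Let [A] be the block of [P] on [w]. Since [P *m P = P], summing over [u] turns the correction
    term into the trace of [\adj A *m A], which is [j * \det A]; the first term contributes
    [\tr P]. *)
Lemma bminor_trace j n m (w : 'I_j -> 'I_n) (P : 'M[F]_n) : P *m P = P -> \tr P = m%:R ->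
  \sum_u bminor w P u u = (m%:R - j%:R) * \det (mxsub w w P).
Proof.
move=> PP tP; rewrite /bminor sumrB -big_distrl /= -/(mxtrace P) tP mulrBl; congr (_ - _).
rewrite exchange_big /=.
have -> : j%:R * \det (mxsub w w P) = \tr (\adj (mxsub w w P) *m mxsub w w P).
  by rewrite mul_adj_mx mxtrace_scalar mulr_natl.
apply: eq_bigr => a _; rewrite exchange_big mxE /=; apply: eq_bigr => b _.
rewrite [mxsub _ _ _ b a]mxE.
have -> : P (w b) (w a) = \sum_u P (w b) u * P u (w a) by rewrite -[in LHS]PP mxE.
rewrite big_distrr /=; apply: eq_bigr => u _.
by ring.
Qed.

(** Two equal rows; in the expanded form this is the adjugate identity for the block on [w]. *)
Lemma bminor_row j n (w : 'I_j -> 'I_n) (P : 'M[F]_n) a v : bminor w P (w a) v = 0.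
Proof.
rewrite /bminor; apply/eqP; rewrite subr_eq0; apply/eqP.
rewrite exchange_big /= (bigD1 a) //= [X in _ + X]big1 ?addr0.
  rewrite -big_distrl /= mulrC; congr (_ * _).
  have := mul_mx_adj (mxsub w w P) => /matrixP/(_ a a); rewrite !mxE eqxx mulr1n => <-.
  by apply: eq_bigr => b _; rewrite !mxE.
move=> b ba; rewrite -big_distrl /=.
have := mul_mx_adj (mxsub w w P) => /matrixP/(_ a b); rewrite !mxE eq_sym (negbTE ba) mulr0n => h.
rewrite [X in X * _](_ : _ = 0) ?mul0r // -[RHS]h.
by apply: eq_bigr => c _; rewrite !mxE.
Qed.

(** The hypothesis says that [U] leaves the rows in [w] alone, so only the border row changes, and
    the bordered minor is linear in it. *)
Lemma bminor_mull j n (w : 'I_j -> 'I_n) (U P : 'M[F]_n) x y :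
  (forall a z, (U *m P) (w a) z = P (w a) z) ->
  bminor w (U *m P) x y = \sum_u U x u * bminor w P u y.
Proof.
move=> h; have hA : mxsub w w (U *m P) = mxsub w w P.
  by apply/matrixP => a b; rewrite [LHS]mxE h mxE.
rewrite /bminor hA mxE.
under [RHS]eq_bigr => u _ do rewrite mulrBr.
rewrite sumrB big_distrl /=; congr (_ - _).
  by apply: eq_bigr => u _; rewrite mulrA.
under [RHS]eq_bigr => u _ do (rewrite mulr_sumr; under eq_bigr => a _ do rewrite mulr_sumr).
rewrite [RHS]exchange_big; apply: eq_bigr => a _ /=; rewrite [RHS]exchange_big; apply: eq_bigr => b _ /=.
rewrite h mxE !big_distrl /=; apply: eq_bigr => u _; ring.
Qed.

Lemma bminor_mulr j n (w : 'I_j -> 'I_n) (P V : 'M[F]_n) x y :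
  (forall b z, (P *m V) z (w b) = P z (w b)) ->
  bminor w (P *m V) x y = \sum_v bminor w P x v * V v y.
Proof.
move=> h; have hA : mxsub w w (P *m V) = mxsub w w P.
  by apply/matrixP => a b; rewrite [LHS]mxE h mxE.
rewrite /bminor hA mxE.
under [RHS]eq_bigr => u _ do rewrite mulrBl.
rewrite sumrB big_distrl /=; congr (_ - _).
  by apply: eq_bigr => u _; rewrite mulrAC.
under [RHS]eq_bigr => u _ do (rewrite mulr_suml; under eq_bigr => a _ do rewrite mulr_suml).
rewrite [RHS]exchange_big; apply: eq_bigr => a _ /=; rewrite [RHS]exchange_big; apply: eq_bigr => b _ /=.
rewrite h [(P *m V) (w b) y]mxE mulr_sumr; apply: eq_bigr => u _; by rewrite !mulrA.
Qed.

Lemma bminor_sub j n (w : 'I_j -> 'I_n) (P : 'M[F]_n) (f : 'I_n -> 'I_n) x y :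
  (forall a, f (w a) = w a) -> bminor w (mxsub f f P) x y = bminor w P (f x) (f y).
Proof.
move=> h; have hA : mxsub w w (mxsub f f P) = mxsub w w P.
  by apply/matrixP => a b; rewrite !mxE !h.
rewrite /bminor hA mxE; congr (_ - _); apply: eq_bigr => a _; apply: eq_bigr => b _.
by rewrite !mxE !h.
Qed.

Lemma det_sub_perm m n (w : 'I_m -> 'I_n) (P : 'M[F]_n) (s : 'S_m) :
  \det (mxsub (w \o s) (w \o s) P) = \det (mxsub w w P).
Proof.
have -> : mxsub (w \o s) (w \o s) P = row_perm s (col_perm s (mxsub w w P)).
  by apply/matrixP => a b; rewrite !mxE.
rewrite row_permE col_permE !det_mulmx !det_perm odd_permV.
by rewrite mulrCA -expr2 sqrr_sign mulr1.
Qed.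

Definition rowrep m n (w : 'I_m -> 'I_n) (l : 'I_m) (q : 'I_n) (i : 'I_m) : 'I_n :=
  if i == l then q else w i.

(** Row [w l] is exchanged for row [q] while the columns stay: the term that a rotation in the plane
    ([w l], [q]) brings into the minor on [w] to first order. *)
Definition wminor m n (w : 'I_m -> 'I_n) (P : 'M[F]_n) (l : 'I_m) (q : 'I_n) : F :=
  \det (mxsub (rowrep w l q) w P).

Lemma wminorE m n (w : 'I_m -> 'I_n) (P : 'M[F]_n) (l : 'I_m) (q : 'I_n) :
  wminor w P l q = \sum_b P q (w b) * \adj (mxsub w w P) b l.
Proof.
rewrite /wminor (expand_det_row _ l); apply: eq_bigr => b _.
rewrite !mxE /rowrep eqxx; congr (_ * _).
rewrite /cofactor; congr (_ * \det _); apply/matrixP => x y; rewrite !mxE.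
by rewrite eq_sym (negbTE (neq_lift _ _)).
Qed.

(** Cramer's rule: [P] has rank at most m, so the bordered minor of size m + 1 vanishes, and its
    expansion writes row [q] of [P] as a combination of the rows [w l], up to the factor
    [\det (mxsub w w P)]. *)
Lemma wminor_sum n m (w : 'I_m -> 'I_n) (Y : 'M[F]_(n, m)) (Z : 'M[F]_(m, n)) q v :
  let P := Y *m Z in
  \sum_l wminor w P l q * P (w l) v = \det (mxsub w w P) * P q v.
Proof.
move=> P; have := bminor_rank w Y Z q v; rewrite -/P /bminor => /eqP.
rewrite subr_eq0 => /eqP; rewrite mulrC => ->.
rewrite exchange_big /=; apply: eq_bigr => l _; rewrite wminorE big_distrl //=.
Qed.

(** A bordered minor is linear in its border row, so it obeys the same relation between rows as the
    entries of [P] in [wminor_sum]. *)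
Lemma wminor_bminor j n m (w' : 'I_j -> 'I_n) (w : 'I_m -> 'I_n)
    (Y : 'M[F]_(n, m)) (Z : 'M[F]_(m, n)) q v :
  let P := Y *m Z in
  \sum_l wminor w P l q * bminor w' P (w l) v = \det (mxsub w w P) * bminor w' P q v.
Proof.
move=> P; rewrite /bminor mulrBr mulrA -wminor_sum -/P big_distrl /=.
rewrite (eq_bigr (fun l => wminor w P l q * P (w l) v * \det (mxsub w' w' P) -
  \sum_a \sum_b wminor w P l q * P (w l) (w' a) * (\adj (mxsub w' w' P) a b * P (w' b) v))); last first.
  move=> l _; rewrite mulrBr mulrA; congr (_ - _); rewrite big_distrr; apply: eq_bigr => a _.
  by rewrite big_distrr; apply: eq_bigr => b _ /=; ring.
rewrite sumrB; congr (_ - _); rewrite exchange_big big_distrr /=; apply: eq_bigr => a _.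
rewrite exchange_big big_distrr /=; apply: eq_bigr => b _.
by rewrite -big_distrl /= wminor_sum -/P; ring.
Qed.

End Minors.

(** * Plane rotations and their action on minors *)

Section Rotations.
Variable R : realType.
Local Notation C := R[i].
Local Notation cRe := (@complex.Re R).
Local Notation cIm := (@complex.Im R).
Local Notation toC := (real_complex R).

Definition rotmx n (a b : 'I_n) (c : R) (be : C) : 'M[C]_n :=
  \matrix_(x, y) if x == a then (toC c *+ (y == a) + be *+ (y == b))
                 else if x == b then (- Num.conj be *+ (y == a) + toC c *+ (y == b))
                 else (x == y)%:R.

Section fixab.
Variables (n : nat) (a b : 'I_n) (c : R) (be : C).
Hypothesis ab : a != b.
Local Notation U := (rotmx a b c be).

Lemma sum_two (al ga : C) (f : 'I_n -> C) :
  \sum_u (al *+ (u == a) + ga *+ (u == b)) * f u = al * f a + ga * f b.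
Proof.
under eq_bigr => u _ do rewrite mulrDl !mulrnAl.
rewrite big_split /=; congr (_ + _).
  by rewrite (bigD1 a) //= eqxx big1 ?addr0 ?mulr1n // => u /negbTE ->.
by rewrite (bigD1 b) //= eqxx big1 ?addr0 ?mulr1n // => u /negbTE ->.
Qed.

Lemma rot_suma (f : 'I_n -> C) : \sum_u U a u * f u = toC c * f a + be * f b.
Proof. by rewrite -sum_two; apply: eq_bigr => u _; rewrite mxE eqxx. Qed.

Lemma rot_sumb (f : 'I_n -> C) : \sum_u U b u * f u = - Num.conj be * f a + toC c * f b.
Proof.
by rewrite -sum_two; apply: eq_bigr => u _; rewrite mxE eqxx eq_sym (negbTE ab).
Qed.

Lemma rot_sumx x (f : 'I_n -> C) : x != a -> x != b -> \sum_u U x u * f u = f x.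
Proof.
move=> xa xb; rewrite (bigD1 x) //= mxE (negbTE xa) (negbTE xb) eqxx mul1r big1 ?addr0 //.
by move=> u ux; rewrite mxE (negbTE xa) (negbTE xb) eq_sym (negbTE ux) mul0r.
Qed.

Let ba : (b == a) = false. Proof. by rewrite eq_sym (negbTE ab). Qed.

Lemma rotaa : U a a = toC c.
Proof. by rewrite mxE eqxx (negbTE ab) mulr0n mulr1n addr0. Qed.
Lemma rotab : U a b = be.
Proof. by rewrite mxE !eqxx ba mulr0n mulr1n add0r. Qed.
Lemma rotba : U b a = - Num.conj be.
Proof. by rewrite mxE !eqxx ba (negbTE ab) mulr0n mulr1n addr0. Qed.
Lemma rotbb : U b b = toC c.
Proof. by rewrite mxE !eqxx ba mulr0n mulr1n add0r. Qed.
Lemma rotay y : y != a -> y != b -> U a y = 0.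
Proof. by move=> ya yb; rewrite mxE eqxx (negbTE ya) (negbTE yb) mulr0n addr0. Qed.
Lemma rotby y : y != a -> y != b -> U b y = 0.
Proof. by move=> ya yb; rewrite mxE eqxx ba (negbTE ya) (negbTE yb) mulr0n addr0. Qed.
Lemma rotxy x y : x != a -> x != b -> U x y = (x == y)%:R.
Proof. by move=> xa xb; rewrite mxE (negbTE xa) (negbTE xb). Qed.

Lemma rot_unitary : toC (c ^+ 2) + be * Num.conj be = 1 -> unitary R U.
Proof.
rewrite expr2 toCM => h; rewrite -[U]adjmxK; apply: unitary_adj; rewrite /unitary adjmxK.
apply/matrixP => x y; rewrite mxE.
under eq_bigr => u _ do rewrite adjmx_ij.
case: (eqVneq x a) => [->|xa]; last case: (eqVneq x b) => [->|xb].
- rewrite rot_suma [RHS]mxE; case: (eqVneq y a) => [->|ya]; last case: (eqVneq y b) => [->|yb].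
  + by rewrite rotaa rotab conj_toC h ?eqxx.
  + by rewrite rotba rotbb ?(negbTE ab) conj_toC rmorphN /= conjCK mulr0n; ring.
  + by rewrite !rotxy // (negbTE ya) (negbTE yb) ?(eq_sym a) ?(negbTE ya) rmorph0 !mulr0 addr0 mulr0n.
- rewrite rot_sumb [RHS]mxE; case: (eqVneq y a) => [->|ya]; last case: (eqVneq y b) => [->|yb].
  + by rewrite rotaa rotab ?ba conj_toC mulr0n; ring.
  + by rewrite rotba rotbb ?eqxx conj_toC rmorphN /= conjCK mulr1n -h; ring.
  + by rewrite !rotxy // (negbTE ya) (negbTE yb) ?(eq_sym b) ?(negbTE yb) rmorph0 !mulr0 addr0 mulr0n.
- rewrite rot_sumx // [RHS]mxE; case: (eqVneq y a) => [->|ya]; last case: (eqVneq y b) => [->|yb].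
  + by rewrite rotay // rmorph0 (negbTE xa).
  + by rewrite rotby // rmorph0 (negbTE xb).
  + by rewrite rotxy // rmorph_nat eq_sym.
Qed.

Lemma rot_row x y (A : 'M[C]_n) : x != a -> x != b -> (U *m A) x y = A x y.
Proof. by move=> xa xb; rewrite mxE rot_sumx. Qed.

Lemma rot_col x y (A : 'M[C]_n) : x != a -> x != b -> (A *m adjmx R U) y x = A y x.
Proof.
move=> xa xb; rewrite mxE -[RHS]conjCK -(rot_sumx (fun u => Num.conj (A y u)) xa xb).
rewrite rmorph_sum; apply: eq_bigr => u _.
by rewrite rmorphM /= conjCK mulrC adjmx_ij.
Qed.

Lemma rot_bminor j (w : 'I_j -> 'I_n) (P : 'M[C]_n) :
  (forall i, w i != a) -> (forall i, w i != b) ->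
  bminor w (U *m P *m adjmx R U) a b =
    toC c * (toC c * bminor w P a b) + be * (toC c * bminor w P b b)
    - be * (toC c * bminor w P a a) - be * (be * bminor w P b a).
Proof.
move=> wa wb; rewrite bminor_mulr; last by move=> i z; rewrite rot_col.
have hrow z : bminor w (U *m P) a z = toC c * bminor w P a z + be * bminor w P b z.
  by rewrite bminor_mull ?rot_suma // => i z'; rewrite rot_row.
(* The column operation is conjugated into a row operation, to which [rot_sumb] applies. *)
transitivity (Num.conj (\sum_u U b u * Num.conj (bminor w (U *m P) a u))).
  rewrite rmorph_sum; apply: eq_bigr => u _.
  by rewrite rmorphM /= conjCK mulrC adjmx_ij.
rewrite rot_sumb rmorphD !rmorphM rmorphN /= !conjCK conj_toC !hrow.
by move: (bminor _ _ _ _) (bminor w P b b) (bminor w P a a) (bminor w P b a) => x y z t; ring.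
Qed.

End fixab.

Lemma bminor_herm j n (w : 'I_j -> 'I_n) (P : 'M[C]_n) u v : adjmx R P = P ->
  bminor w P v u = Num.conj (bminor w P u v).
Proof.
move=> aP; have eP x y : Num.conj (P x y) = P y x by rewrite -adjmx_ij aP.
have eA : map_mx Num.conj (mxsub w w P) = (mxsub w w P)^T.
  by apply/matrixP => x y; rewrite !mxE eP.
rewrite /bminor rmorphB rmorphM /= eP -det_map_mx eA det_tr; congr (_ - _).
rewrite rmorph_sum exchange_big; apply: eq_bigr => a _; rewrite rmorph_sum.
apply: eq_bigr => b _ /=; rewrite !rmorphM /= !eP.
have -> : Num.conj (\adj (mxsub w w P) a b) = \adj (mxsub w w P) b a.
  transitivity ((map_mx Num.conj (\adj (mxsub w w P))) a b); first by rewrite [RHS]mxE.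
  by rewrite map_mx_adj eA -trmx_adj mxE.
by ring.
Qed.

(** The bordered minors at [a] and [b] form a hermitian 2 x 2 matrix, which the rotation conjugates.
    The choices [u = 1] and [u = 'i] of the phase give access to the real and the imaginary part of
    its off-diagonal entry. *)
Lemma rotation_bminor j n (w : 'I_j -> 'I_n) (P : 'M[C]_n) (a b : 'I_n) (c s : R) (u : C) :
  a != b -> u * Num.conj u = 1 -> adjmx R P = P ->
  (forall i, w i != a) -> (forall i, w i != b) ->
  let U := rotmx a b c (toC s * u) in
  cRe (Num.conj u * bminor w (U *m P *m adjmx R U) a b) =
    (c ^+ 2 - s ^+ 2) * cRe (Num.conj u * bminor w P a b)
    + c * s * (cRe (bminor w P b b) - cRe (bminor w P a a)).
Proof.
move=> ab uu aP wa wb U; rewrite rot_bminor // (bminor_herm w a b aP).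
set z := bminor w P a b; set x := bminor w P b b; set y := bminor w P a a.
have -> : Num.conj u * (toC c * (toC c * z) + toC s * u * (toC c * x) -
    toC s * u * (toC c * y) - toC s * u * (toC s * u * Num.conj z)) =
    toC c * toC c * (Num.conj u * z) + (u * Num.conj u) * (toC (c * s) * (x - y))
    - (u * Num.conj u) * (toC s * toC s * (u * Num.conj z)).
  by rewrite toCM; ring.
have -> : u * Num.conj z = Num.conj (Num.conj u * z) by rewrite rmorphM /= conjCK.
rewrite uu !mul1r -!toCM.
have cR (r : R) (v : C) : cRe (toC r * v) = r * cRe v by rewrite cReM cIm_real mul0r subr0.
by rewrite cReD cReN cReD !cR cRe_conj cReD cReN; ring.
Qed.

(** With [P = Y Y^dagger], the minor on [w] is [D * conj D], where [D] is the determinant of the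
    rows [w] of [Y]. The rotation alters only row [w l] among them, so by multilinearity [D] becomes
    [c D + s u D'], and the squared modulus is expanded. *)
Lemma rotation_minor n m (w : 'I_m -> 'I_n) (P : 'M[C]_n) (l : 'I_m) (q : 'I_n) (c s : R) (u : C) :
  injective w -> (forall i, w i != q) -> u * Num.conj u = 1 -> grass R n m P ->
  let U := rotmx (w l) q c (toC s * u) in
  cRe (\det (mxsub w w (U *m P *m adjmx R U))) =
    c ^+ 2 * cRe (\det (mxsub w w P)) + 2 * c * s * cRe (u * wminor w P l q)
    + s ^+ 2 * cRe (\det (mxsub (rowrep w l q) (rowrep w l q) P)).
Proof.
move=> wi wq uu [Y [hY ->]] U.
have dd f g : \det (mxsub f g (Y *m adjmx R Y)) =
    \det (rowsub f Y) * Num.conj (\det (rowsub g Y)).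
  rewrite mxsub_mul det_mulmx -adjmx_sub; congr (_ * _).
  by rewrite /adjmx det_tr det_map_mx.
have -> : U *m (Y *m adjmx R Y) *m adjmx R U = (U *m Y) *m adjmx R (U *m Y).
  by rewrite adjmxM !mulmxA.
rewrite mxsub_mul det_mulmx -adjmx_sub [X in _ * X](_ : _ = Num.conj (\det (rowsub w (U *m Y)))); last first.
  by rewrite /adjmx det_tr det_map_mx.
rewrite /wminor !dd; set D := \det (rowsub w Y); set D' := \det (rowsub (rowrep w l q) Y).
have -> : \det (rowsub w (U *m Y)) = toC c * D + toC s * u * D'.
  apply: (determinant_multilinear (i0 := l)).
  - apply/rowP => y; rewrite !mxE rot_suma.
    by rewrite /rowrep eqxx.
  - apply/matrixP => x y; rewrite !mxE rot_sumx //.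
    by rewrite (inj_eq wi) eq_sym neq_lift.
  - apply/matrixP => x y; rewrite !mxE rot_sumx //; last by rewrite (inj_eq wi) eq_sym neq_lift.
    by rewrite /rowrep eq_sym (negbTE (neq_lift _ _)).
have -> : (toC c * D + toC s * u * D') * Num.conj (toC c * D + toC s * u * D') =
   toC (c ^+ 2) * (D * Num.conj D) + toC (c * s) * (u * (D' * Num.conj D) + Num.conj (u * (D' * Num.conj D)))
   + (u * Num.conj u) * (toC (s ^+ 2) * (D' * Num.conj D')).
  by rewrite rmorphD !rmorphM /= conjCK !conj_toC; ring.
have cR (r : R) (v : C) : cRe (toC r * v) = r * cRe v by rewrite cReM cIm_real mul0r subr0.
by rewrite uu mul1r !cReD !cR cReD cRe_conj; ring.
Qed.

End Rotations.

(** * Measurability and invariance *)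

Section GrassMeasure.
Variables (R : realType) (n m k : nat).
Hypothesis mn : (m <= n)%N.
Local Notation C := R[i].
Local Notation cRe := (@complex.Re R).
Local Notation cIm := (@complex.Im R).
Local Notation toC := (real_complex R).
Local Notation T := (GT R k n).
Local Notation S := (grassk R k n m : set T).

Lemma dc2_measurable (x : T) : measurable_fun setT (fun y : T => dc2 R x y).
Proof.
apply: (measurability (@RGenInftyO.G R)); first exact: RGenInftyO.measurableE.
move=> _ [_ [r ->] <-]; rewrite setTI; apply: sub_sigma_algebra.
by exists x, r; apply/seteqP; split=> y /=; rewrite in_itv.
Qed.

Lemma uact_measurable (U : 'I_k -> 'M[C]_n) : (forall i, unitary R (U i)) ->
  measurable_fun setT (uact R U : T -> T).
Proof.
move=> hU; apply: (@measurability _ _ T T setT _ (dc_balls R k n) erefl).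
move=> _ [_ [x [r ->]] <-]; rewrite setTI; apply: sub_sigma_algebra.
exists (uact R (fun i => adjmx R (U i)) x), r; apply/seteqP.
suff h y : dc2 R x (uact R U y) = dc2 R (uact R (fun i => adjmx R (U i)) x) y.
  by split=> y /=; rewrite h.
apply: eq_bigr => i _; rewrite !ffunE adjmxK; congr (_ / _).
rewrite -(frob2_unitary _ (unitary_adj (hU i))) adjmxK; congr (frob2 _ _).
rewrite mulmxBr mulmxBl !mulmxA (hU i) mul1mx -[X in _ - X]mulmxA (hU i) mulmx1.
by [].
Qed.

Definition coordt (i : 'I_k) (a b : 'I_n) (z : C) : T :=
  [ffun i' => if i' == i then z *: delta_mx a b else 0].

(** Polarization: squared distances to two opposite points differ by a linear function of [y]. The
    sigma-algebra is generated by balls, and this is how the entries become measurable. *)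
Lemma dc2_lin i a b z (y : T) :
  dc2 R (coordt i a b (- z)) y - dc2 R (coordt i a b z) y =
  2 * (cRe z * cRe (y i a b) + cIm z * cIm (y i a b)).
Proof.
have -> : 2 * (cRe z * cRe (y i a b) + cIm z * cIm (y i a b)) =
    \sum_j \sum_c \sum_d (if (j == i) && (c == a) && (d == b) then
      2 * (cRe z * cRe (y j c d) + cIm z * cIm (y j c d)) else 0).
  rewrite (bigD1 i) //= (bigD1 a) //= (bigD1 b) //= !eqxx /=.
  rewrite !big1 ?addr0 // => [j|c|d] /negbTE h; rewrite ?h ?andbF //.
    by rewrite big1 // => c _; rewrite big1.
  by rewrite big1.
rewrite /dc2 -sumrB; apply: eq_bigr => j _; rewrite -mulrBl /frob2 -sumrB mulr_suml.
apply: eq_bigr => c _; rewrite -sumrB mulr_suml; apply: eq_bigr => d _.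
rewrite !ffunE; case: (j == i) => /=; last by rewrite subrr mul0r.
rewrite !mxE !cReD !cImD !cReN !cImN; case: (c == a) => /=; last first.
  by rewrite !mulr0 subrr mul0r.
case: (d == b) => /=; last by rewrite !mulr0 subrr mul0r.
by rewrite !mulr1 cReN cImN; field.
Qed.

Lemma coord_measurable z i a b :
  measurable_fun setT (fun y : T => cRe z * cRe (y i a b) + cIm z * cIm (y i a b)).
Proof.
apply: (eq_measurable_fun
  (fun y : T => 2^-1 * (dc2 R (coordt i a b (- z)) y - dc2 R (coordt i a b z) y))).
  by move=> y _; rewrite dc2_lin; field.
apply: measurable_funM; first exact: measurable_cst.
by apply: measurable_funB; exact: dc2_measurable.
Qed.

Lemma Re_measurable i a b : measurable_fun setT (fun y : T => cRe (y i a b)).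
Proof.
apply: (eq_measurable_fun _ _ (coord_measurable 1 i a b)) => y _ /=.
by rewrite mul1r mul0r addr0.
Qed.

Lemma Im_measurable i a b : measurable_fun setT (fun y : T => cIm (y i a b)).
Proof.
apply: (eq_measurable_fun _ _ (coord_measurable 'i%C i a b)) => y _ /=.
by rewrite mul1r mul0r add0r.
Qed.

Definition cmeas (f : T -> C) :=
  measurable_fun setT (fun x => cRe (f x)) /\ measurable_fun setT (fun x => cIm (f x)).

Lemma cmeas_cst z : cmeas (fun=> z).
Proof. by split; exact: measurable_cst. Qed.
Lemma cmeas_coord i a b : cmeas (fun x => x i a b).
Proof. by split; [exact: Re_measurable|exact: Im_measurable]. Qed.
Lemma cmeasD f g : cmeas f -> cmeas g -> cmeas (fun x => f x + g x).
Proof.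
move=> [f1 f2] [g1 g2]; split.
  by apply: (eq_measurable_fun _ _ (measurable_funD f1 g1)) => x _; rewrite cReD.
by apply: (eq_measurable_fun _ _ (measurable_funD f2 g2)) => x _; rewrite cImD.
Qed.
Lemma cmeasM f g : cmeas f -> cmeas g -> cmeas (fun x => f x * g x).
Proof.
move=> [f1 f2] [g1 g2]; split.
  apply: (eq_measurable_fun _ _ (measurable_funB (measurable_funM f1 g1) (measurable_funM f2 g2))).
  by move=> x _; rewrite cReM.
apply: (eq_measurable_fun _ _ (measurable_funD (measurable_funM f1 g2) (measurable_funM f2 g1))).
by move=> x _; rewrite cImM.
Qed.
Lemma cmeasB f g : cmeas f -> cmeas g -> cmeas (fun x => f x - g x).
Proof.
move=> hf hg; rewrite (_ : (fun x => _) = fun x => f x + (-1) * g x).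
  by apply: cmeasD => //; apply: cmeasM => //; exact: cmeas_cst.
by apply/funext => x; rewrite mulN1r.
Qed.
Lemma cmeas_sum (I : Type) (s : seq I) (F : I -> T -> C) :
  (forall i, cmeas (F i)) -> cmeas (fun x => \sum_(i <- s) F i x).
Proof.
move=> h; elim: s => [|i s ih].
  by under eq_fun do rewrite big_nil; exact: cmeas_cst.
by under eq_fun do rewrite big_cons; exact: cmeasD.
Qed.
Lemma cmeas_zero f : cmeas f -> measurable [set x | f x = 0].
Proof.
move=> [f1 f2].
have -> : [set x | f x = 0] = ((fun x => cRe (f x)) @^-1` [set 0]) `&` ((fun x => cIm (f x)) @^-1` [set 0]).
  by apply/seteqP; split => x /= [h1]; [rewrite h1|move=> h2; apply: eqcP].
by apply: measurableI; rewrite -[_ @^-1` _]setTI; [apply: f1|apply: f2].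
Qed.

(** By [grassP], a finite intersection of zero sets of measurable functions of the entries. *)
Lemma grassk_measurable : measurable S.
Proof.
have -> : S = \bigcap_(i in [set: 'I_k]) (
    (\bigcap_(a in [set: 'I_n]) \bigcap_(b in [set: 'I_n])
      ([set x : T | cRe (x i b a) - cRe (x i a b) = 0] `&` [set x : T | cIm (x i b a) + cIm (x i a b) = 0]
       `&` [set x : T | \sum_c x i a c * x i c b - x i a b = 0]))
    `&` [set x : T | \sum_a x i a a - m%:R = 0]).
  apply/seteqP; split => x /=.
    move=> h i _; have /(grassP _ mn)[h1 h2 h3] := h i; split; last first.
      by apply/eqP; rewrite subr_eq0; apply/eqP.
    have eC a b : x i b a = Num.conj (x i a b) by rewrite -adjmx_ij h1.
    move=> a _ b _; split; last first.
      by apply/eqP; rewrite subr_eq0; apply/eqP; rewrite -[in RHS]h2 mxE.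
    by split; rewrite /= eC ?cRe_conj ?cIm_conj ?subrr ?addNr.
  move=> h i; apply/(grassP _ mn); have [h1 h3] := h i I; split.
  - apply/matrixP => a b; rewrite adjmx_ij; have [[/= e1 e2] _] := h1 a I b I.
    by apply: eqcP; rewrite ?cRe_conj ?cIm_conj; lra.
  - apply/matrixP => a b; rewrite mxE; have [_ /= e] := h1 a I b I.
    by apply/eqP; rewrite -subr_eq0; apply/eqP.
  - by apply/eqP; rewrite -subr_eq0; apply/eqP.
have fm (I : finType) (F : I -> set T) : (forall i, measurable (F i)) ->
    measurable (\bigcap_(i in [set: I]) F i).
  move=> h; apply: fin_bigcap_measurable => //; exact: finite_finset.
have zm (f : T -> R) : measurable_fun setT f -> measurable [set x : T | f x = 0].
  by move=> mf; rewrite (_ : [set _ | _] = setT `&` f @^-1` [set 0]) ?setTI //; rewrite -[_ @^-1` _]setTI; apply: mf.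
apply: (@fm _ _) => i; apply: measurableI.
  apply: (@fm _ _) => a; apply: (@fm _ _) => b; apply: measurableI; first apply: measurableI.
  - by apply: (@zm _); apply: measurable_funB; exact: Re_measurable.
  - by apply: (@zm _); apply: measurable_funD; exact: Im_measurable.
  - apply: cmeas_zero; apply: cmeasB; last exact: cmeas_coord.
    by apply: cmeas_sum => c; apply: cmeasM; exact: cmeas_coord.
apply: cmeas_zero; apply: cmeasB; last exact: cmeas_cst.
by apply: cmeas_sum => c; exact: cmeas_coord.
Qed.

(** [P = P P^dagger] makes each diagonal entry the sum of the squared moduli in its row; so the
    diagonal is at most 1, and then every entry is. *)
Lemma grass_entry_le (P : 'M[C]_n) a b : grass R n m P ->
  `|cRe (P a b)| <= 1 /\ `|cIm (P a b)| <= 1.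
Proof.
move=> /grass_hermitian[aP PP _].
have e c : cRe (P c c) = \sum_d (cRe (P c d) ^+ 2 + cIm (P c d) ^+ 2).
  rewrite -[in LHS]PP mxE cRe_sum; apply: eq_bigr => d _.
  have -> : P d c = Num.conj (P c d) by rewrite -adjmx_ij aP.
  by rewrite mul_conj.
have h c d : cRe (P c d) ^+ 2 + cIm (P c d) ^+ 2 <= cRe (P c c).
  rewrite [leRHS]e (bigD1 d) //= lerDl.
  by apply: sumr_ge0 => ? _; rewrite addr_ge0 ?sqr_ge0.
have d1 : cRe (P a a) <= 1.
  by have := h a a; have := sqr_ge0 (cIm (P a a)); nra.
have := h a b; have := sqr_ge0 (cIm (P a b)); have := sqr_ge0 (cRe (P a b)).
by move=> *; split; rewrite -sqrtr_sqr -sqrtr1 ler_sqrt //; lra.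
Qed.

Variable mu : probability T R.
Hypothesis hmu : uniform_grassk R k n m mu.

Let PS : mu S = 1%E. Proof. by case: hmu. Qed.
Local Notation E := (Ex mu S).
Local Notation gd := (good S).

Lemma grassk_uact (U : 'I_k -> 'M[C]_n) (x : T) : (forall i, unitary R (U i)) ->
  S x -> S (uact R U x).
Proof. by move=> hU Sx i; rewrite ffunE; apply: grass_act. Qed.

Lemma uactK (U : 'I_k -> 'M[C]_n) (x : T) : (forall i, unitary R (U i)) ->
  uact R (fun i => adjmx R (U i)) (uact R U x) = x.
Proof.
move=> hU; apply/ffunP => i; rewrite !ffunE adjmxK !mulmxA hU mul1mx.
by rewrite -mulmxA hU mulmx1.
Qed.

Lemma uact_preim (U : 'I_k -> 'M[C]_n) : (forall i, unitary R (U i)) ->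
  (uact R U : T -> T) @^-1` S = S.
Proof.
move=> hU; apply/seteqP; split => x /=; last exact: grassk_uact.
have hU' i : unitary R (adjmx R (U i)) by exact: unitary_adj.
by move=> /(grassk_uact hU'); rewrite uactK.
Qed.

Lemma good_uact (U : 'I_k -> 'M[C]_n) (f : T -> R) : (forall i, unitary R (U i)) ->
  measurable_fun setT f -> gd f -> gd (fun x => f (uact R U x)).
Proof.
move=> hU mf [_ [M hM]]; split; last by exists M => x Sx; apply: hM; exact: grassk_uact.
apply: measurable_funTS; apply: (measurableT_comp mf); exact: uact_measurable.
Qed.

(** Change of variables along [uact]: the pushforward of [mu] is [mu], and [S] is its own
    preimage. *)
Lemma Ex_uact (U : 'I_k -> 'M[C]_n) (f : T -> R) : (forall i, unitary R (U i)) ->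
  measurable_fun setT f -> gd f -> E (fun x => f (uact R U x)) = E f.
Proof.
move=> hU mf gf; rewrite /Ex /Rintegral; congr fine.
have mU := uact_measurable hU.
have := @integral_pushforward _ _ T T R _ mU mu S (EFin \o f).
rewrite uact_preim // => <- //.
- apply: eq_measure_integral => A mA _; rewrite /pushforward.
  exact: (proj2 hmu U hU A mA).
- exact/measurable_EFinP.
- exact: (good_intg grassk_measurable (good_uact hU mf gf)).
- exact: grassk_measurable.
Qed.

Definition cgood (f : T -> C) := cmeas f /\
  exists M : R, forall x, S x -> `|cRe (f x)| <= M /\ `|cIm (f x)| <= M.

Lemma cgood_good f : cgood f -> gd (fun x => cRe (f x)) /\ gd (fun x => cIm (f x)).
Proof.
move=> [[m1 m2] [M hM]]; split; split;
  by [exact: measurable_funTS|exists M => x /hM []].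
Qed.
Lemma good_cgood f : cmeas f -> gd (fun x => cRe (f x)) -> gd (fun x => cIm (f x)) -> cgood f.
Proof.
move=> mf [_ [M hM]] [_ [N hN]]; split => //; exists (Num.max M N) => x Sx.
by rewrite !le_max hM // hN // orbT.
Qed.
Lemma cgood_cst z : cgood (fun=> z).
Proof.
by apply: good_cgood; [exact: cmeas_cst|apply: good_cst|apply: good_cst].
Qed.
Lemma cgood_coord i a b : cgood (fun x => x i a b).
Proof.
split; first exact: cmeas_coord.
by exists 1 => x Sx; exact: grass_entry_le (Sx i).
Qed.
Lemma cgoodD f g : cgood f -> cgood g -> cgood (fun x => f x + g x).
Proof.
move=> hf hg; have [f1 f2] := cgood_good hf; have [g1 g2] := cgood_good hg.
apply: good_cgood; first exact: cmeasD (proj1 hf) (proj1 hg).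
  by apply: good_ext (goodD f1 g1) => x _; rewrite cReD.
by apply: good_ext (goodD f2 g2) => x _; rewrite cImD.
Qed.
Lemma cgoodM f g : cgood f -> cgood g -> cgood (fun x => f x * g x).
Proof.
move=> hf hg; have [f1 f2] := cgood_good hf; have [g1 g2] := cgood_good hg.
apply: good_cgood; first exact: cmeasM (proj1 hf) (proj1 hg).
  by apply: good_ext (goodB (goodM f1 g1) (goodM f2 g2)) => x _; rewrite cReM.
by apply: good_ext (goodD (goodM f1 g2) (goodM f2 g1)) => x _; rewrite cImM.
Qed.
Lemma cgoodB f g : cgood f -> cgood g -> cgood (fun x => f x - g x).
Proof.
move=> hf hg; rewrite (_ : (fun x => _) = fun x => f x + (-1) * g x).
  by apply: cgoodD => //; apply: cgoodM => //; exact: cgood_cst.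
by apply/funext => x; rewrite mulN1r.
Qed.
Lemma cgood_sum (I : Type) (s : seq I) (F : I -> T -> C) :
  (forall i, cgood (F i)) -> cgood (fun x => \sum_(i <- s) F i x).
Proof.
move=> h; elim: s => [|i s ih].
  by under eq_fun do rewrite big_nil; exact: cgood_cst.
by under eq_fun do rewrite big_cons; exact: cgoodD.
Qed.
Lemma cgood_prod (I : Type) (s : seq I) (F : I -> T -> C) :
  (forall i, cgood (F i)) -> cgood (fun x => \prod_(i <- s) F i x).
Proof.
move=> h; elim: s => [|i s ih].
  by under eq_fun do rewrite big_nil; exact: cgood_cst.
by under eq_fun do rewrite big_cons; exact: cgoodM.
Qed.
Lemma cgood_det p (M : T -> 'M[C]_p) : (forall a b, cgood (fun x => M x a b)) ->
  cgood (fun x => \det (M x)).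
Proof.
move=> h; apply: cgood_sum => s; apply: cgoodM; first exact: cgood_cst.
by apply: cgood_prod => i; exact: h.
Qed.
Lemma cgood_adj p (M : T -> 'M[C]_p) a b : (forall a b, cgood (fun x => M x a b)) ->
  cgood (fun x => \adj (M x) a b).
Proof.
move=> h; under eq_fun do rewrite mxE; apply: cgoodM; first exact: cgood_cst.
by apply: cgood_det => c d; under eq_fun do rewrite !mxE; exact: h.
Qed.
Lemma cgood_minor i p (f g : 'I_p -> 'I_n) : cgood (fun x => \det (mxsub f g (x i))).
Proof.
by apply: cgood_det => c d; under eq_fun do rewrite !mxE; exact: cgood_coord.
Qed.
Lemma cgood_bminor i p (w : 'I_p -> 'I_n) u v : cgood (fun x => bminor w (x i) u v).
Proof.
apply: cgoodB.
  by apply: cgoodM; [exact: cgood_coord|exact: cgood_minor].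
apply: cgood_sum => a; apply: cgood_sum => b.
apply: cgoodM; last exact: cgood_coord.
apply: cgoodM; first exact: cgood_coord.
apply: cgood_adj => c d; under eq_fun do rewrite !mxE; exact: cgood_coord.
Qed.

End GrassMeasure.

(** * Moments of the leading minor *)

Section Recursion.
Variable R : realType.
Local Notation C := R[i].
Local Notation cRe := (@complex.Re R).
Local Notation cIm := (@complex.Im R).
Local Notation toC := (real_complex R).

Lemma sum_ord_geq_const (j m : nat) (c : R) : (j <= m)%N ->
  \sum_(l < m | (j <= l)%N) c = (m%:R - j%:R) * c.
Proof.
move=> jm; rewrite -natrB // mulr_natl -sumr_const_nat.
by rewrite (big_geq_mkord j m xpredT (fun=> c)).
Qed.
Lemma coef1M (p q : {poly R}) : (p * q)`_1 = p`_0 * q`_1 + p`_1 * q`_0.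
Proof. by rewrite coefM big_ord_recl big_ord1. Qed.
Lemma coef0X (p : {poly R}) e : (p ^+ e)`_0 = p`_0 ^+ e.
Proof. by elim: e => [|e ih]; rewrite ?expr0 ?coef1 // !exprS coef0M ih. Qed.
Lemma coef1X (p : {poly R}) e : (p ^+ e)`_1 = e%:R * p`_0 ^+ e.-1 * p`_1.
Proof.
elim: e => [|e ih]; first by rewrite expr0 coef1 !mul0r.
rewrite exprS coef1M ih coef0X /= -(natr1 e); case: e {ih} => [|e] /=.
  by rewrite !expr0; ring.
by rewrite !exprS; ring.
Qed.

Variables (n m k : nat).
Hypothesis mn : (m < n)%N.
Local Notation T := (GT R k n).
Local Notation S := (grassk R k n m : set T).
Variable mu : probability T R.
Hypothesis hmu : uniform_grassk R k n m mu.
Let mS : measurable S. Proof. exact: grassk_measurable (ltnW mn). Qed.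
Let PS : mu S = 1%E. Proof. by case: hmu. Qed.
Local Notation E := (Ex mu S).

Local Notation w := (widen_ord (ltnW mn)).
(** On the Grassmannian the determinant is already real ([compress_spectrum]); the real part only
    changes its type. *)
Definition lead (P : 'M[C]_n) : R := cRe (\det (mxsub w w P)).

Definition act1 (i0 : 'I_k) (V : 'M[C]_n) (x : T) : T :=
  uact R (fun i => if i == i0 then V else 1%:M) x.

Lemma act1_eq i0 V x : act1 i0 V x i0 = V *m x i0 *m adjmx R V.
Proof. by rewrite ffunE eqxx. Qed.
Lemma act1_neq i0 V x i : i != i0 -> act1 i0 V x i = x i.
Proof. by move=> /negbTE h; rewrite ffunE h adjmx1 mulmx1 mul1mx. Qed.
Lemma act1_unitary (i0 : 'I_k) (V : 'M[C]_n) : unitary R V ->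
  forall i : 'I_k, unitary R (if i == i0 then V else 1%:M).
Proof. by move=> hV i; case: ifP => // _; exact: unitary1. Qed.

Section Fixed.
Variables (i0 : 'I_k) (h : T -> R).
Hypotheses (gh : good S h) (mh : measurable_fun setT h).
Hypothesis ih : forall V x, unitary R V -> h (act1 i0 V x) = h x.
Variables (p j : nat).
Hypothesis jm : (j <= m)%N.
Hypothesis jn : (j <= n)%N.
Local Notation wj := (widen_ord jn).
Local Notation G x u v := (bminor wj (x i0) u v).
Local Notation Dl x := (lead (x i0)).

Let good_Re (f : T -> C) : cgood m f -> good S (fun x => cRe (f x)).
Proof. by case/cgood_good. Qed.
Let good_lead : good S (fun x : T => Dl x).
Proof. exact/good_Re/cgood_minor. Qed.
Let meas_lead : measurable_fun setT (fun x : T => Dl x).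
Proof.
have : cgood m (fun x : T => \det (mxsub w w (x i0))) by exact: cgood_minor.
by case=> -[].
Qed.

(** [h] stands for a function of the other factors: rotations of factor [i0] fix it, so invariance
    in that factor survives multiplication by [h]. *)
Lemma Ex_act1 (V : 'M[C]_n) (f : T -> R) : unitary R V ->
  measurable_fun setT f -> good S f ->
  E (fun x => h x * f (act1 i0 V x)) = E (fun x => h x * f x).
Proof.
move=> hV mf gf.
rewrite -(Ex_uact (ltnW mn) hmu (act1_unitary i0 hV) (f := fun x => h x * f x)).
- by apply: eq_Ex => x _; rewrite -/(act1 i0 V x) ih.
- exact: measurable_funM.
- exact: goodM.
Qed.

(* The coefficient of th in the invariance of E[h D^p Re(conj u G_lq)] under the
   rotation by arctan th in the plane (l, q): all the minors involved are
   quadratic forms in (cos, sin). *)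
Lemma rotation_identity (l : 'I_m) (q : 'I_n) (u : C) :
  (j <= l)%N -> (m <= q)%N -> u * Num.conj u = 1 ->
  E (fun x => h x * (2 * p%:R * lead (x i0) ^+ p.-1 *
        (cRe (u * wminor w (x i0) l q) * cRe (Num.conj u * G x (w l) q))
      + Dl x ^+ p * (cRe (G x q q) - cRe (G x (w l) (w l))))) = 0.
Proof.
move=> jl mq uu.
pose rho (x : T) := cRe (u * wminor w (x i0) l q).
pose Dl' (x : T) := cRe (\det (mxsub (rowrep w l q) (rowrep w l q) (x i0))).
pose ga (x : T) := cRe (Num.conj u * G x (w l) q).
pose de (x : T) := cRe (G x q q) - cRe (G x (w l) (w l)).
have grho : good S rho.
  by apply: good_Re; apply: cgoodM; [exact: cgood_cst|exact: cgood_minor].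
have gDl' : good S Dl' by apply: good_Re; exact: cgood_minor.
have gga : good S ga.
  by apply: good_Re; apply: cgoodM; [exact: cgood_cst|exact: cgood_bminor].
have mga : measurable_fun setT ga.
  have : cgood m (fun x : T => Num.conj u * G x (w l) q).
    by apply: cgoodM; [exact: cgood_cst|exact: cgood_bminor].
  by case=> -[].
have gde : good S de by apply: goodB; apply: good_Re; exact: cgood_bminor.
(* With [th] the tangent of the angle, the rotated minor and bordered minor are [(1 + th^2)^-1]
   times the values at [th] of [A] and [B]. *)
pose A (x : T) : {poly R} := (Dl x)%:P + (2 * rho x)%:P * 'X + (Dl' x)%:P * 'X^2.
pose B (x : T) : {poly R} := (ga x)%:P * (1 - 'X^2) + (de x)%:P * 'X.
pose Q (x : T) : {poly R} := (h x)%:P * (A x ^+ p * B x).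
pose e0 := E (fun x => h x * (Dl x ^+ p * ga x)).
have gQ : goodp S Q.
  apply: goodpM; first exact: goodp_cst.
  apply: goodpM.
    apply: goodpX; apply: goodpD; first apply: goodpD; first exact: goodp_cst.
      by apply: goodpM; [apply: goodp_cst; exact: goodZ|exact: goodp_poly].
    by apply: goodpM; [exact: goodp_cst|exact: goodp_poly].
  by apply: goodpD; apply: goodpM; by [exact: goodp_cst|exact: goodp_poly].
(* The exponent [p.+1] clears the denominators of the [p] minors and of the single bordered
   minor. *)
have key th : E (fun x => (Q x).[th]) = ((1 + 'X^2) ^+ p.+1 * e0%:P).[th].
  set a := 1 + th ^+ 2; have a0 : 0 < a by rewrite /a; have := sqr_ge0 th; lra.
  pose c := (Num.sqrt a)^-1; pose s := th * c.
  have c2 : c ^+ 2 = a^-1 by rewrite exprVn sqr_sqrtr // ltW.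
  have cs1 : toC (c ^+ 2) + toC s * u * Num.conj (toC s * u) = 1.
    have -> : Num.conj (toC s * u) = toC s * Num.conj u by rewrite rmorphM /= conj_toC.
  rewrite mulrACA uu mulr1 -toCM -rmorphD /=.
    have -> : c ^+ 2 + s * s = 1; last by [].
    rewrite /s mulrACA -!expr2 c2 /a; field; rewrite -/a; exact: lt0r_neq0.
  have lq : w l != q by rewrite -val_eqE /= neq_ltn (leq_trans (ltn_ord l) mq).
  have hU : unitary R (rotmx (w l) q c (toC s * u)) by apply: rot_unitary.
  have mf : measurable_fun setT (fun x : T => Dl x ^+ p * ga x).
    by apply: measurable_funM => //; exact: measurable_funX.
  have gf : good S (fun x : T => Dl x ^+ p * ga x) by apply: goodM => //; exact: goodX.
  rewrite !(hornerE, horner_exp) -/a -/e0 /e0.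
  rewrite -(Ex_act1 hU mf gf) -(ExZ mS); last first.
    by apply: goodM => //; exact: good_uact (act1_unitary i0 hU) mf gf.
  apply: eq_Ex => x Sx;
  have -> : (Q x).[th] = h x * ((Dl x + 2 * rho x * th + Dl' x * th ^+ 2) ^+ p *
      (ga x * (1 - th ^+ 2) + de x * th)).
    by rewrite /Q /A /B !(hornerE, horner_exp) /= ?expr2 ?mulrA.
  rewrite [RHS]mulrCA; congr (_ * _).
  rewrite /ga act1_eq rotation_bminor //; first last.
  - by move=> i; rewrite -val_eqE /= neq_ltn (leq_trans (ltn_ord i)) // (leq_trans jm).
  - by move=> i; rewrite -val_eqE /= neq_ltn (leq_trans (ltn_ord i)).
  - by have /grass_hermitian[] := Sx i0.
  rewrite /lead rotation_minor //; first last.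
  - by move=> i; rewrite -val_eqE /= neq_ltn (leq_trans (ltn_ord i)).
  - by move=> i i' /(congr1 val) /= /val_inj.
  rewrite -/(ga x) -/(de x) -/(rho x) -/(Dl' x) -/(lead (x i0)).
  have -> : c ^+ 2 * Dl x + 2 * c * s * rho x + s ^+ 2 * Dl' x =
     a^-1 * (Dl x + 2 * rho x * th + Dl' x * th ^+ 2).
    by rewrite -c2 /s; ring.
  have -> : (c ^+ 2 - s ^+ 2) * ga x + c * s * de x =
     a^-1 * (ga x * (1 - th ^+ 2) + de x * th).
    by rewrite -c2 /s; ring.
  rewrite exprMn mulrACA -exprSr mulrA -exprMn divff ?expr1n ?mul1r //.
  exact: lt0r_neq0.
(* The right side is even in [th], so its linear coefficient is 0; that of [Q] is the integrand of
   the claim. *)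
have := Ex_coef mS PS gQ key (i := 1).
rewrite coef1M coef1X coef0X !coefC /= mulr0 add0r.
rewrite !(coefD, coef1, coefXn) /= !addr0 mulr0 mul0r => <-.
apply: eq_Ex => x _; rewrite /Q coef1M !coefC /= mul0r addr0; congr (_ * _).
rewrite coef1M coef1X coef0X /A /B.
rewrite !(coefD, coefM, coefC, coefX, coefXn, coefB, coef1, big_ord_recl, big_ord0) /=.
rewrite !(coefN, coefXn) /= !(mulr0, addr0, mulr1, oppr0, add0r).
by rewrite /rho /ga /de; ring.
Qed.

(** [rotation_identity] is summed over [l]: by [wminor_bminor] the mixed terms add up to
    [Dl x * G x q q], which restores the power of [Dl] lost to the derivative. Rows [l < j] drop out
    as repeated rows. *)
Lemma rotation_sum (q : 'I_n) : (m <= q)%N ->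
  (m%:R - j%:R + p%:R) * E (fun x => h x * (Dl x ^+ p * cRe (G x q q))) =
  \sum_(l < m | (j <= l)%N) E (fun x => h x * (Dl x ^+ p * cRe (G x (w l) (w l)))).
Proof.
move=> mq.
pose H l x := h x * (p%:R * Dl x ^+ p.-1 * cRe (wminor w (x i0) l q * G x (w l) q)
  + Dl x ^+ p * (cRe (G x q q) - cRe (G x (w l) (w l)))).
have gGG u v : good S (fun x : T => cRe (G x u v)) by apply: good_Re; exact: cgood_bminor.
have gX e : good S (fun x : T => Dl x ^+ e) by exact: goodX.
have gWG l : good S (fun x : T => cRe (wminor w (x i0) l q * G x (w l) q)).
  by apply: good_Re; apply: cgoodM; [exact: cgood_minor|exact: cgood_bminor].
have gH l : good S (H l).
  apply: goodM => //; apply: goodD; last by apply: goodM => //; exact: goodB.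
  by apply: goodM => //; exact: goodZ.
have EH (l : 'I_m) : (j <= l)%N -> E (H l) = 0.
  move=> jl.
  pose F u x := h x * (2 * p%:R * lead (x i0) ^+ p.-1 *
        (cRe (u * wminor w (x i0) l q) * cRe (Num.conj u * G x (w l) q))
      + Dl x ^+ p * (cRe (G x q q) - cRe (G x (w l) (w l)))).
  have gF u : good S (F u).
    apply: goodM => //; apply: goodD; last by apply: goodM => //; exact: goodB.
    apply: goodM; first exact: goodZ.
    by apply: goodM; apply: good_Re; apply: cgoodM;
      [exact: cgood_cst|exact: cgood_minor|exact: cgood_cst|exact: cgood_bminor].
  have r1 : E (F 1) = 0 by apply: rotation_identity => //; rewrite rmorph1 mulr1.
  have r2 : E (F 'i%C) = 0.
    by apply: rotation_identity => //; rewrite mul_conj /= expr0n expr1n add0r.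
  (* With W and G the two complex minors, adding the phases 1 and 'i gives
     [Re W Re G - Im W Im G = Re (W G)]. *)
  have e2 : E (fun x => 2 * H l x) = E (fun x => F 1 x + F 'i%C x).
    apply: eq_Ex => x _; rewrite /H /F rmorph1 !mul1r.
    move: (wminor _ _ _ _) (bminor _ _ (w l) q) => [a b] [c e] /=.
    by ring.
  move: e2; rewrite ExZ // ExD // r1 r2 addr0 => /eqP; rewrite mulf_eq0 pnatr_eq0 /=.
  by move/eqP.
have Hsum x : S x -> \sum_(l < m | (j <= l)%N) H l x =
    p%:R * (h x * (Dl x ^+ p * cRe (G x q q))) +
    \sum_(l < m | (j <= l)%N) (h x * (Dl x ^+ p * cRe (G x q q))
       - h x * (Dl x ^+ p * cRe (G x (w l) (w l)))).
  move=> Sx.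
  have e1 : \sum_(l < m | (j <= l)%N) cRe (wminor w (x i0) l q * G x (w l) q)
      = Dl x * cRe (G x q q).
    have /grass_hermitian[aP PP _] := Sx i0.
    have wi : injective w by move=> a b /(congr1 val) /= /val_inj.
    have [r [_ dr _]] := compress_spectrum wi aP PP.
    have [Y [_ eY]] := Sx i0.
    have := wminor_bminor wj w Y (adjmx R Y) q q; rewrite /= -eY dr.
    move=> /(congr1 cRe); rewrite cRe_sum cReM cIm_real mul0r subr0 /lead dr => <-.
    rewrite big_mkcond; apply: eq_bigr => l _; case: leqP => // lj.
    have -> : w l = wj (Ordinal lj) by apply/val_inj.
    by rewrite bminor_row mulr0.
  transitivity (h x * (p%:R * Dl x ^+ p.-1 * (Dl x * cRe (G x q q))) +
      \sum_(l < m | (j <= l)%N) (h x * (Dl x ^+ p * cRe (G x q q))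
       - h x * (Dl x ^+ p * cRe (G x (w l) (w l))))).
    rewrite -e1 !mulr_sumr -big_split; apply: eq_bigr => l _.
    by rewrite /H mulrDr -mulrBr -mulrBr mulrA.
  congr (_ + _); case: (p) => [|p'] /=; first by rewrite !mul0r mulr0.
  by rewrite exprS; ring.
have gA u v : good S (fun x : T => h x * (Dl x ^+ p * cRe (G x u v))).
  by apply: goodM => //; exact: goodM.
have E0 : E (fun x => \sum_(l < m | (j <= l)%N) H l x) = 0.
  by rewrite (Ex_sum mS PS) //; apply: big1 => l; exact: EH.
pose a := E (fun x => h x * (Dl x ^+ p * cRe (G x q q))).
pose b (l : 'I_m) := E (fun x => h x * (Dl x ^+ p * cRe (G x (w l) (w l)))).
have E1 : E (fun x => \sum_(l < m | (j <= l)%N) H l x) =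
    p%:R * a + \sum_(l < m | (j <= l)%N) (a - b l).
  rewrite (eq_Ex mu Hsum) ExD //; first last.
  - by apply: good_sum => l; exact: goodB.
  - exact: goodZ.
  congr (_ + _); first exact: ExZ.
  rewrite (Ex_sum mS PS); last by move=> l; exact: goodB.
  by apply: eq_bigr => l _; exact: ExB.
rewrite -/a -/(b _) (eq_bigr b) //; clearbody a b.
move: E1; rewrite E0 sumrB sum_ord_geq_const // => h0.
by apply/eqP; rewrite -subr_eq0 [X in _ == X]h0; apply/eqP; ring.
Qed.

(** The transposition of [w j'] and [w l] is unitary, fixes the first j coordinates, and permutes
    the first m among themselves, which preserves the leading minor. *)
Lemma swap_identity (l : 'I_m) (jlt : (j < m)%N) : (j <= l)%N ->
  E (fun x => h x * (Dl x ^+ p * cRe (G x (w l) (w l)))) =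
  E (fun x => h x * (Dl x ^+ p * cRe (G x (w (Ordinal jlt)) (w (Ordinal jlt))))).
Proof.
move=> jl; set j' := Ordinal jlt.
pose s : 'S_n := tperm (w j') (w l).
have hV : unitary R (perm_mx s : 'M[C]_n).
  by rewrite /unitary /adjmx map_perm_mx tr_perm_mx -perm_mxM mulVg perm_mx1.
have eV (P : 'M[C]_n) : perm_mx s *m P *m adjmx R (perm_mx s) = mxsub s s P.
  rewrite /adjmx map_perm_mx tr_perm_mx -row_permE -col_permE.
  by apply/matrixP => a b; rewrite !mxE.
have gG u v : good S (fun x : T => cRe (G x u v)) by apply: good_Re; exact: cgood_bminor.
have mf : measurable_fun setT (fun x : T => Dl x ^+ p * cRe (G x (w j') (w j'))).
  apply: measurable_funM; first exact: measurable_funX.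
  have : cgood m (fun x : T => G x (w j') (w j')) by exact: cgood_bminor.
  by case=> -[].
rewrite -(Ex_act1 hV mf); last by apply: goodM => //; exact: goodX.
apply: eq_Ex => x _; rewrite act1_eq eV bminor_sub; last first.
  move=> a; rewrite tpermD // -val_eqE /= eq_sym neq_ltn.
    by rewrite ltn_ord.
  by rewrite (leq_trans (ltn_ord a) jl).
have wi : injective w by move=> a' b' /(congr1 val) /= /val_inj.
have -> : lead (mxsub s s (x i0)) = Dl x.
  rewrite /lead -[in RHS](det_sub_perm w (x i0) (tperm j' l)).
  congr (cRe (\det _)); apply/matrixP => a b; rewrite !mxE /=.
  by rewrite /s -!(inj_tperm _ _ _ wi).
by rewrite tpermL.
Qed.

(** Let [A0] and [B0] be the two expectations. In expectation, the diagonal bordered minors are 0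
    for [u < j], equal to [B0] for [j <= u < m] ([swap_identity]), and equal to
    [(m - j) / (m - j + p) * B0] for [u >= m] ([rotation_sum]). Their sum is [(m - j) * A0] by
    [bminor_trace]. *)
Lemma chain_step (jlt : (j < m)%N) :
  (p%:R + m%:R - j%:R) * E (fun x => h x * (Dl x ^+ p * cRe (\det (mxsub wj wj (x i0))))) =
  (p%:R + n%:R - j%:R) *
    E (fun x => h x * (Dl x ^+ p * cRe (G x (w (Ordinal jlt)) (w (Ordinal jlt))))).
Proof.
set A0 := E _; set B0 := E _.
have gG u v : good S (fun x : T => cRe (G x u v)) by apply: good_Re; exact: cgood_bminor.
have gA u : good S (fun x : T => h x * (Dl x ^+ p * cRe (G x u u))).
  by apply: goodM => //; apply: goodM => //; exact: goodX.
pose g u := E (fun x => h x * (Dl x ^+ p * cRe (G x u u))).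
have tr : \sum_u g u = (m%:R - j%:R) * A0.
  rewrite /g -(Ex_sum mS PS) // /A0 -(ExZ mS); last first.
    apply: goodM => //; apply: goodM; first exact: goodX.
    by apply: good_Re; exact: cgood_minor.
  apply: eq_Ex => x Sx; rewrite -mulr_sumr -mulr_sumr -cRe_sum.
  have /grass_hermitian[_ PP tP] := Sx i0.
  rewrite (bminor_trace _ PP tP) cReM.
  have -> : cRe (m%:R - j%:R) = m%:R - j%:R.
    by rewrite -!(rmorph_nat toC) -rmorphB.
  have -> : cIm (m%:R - j%:R) = 0.
    by rewrite -!(rmorph_nat toC) -rmorphB.
  by ring.
have lowz (u : 'I_n) : (u < j)%N -> g u = 0.
  move=> uj; rewrite -[RHS](Ex_cst mS PS 0); apply: eq_Ex => x _.
  have -> : u = wj (Ordinal uj) by apply/val_inj.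
  by rewrite bminor_row /= !mulr0.
have mj0 : (m%:R - j%:R : R) != 0 by rewrite subr_eq0 eqr_nat neq_ltn jlt orbT.
have pmj0 : (m%:R - j%:R + p%:R : R) != 0.
  by rewrite -natrB // -natrD pnatr_eq0 -lt0n addn_gt0 subn_gt0 jlt.
have Ssum : \sum_(l < m | (j <= l)%N) g (w l) = (m%:R - j%:R) * B0.
  rewrite (eq_bigr (fun=> B0)); last by move=> l jl; exact: swap_identity.
  by rewrite sum_ord_geq_const.
have upper (q : 'I_n) : (m <= q)%N -> g q = (m%:R - j%:R) * B0 / (m%:R - j%:R + p%:R).
  move=> mq; apply: (mulfI pmj0); rewrite /g rotation_sum // -Ssum mulrCA divff // mulr1.
  by [].
have split_sum : \sum_u g u =
    (m%:R - j%:R) * B0 + (n%:R - m%:R) * ((m%:R - j%:R) * B0 / (m%:R - j%:R + p%:R)).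
  rewrite (bigID (fun u : 'I_n => (u < m)%N)) /=; congr (_ + _).
    rewrite -Ssum (big_ord_narrow (ltnW mn)) [RHS]big_mkcond; apply: eq_bigr => l _.
    by case: leqP => // lj; apply: lowz.
  under eq_bigl => u do rewrite -leqNgt.
  rewrite (eq_bigr (fun=> (m%:R - j%:R) * B0 / (m%:R - j%:R + p%:R))); last by move=> u; exact: upper.
  by rewrite sum_ord_geq_const // ltnW.
apply: (mulfI mj0); rewrite mulrCA -tr split_sum.
by field.
Qed.

End Fixed.

Section Moments.
Let good_lead (i : 'I_k) : good S (fun x : T => lead (x i)).
Proof.
have : cgood m (fun x : T => \det (mxsub w w (x i))) by exact: cgood_minor.
by case/cgood_good.
Qed.
Let meas_lead (i : 'I_k) : measurable_fun setT (fun x : T => lead (x i)).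
Proof.
have : cgood m (fun x : T => \det (mxsub w w (x i))) by exact: cgood_minor.
by case=> -[].
Qed.

(** Grows a minor one row at a time by [chain_step], from the empty minor 1 at j = 0 to the
    additional factor [lead] at j = m. *)
Lemma lead_step (i0 : 'I_k) (h : T -> R) p : good S h -> measurable_fun setT h ->
  (forall V x, unitary R V -> h (act1 i0 V x) = h x) ->
  E (fun x => h x * lead (x i0) ^+ p.+1) =
  (\prod_(j < m) ((p + (m - j))%:R / (p + (n - j))%:R)) * E (fun x => h x * lead (x i0) ^+ p).
Proof.
move=> gh mh ih.
have step j (jm : (j <= m)%N) (jn : (j <= n)%N) :
    E (fun x => h x * lead (x i0) ^+ p) =
    (\prod_(j' < j) ((p + (n - j'))%:R / (p + (m - j'))%:R)) *
    E (fun x => h x * (lead (x i0) ^+ p *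
      cRe (\det (mxsub (widen_ord jn) (widen_ord jn) (x i0))))).
  elim: j jm jn => [|j IH] jm jn.
    rewrite big_ord0 mul1r; apply: eq_Ex => x _.
    by rewrite det_mx00 /= mulr1.
  rewrite (IH (ltnW jm) (ltnW jn)) big_ord_recr /= -mulrA; congr (_ * _).
  have := chain_step gh mh ih p (ltnW jm) (ltnW jn) jm.
  set A0 := E _; set B0 := E _; set C0 := E _ => h1.
  have -> : C0 = B0.
    apply: eq_Ex => x _; congr (_ * (_ * cRe _)); apply: det_widenS => //.
    by rewrite addn1.
  rewrite !natrD !natrB ?(ltnW jm) ?(ltnW jn) //.
  have nz : p%:R + (m%:R - j%:R) != 0 :> R.
    by rewrite -natrB ?(ltnW jm) // -natrD pnatr_eq0 -lt0n addn_gt0 subn_gt0 jm orbT.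
  apply: (mulfI nz); rewrite addrA [RHS]mulrCA [RHS]mulrA.
  have -> : (p%:R + m%:R - j%:R) * A0 = (p%:R + n%:R - j%:R) * B0 by exact: h1.
  by rewrite addrA -[X in _ = X * _]mulrA mulVf ?mulr1 ?addrA // -addrA.
rewrite (step m (leqnn m) (ltnW mn)) mulrA -big_split /= big1 ?mul1r.
  apply: eq_Ex => x _; by rewrite exprSr.
move=> j _; rewrite mulrACA [X in _ * X]mulrC.
have nz1 : (p + (n - j))%:R != 0 :> R.
  by rewrite pnatr_eq0 -lt0n addn_gt0 subn_gt0 (ltn_trans (ltn_ord j) mn) orbT.
have nz2 : (p + (m - j))%:R != 0 :> R.
  by rewrite pnatr_eq0 -lt0n addn_gt0 subn_gt0 ltn_ord orbT.
by rewrite -invfM divff // mulf_neq0.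
Qed.

Definition ratio s : R := \prod_(p < s) \prod_(j < m) ((p + (m - j))%:R / (p + (n - j))%:R).

Lemma lead_moment (i0 : 'I_k) (h : T -> R) s : good S h -> measurable_fun setT h ->
  (forall V x, unitary R V -> h (act1 i0 V x) = h x) ->
  E (fun x => h x * lead (x i0) ^+ s) = ratio s * E h.
Proof.
move=> gh mh ih; elim: s => [|s IH].
  by rewrite /ratio big_ord0 mul1r; apply: eq_Ex => x _; rewrite expr0 mulr1.
by rewrite lead_step // IH mulrA /ratio big_ord_recr /= [X in X * _]mulrC.
Qed.

Definition leadprod (x : T) : R := \prod_i lead (x i).

(** Peels off one factor at a time, the product over the remaining ones serving as the weight
    [h]. *)
Lemma leadprod_moment s : E (fun x => leadprod x ^+ s) = ratio s ^+ k.
Proof.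
have H (r : seq 'I_k) : uniq r ->
    E (fun x => \prod_(i <- r) lead (x i) ^+ s) = ratio s ^+ size r.
  elim: r => [_|i0 r IH /= /andP[i0r ur]].
    rewrite expr0 -[RHS](Ex_cst mS PS 1); apply: eq_Ex => x _.
    by rewrite big_nil.
  rewrite exprS -IH // -(lead_moment (i0 := i0)).
  - by apply: eq_Ex => x _; rewrite big_cons mulrC.
  - by apply: good_prod => i; exact: goodX.
  - apply: measurable_prod => i _; exact: measurable_funX.
  - move=> V x hV; rewrite big_seq [RHS]big_seq; apply: eq_bigr => i ir.
    by rewrite act1_neq //; apply: contraNneq i0r => <-.
have := H (index_enum _) (index_enum_uniq _).
have -> : size (index_enum 'I_k) = k by rewrite -[RHS]card_ord cardT enumT.
by move=> <-; apply: eq_Ex => x _; rewrite /leadprod prodrXl.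
Qed.

End Moments.
End Recursion.

(** * Asymptotics of the moments *)

Section RatioAsymptotics.
Variable R : realType.

Lemma fact_ratio a b s :
  \prod_(p < s) ((p + a.+1)%:R / (p + b.+1)%:R) =
  ((s + a)`!%:R / a`!%:R) * (b`!%:R / (s + b)`!%:R) :> R.
Proof.
have f0 x : x`!%:R != 0 :> R by rewrite pnatr_eq0 -lt0n fact_gt0.
elim: s => [|s IH]; first by rewrite big_ord0 !add0n !divff // mulr1.
rewrite big_ord_recr /= IH !addSn !factS !addnS !natrM.
have nz x : x.+1%:R != 0 :> R by rewrite pnatr_eq0.
set u := (s + a).+1%:R; set v := (s + b).+1%:R; have v0 : v != 0 by exact: nz.
by clearbody u v; field; rewrite !f0 v0.
Qed.

Lemma cvg_shift (c : nat) : ((fun s : nat => s%:R / (s + c)%:R : R) @ \oo --> (1 : R)).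
Proof.
have h : (fun s : nat => s.+1%:R / (s.+1 + c)%:R : R) = fun s => 1 - c%:R * ((s + c.+1)%:R)^-1.
  apply/funext => s; rewrite addSnnS.
  have nz : (s + c.+1)%:R != 0 :> R by rewrite pnatr_eq0 addnS.
  by apply: (mulIf nz); rewrite -mulrA mulVf // mulrBl -mulrA mulVf // mulr1 mul1r !natrD -!natr1; ring.
have h2 : (fun s : nat => 1 - c%:R * ((s + c.+1)%:R)^-1 : R) @ \oo --> (1 - c%:R * 0 : R).
  apply: cvgB; first exact: cvg_cst.
  apply: cvgMr; rewrite (cvg_shiftn c.+1 (fun s => s%:R^-1 : R)).
  by rewrite -(cvg_shiftS (fun s => s%:R^-1 : R)); exact: cvg_harmonic.
by rewrite -(cvg_shiftS (fun s => s%:R / (s + c)%:R : R)) h; rewrite mulr0 subr0 in h2.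
Qed.

Lemma cvg_fact (a d : nat) :
  ((fun s : nat => s%:R ^+ d * ((s + a)`!%:R / (s + (a + d))`!%:R) : R) @ \oo --> (1 : R)).
Proof.
have f0 x : x`!%:R != 0 :> R by rewrite pnatr_eq0 -lt0n fact_gt0.
elim: d => [|d IH].
  under eq_fun => s do rewrite expr0 mul1r addn0 divff //; exact: cvg_cst.
have -> : (fun s : nat => s%:R ^+ d.+1 * ((s + a)`!%:R / (s + (a + d.+1))`!%:R) : R) =
    fun s => (s%:R ^+ d * ((s + a)`!%:R / (s + (a + d))`!%:R)) * (s%:R / (s + (a + d).+1)%:R).
  apply/funext => s; rewrite !addnS factS natrM exprS.
  have nz x : x.+1%:R != 0 :> R by rewrite pnatr_eq0.
  set u := (s + (a + d)).+1%:R; have u0 : u != 0 by exact: nz.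
  by clearbody u; field; rewrite !f0 u0.
rewrite -[X in _ --> X]mulr1; apply: cvgM => //; exact: cvg_shift.
Qed.

(** For each row [j] the product over [p] telescopes into a quotient of factorials that decays like
    [s^-(n-m)]; the m rows give the exponent, and the factorials left at the start of the telescope
    give the limit. *)
Lemma cvg_ratio (n m : nat) : (m < n)%N ->
  ((fun s : nat => s%:R ^+ (m * (n - m)) * ratio R n m s) @ \oo -->
   (\prod_(j < m) ((n - j.+1)`!%:R / (m - j.+1)`!%:R) : R)).
Proof.
move=> mn.
have -> : (fun s : nat => s%:R ^+ (m * (n - m)) * ratio R n m s) =
  fun s => \prod_(j < m) ((s%:R ^+ (n - m) * ((s + (m - j.+1))`!%:R / (s + (m - j.+1 + (n - m)))`!%:R))
      * ((n - j.+1)`!%:R / (m - j.+1)`!%:R)).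
  apply/funext => s; rewrite /ratio exchange_big /= mulnC exprM.
  have -> : (s%:R ^+ (n - m)) ^+ m = \prod_(j < m) s%:R ^+ (n - m) :> R.
    by rewrite prodr_const card_ord.
  rewrite -big_split; apply: eq_bigr => j _ /=.
  have jm := ltn_ord j.
  have -> : (m - j)%N = (m - j.+1).+1 by lia.
  have -> : (n - j)%N = (n - j.+1).+1 by lia.
  rewrite fact_ratio.
  have -> : (m - j.+1 + (n - m) = n - j.+1)%N by lia.
  have f0 x : x`!%:R != 0 :> R by rewrite pnatr_eq0 -lt0n fact_gt0.
  by field; rewrite !f0.
have H (I : Type) (r : seq I) (F : I -> nat -> R) (c : I -> R) :
    (forall j, F j @ \oo --> (1 : R)) ->
    (fun s => \prod_(j <- r) (F j s * c j)) @ \oo --> \prod_(j <- r) c j.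
  move=> hF; elim: r => [|j r IH].
    by under eq_fun do rewrite big_nil; rewrite big_nil; exact: cvg_cst.
  under eq_fun do rewrite big_cons; rewrite big_cons; apply: cvgM => //.
  rewrite -[X in _ --> X]mul1r; apply: cvgM => //; exact: cvg_cst.
by apply: H => j; exact: cvg_fact.
Qed.

Lemma cvg_ratio_pow (n m k : nat) : (m < n)%N ->
  ((fun s : nat => s%:R ^+ (k * (m * (n - m))) * ratio R n m s ^+ k) @ \oo -->
   ((\prod_(j < m) ((n - j.+1)`!%:R / (m - j.+1)`!%:R)) ^+ k : R)).
Proof.
move=> mn; rewrite (_ : (fun s : nat => _) = fun s => (s%:R ^+ (m * (n - m)) * ratio R n m s) ^+ k); last first.
  by apply/funext => s; rewrite mulnC exprM -exprMn.
elim: k => [|k IH].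
  rewrite (_ : (fun s : nat => _) = fun=> 1); first exact: cvg_cst.
  by apply/funext => s; rewrite expr0.
rewrite exprS (_ : (fun s : nat => _) = fun s => s%:R ^+ (m * (n - m)) * ratio R n m s *
  (s%:R ^+ (m * (n - m)) * ratio R n m s) ^+ k).
  by apply: cvgM => //; exact: cvg_ratio.
by apply/funext => s; rewrite exprS.
Qed.

End RatioAsymptotics.

(** * From moments to tails *)

Section Bernstein.
Variable R : realType.

(* [bern N f] is the Bernstein polynomial of the values [f 0, ..., f N], written
   by conditioning on the last of N coin tosses. *)
Fixpoint bern (N : nat) (f : nat -> R) : {poly R} :=
  if N is N'.+1 then 'X * bern N' (fun i => f i.+1) + (1 - 'X) * bern N' f
  else (f 0%N)%:P.

Lemma bernS N f y :
  (bern N.+1 f).[y] = y * (bern N (fun i => f i.+1)).[y] + (1 - y) * (bern N f).[y].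
Proof. by rewrite /= !hornerE. Qed.

Lemma bern_le N f g y : 0 <= y <= 1 -> (forall i, f i <= g i) ->
  (bern N f).[y] <= (bern N g).[y].
Proof.
move=> y01; elim: N f g => [|N IH] f g h; first by rewrite /= !hornerC.
rewrite !bernS; apply: lerD; apply: ler_wpM2l; try lra; by apply: IH => i; exact: h.
Qed.

Lemma bern_affine N f a b y : (bern N (fun i => a * f i + b)).[y] = a * (bern N f).[y] + b.
Proof.
elim: N f => [|N IH] f; first by rewrite /= !hornerC.
by rewrite !bernS !IH; ring.
Qed.

(** Mean square deviation of a binomial variable: variance plus squared bias. *)
Lemma bern_square N a y :
  (bern N (fun i => (i%:R - a) ^+ 2)).[y] = N%:R * y * (1 - y) + (N%:R * y - a) ^+ 2.
Proof.
elim: N a => [|N IH] a; first by rewrite /= hornerC; ring.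
rewrite bernS IH -natr1.
have -> : (bern N (fun i => (i.+1%:R - a) ^+ 2)).[y] =
    (bern N (fun i => (i%:R - (a - 1)) ^+ 2)).[y].
  by congr (bern N _).[y]; apply/funext => i; rewrite -natr1; congr (_ ^+ 2); ring.
by rewrite IH; ring.
Qed.

(** Chebyshev's argument: the Lipschitz bound is dominated by a quadratic through
    [2 |v| <= v^2 / eta + eta], and Bernstein polynomials of quadratics are explicit
    ([bern_square]). Taking [N] above [eta^-2] controls the variance term. *)
Lemma lipschitz_poly_approx (g : R -> R) (L e : R) : 0 <= L -> 0 < e ->
  (forall x y, `|g x - g y| <= L * `|x - y|) ->
  exists q : {poly R}, forall y, 0 <= y <= 1 -> `|g y - q.[y]| <= e.
Proof.
move=> L0 e0 hg.
pose eta := e / (L + 1); have eta0 : 0 < eta by rewrite /eta divr_gt0 //; lra.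
have Le : L * eta <= e.
  by rewrite /eta mulrCA ler_piMr ?(ltW e0) // ler_pdivrMr; lra.
pose N := (Num.truncn (eta ^-2)).+1.
have N0 : (0 : R) < N%:R by rewrite ltr0n.
have hN : 1 <= eta ^+ 2 * N%:R.
  have : eta ^- 2 <= N%:R by apply: ltW; rewrite /N truncnS_gt.
  by move=> h; rewrite mulrC -ler_pdivrMr ?exprn_gt0 // div1r.
exists (bern N (fun i => g (i%:R / N%:R))) => y y01.
pose A i := (L / (2 * eta * N%:R ^+ 2)) * (i%:R - N%:R * y) ^+ 2 + L * eta / 2.
have hA i : `|g (i%:R / N%:R) - g y| <= A i.
  apply: le_trans (hg _ _) _.
  set v := i%:R / N%:R - y.
  have -> : A i = L * ((v ^+ 2 / eta + eta) / 2).
    by rewrite /A /v; field; rewrite !gt_eqF.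
  apply: ler_wpM2l => //.
  rewrite ler_pdivlMr // -(ler_pM2r eta0) mulrDl divfK ?gt_eqF //.
  have := sqr_ge0 (`|v| - eta); have := real_normK (num_real v).
  by nra.
have B1 : (bern N A).[y] <= e.
  rewrite bern_affine bern_square subrr expr0n addr0.
  apply: le_trans Le.
  have -> : L / (2 * eta * N%:R ^+ 2) * (N%:R * y * (1 - y)) =
      L / (eta * N%:R) * (y * (1 - y) / 2).
    by field; rewrite !gt_eqF.
  have h1 : L / (eta * N%:R) <= L * eta.
    rewrite ler_pdivrMr ?(mulr_gt0 eta0 N0) //.
    by have := ler_wpM2l L0 hN; rewrite mulr1; nra.
  have h2 : y * (1 - y) / 2 <= 1 / 2 by nra.
  have h3 : 0 <= y * (1 - y) / 2 by apply: divr_ge0; nra.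
  have h4 : 0 <= L * eta by rewrite mulr_ge0 // ltW.
  move: h1 h2 h3 h4; move: (L / (eta * N%:R)) (y * (1 - y) / 2) (L * eta) => u v z h1 h2 h3 h4.
  by nra.
rewrite distrC ler_norml; apply/andP; split.
  rewrite lerBrDl; apply: le_trans (_ : (bern N (fun i => (-1) * A i + g y)).[y] <= _).
    by rewrite bern_affine; lra.
  by apply: bern_le => // i; have := hA i; rewrite ler_norml => /andP[]; lra.
rewrite lerBlDl; apply: le_trans (_ : (bern N (fun i => 1 * A i + g y)).[y] <= _).
  by apply: bern_le => // i; have := hA i; rewrite ler_norml => /andP[]; lra.
by rewrite bern_affine; lra.
Qed.

(** [y * g y] is a ramp squeezed between the indicators of [[b, +oo[] and []b', +oo[]. The factor
    [y] is split off because [weighted] supplies it; dividing the ramp by [max b' y] rather than by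
    [y] keeps [g] Lipschitz. *)
Lemma lipschitz_cutoff (b' b : R) : 0 < b' -> b' < b ->
  exists g : R -> R, exists2 L, 0 <= L &
   [/\ forall x y, `|g x - g y| <= L * `|x - y|,
       forall y, 0 <= y -> 0 <= y * g y <= 1,
       forall y, b <= y -> y * g y = 1 &
       forall y, y <= b' -> g y = 0].
Proof.
move=> b'0 bb'.
pose u (y : R) := Num.min 1 (Num.max 0 ((y - b') / (b - b'))).
pose v (y : R) := (Num.max b' y)^-1.
have d0 : 0 < b - b' by lra.
have u01 y : 0 <= u y <= 1.
  by rewrite /u le_min ge_min lexx ler01 le_max lexx.
have m0 y : 0 < Num.max b' y by rewrite lt_max b'0.
have v01 y : 0 <= v y <= b'^-1.
  by rewrite /v invr_ge0 (ltW (m0 y)) /= lef_pV2 ?posrE // le_max lexx.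
have maxL (c x y : R) : `|Num.max c x - Num.max c y| <= `|x - y|.
  by rewrite !maxEle; case: ifP => h1; case: ifP => h2;
    have := ler_norm (x - y); have := ler_norm (y - x); rewrite -(distrC y x) ?subrr ?normr0 // => *;
    rewrite ?normr_ge0 // ler_norml; apply/andP; split; lra.
have minL (c x y : R) : `|Num.min c x - Num.min c y| <= `|x - y|.
  by rewrite !minEle; case: ifP => h1; case: ifP => h2;
    have := ler_norm (x - y); have := ler_norm (y - x); rewrite -(distrC y x) ?subrr ?normr0 // => *;
    rewrite ?normr_ge0 // ler_norml; apply/andP; split; lra.
have uL x y : `|u x - u y| <= (b - b')^-1 * `|x - y|.
  apply: le_trans (minL _ _ _) _; apply: le_trans (maxL _ _ _) _.
  rewrite -mulrBl normrM mulrC ger0_norm ?invr_ge0 ?(ltW d0) //.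
  by have -> : x - b' - (y - b') = x - y by ring.
have vL x y : `|v x - v y| <= b'^-1 ^+ 2 * `|x - y|.
  have -> : v x - v y = v x * v y * (Num.max b' y - Num.max b' x).
    by rewrite /v; field; rewrite !gt_eqF.
  rewrite normrM ger0_norm; last by apply: mulr_ge0; case/andP: (v01 x); case/andP: (v01 y).
  apply: ler_pM => //.
  - by apply: mulr_ge0; case/andP: (v01 x); case/andP: (v01 y).
  - by rewrite expr2; apply: ler_pM; case/andP: (v01 x); case/andP: (v01 y).
  - by rewrite (distrC x y); exact: maxL.
have ib0 : 0 <= b'^-1 by rewrite invr_ge0 ltW.
exists (fun y => u y * v y), ((b - b')^-1 * b'^-1 + b'^-1 ^+ 2).
  by rewrite addr_ge0 ?mulr_ge0 ?exprn_ge0 ?invr_ge0 // ltW.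
split.
- move=> x y.
  have -> : u x * v x - u y * v y = (u x - u y) * v x + u y * (v x - v y) by ring.
  apply: le_trans (ler_normD _ _) _; rewrite [leRHS]mulrDl; apply: lerD; rewrite normrM.
    rewrite mulrAC; apply: ler_pM => //; last by case/andP: (v01 x) => h1 h2; rewrite ger0_norm.
  rewrite -[leRHS]mul1r; apply: ler_pM => //.
  by case/andP: (u01 y) => h1 h2; rewrite ger0_norm.
- move=> y y0; have /andP[u0 u1] := u01 y; have /andP[v0 v1] := v01 y.
  have h : y * v y <= 1 by rewrite /v ler_pdivrMr // mul1r le_max lexx orbT.
  have h0 : 0 <= y * v y by exact: mulr_ge0.
  by rewrite mulrCA; apply/andP; split; nra.
- move=> y by_; have -> : u y = 1.
    apply/min_idPl; rewrite le_max; apply/orP; right.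
    by rewrite ler_pdivlMr // mul1r; lra.
  rewrite mul1r /v (max_idPr _); last by lra.
  by rewrite divff //; lra.
- move=> y yb; rewrite /u (max_idPl _) ?(min_idPr _) ?ler01 ?mul0r //.
  by rewrite ler_pdivrMr // mul0r; lra.
Qed.

End Bernstein.

(** * The scaled moment functional *)

Section MomentTail.
Context d (T : measurableType d) (R : realType) (P : probability T R) (S : set T).
Hypotheses (mS : measurable S) (PS : P S = 1%E).
Variable X : T -> R.
Hypotheses (gX : good S X) (X01 : forall x, S x -> 0 <= X x <= 1).

Definition tailp (c : R) : R := Ex P S (\1_[set x | c <= X x]).

Lemma good_tail c : good S (\1_[set x | c <= X x] : T -> R).
Proof.
apply: good_indic; rewrite setIC.
have := proj1 gX mS `[c, +oo[%classic (measurable_itv _).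
by congr measurable; apply/seteqP; split => x /= [h1]; rewrite in_itv /= andbT.
Qed.

Variables (tau : nat) (C : R).
Hypothesis (hC : (fun s : nat => s%:R ^+ tau * Ex P S (fun x => X x ^+ s) : R) @ \oo --> C).

(** The factor [X x ^+ s] in front of [g] removes the constant monomial, whose scaled expectation
    [s^tau] diverges for positive tau. *)
Definition weighted (s : nat) (g : R -> R) : R :=
  s%:R ^+ tau * Ex P S (fun x => X x ^+ s * g (X x ^+ s)).

(** The monomial of degree [i] meets the moment of order [s (i + 1)], and this rescaling of [s]
    divides the limit by [(i + 1)^tau]. *)
Lemma weighted_poly (q : {poly R}) :
  (fun s => weighted s (horner q)) @ \oo --> C * \sum_(i < size q) q`_i / i.+1%:R ^+ tau.
Proof.
have -> : (fun s => weighted s (horner q)) = fun s => \sum_(i < size q) (q`_i / i.+1%:R ^+ tau *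
    ((s * i.+1)%:R ^+ tau * Ex P S (fun x => X x ^+ (s * i.+1)))).
  apply/funext => s; rewrite /weighted.
  rewrite (eq_Ex P (g := fun x => \sum_(i < size q) q`_i * X x ^+ (s * i.+1))); last first.
    move=> x _; rewrite horner_coef mulr_sumr; apply: eq_bigr => i _.
    by rewrite mulrCA -exprM -exprD mulnS.
  rewrite (Ex_sum mS PS); last by move=> i; apply: goodZ; exact: goodX.
  rewrite mulr_sumr; apply: eq_bigr => i _; rewrite ExZ //; last exact: goodX.
  rewrite natrM exprMn.
  have i0 : i.+1%:R ^+ tau != 0 :> R by rewrite expf_neq0 // pnatr_eq0.
  by field.
rewrite mulr_sumr.
have H (I : Type) (r : seq I) (F : I -> nat -> R) (l : I -> R) :
    (forall i, F i @ \oo --> l i) ->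
    (fun s => \sum_(i <- r) F i s) @ \oo --> \sum_(i <- r) l i.
  move=> hF; elim: r => [|j r IH].
    by under eq_fun do rewrite big_nil; rewrite big_nil; exact: cvg_cst.
  by under eq_fun do rewrite big_cons; rewrite big_cons; apply: cvgD.
apply: (H _ _ (fun (i : 'I_(size q)) (s : nat) => q`_i / i.+1%:R ^+ tau *
    ((s * i.+1)%:R ^+ tau * Ex P S (fun x => X x ^+ (s * i.+1))))) => i.
rewrite [C * _]mulrC; apply: cvgMr.
have hs : (fun s => (s * i.+1)%N) @ \oo --> \oo.
  move=> A [N _ NA]; exists N => // s /= Ns; apply: NA => /=.
  by rewrite (leq_trans Ns) // leq_pmulr.
exact: (cvg_comp _ _ hs hC).
Qed.

Lemma weighted_close (s : nat) (g h : R -> R) e :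
  good S (fun x => X x ^+ s * g (X x ^+ s)) -> good S (fun x => X x ^+ s * h (X x ^+ s)) ->
  (forall y, 0 <= y <= 1 -> `|g y - h y| <= e) ->
  weighted s g <= weighted s h + e * (s%:R ^+ tau * Ex P S (fun x => X x ^+ s)).
Proof.
move=> gg gh he; rewrite /weighted mulrCA -mulrDr; apply: ler_wpM2l; first exact: exprn_ge0.
rewrite -ExZ //; last exact: goodX.
rewrite -ExD //; last by apply: goodZ; exact: goodX.
apply: le_Ex => //; first by apply: goodD => //; apply: goodZ; exact: goodX.
move=> x /X01 /andP[x0 x1].
have /he : 0 <= X x ^+ s <= 1 by rewrite exprn_ge0 // exprn_ile1.
have : 0 <= X x ^+ s by rewrite exprn_ge0.
by rewrite ler_norml => y0 /andP[_]; nra.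
Qed.

Lemma good_weighted_lip (s : nat) (g : R -> R) L :
  (forall x y, `|g x - g y| <= L * `|x - y|) -> good S (fun x => X x ^+ s * g (X x ^+ s)).
Proof.
move=> gL.
have cg : continuous g.
  move=> x; apply/cvgrPdist_lt => e e0; near=> y.
  apply: le_lt_trans (gL _ _) _.
  have : `|x - y| < e / (`|L| + 1).
    by near: y; apply: cvgr_dist_lt; rewrite // divr_gt0 // ltr_wpDl.
  rewrite ltr_pdivlMr ?ltr_wpDl //; have := ler_norm L; have := normr_ge0 (x - y); nra.
apply: goodM; first exact: goodX.
have gXs := goodX s gX; have [mXs [M hM]] := gXs; split.
  by apply: (measurableT_comp (continuous_measurable_fun cg)).
exists (`|g 0| + `|L| * M) => x Sx.
have -> : g (X x ^+ s) = g 0 + (g (X x ^+ s) - g 0) by ring.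
apply: le_trans (ler_normD _ _) _; rewrite lerD2l; apply: le_trans (gL _ _) _.
rewrite subr0; apply: le_trans (_ : `|L| * `|X x ^+ s| <= _).
  by rewrite ler_wpM2r // ler_norm.
by rewrite ler_wpM2l // hM.
Unshelve. all: by end_near. Qed.

Lemma good_weighted_poly (s : nat) (q : {poly R}) :
  good S (fun x => X x ^+ s * horner q (X x ^+ s)).
Proof.
have h (i : 'I_(size q)) := goodZ q`_i (goodX i (goodX s gX)).
apply: goodM; first exact: goodX.
by apply: good_ext (good_sum (index_enum _) xpredT h) => x _; rewrite horner_coef.
Qed.

End MomentTail.

Section TailComparison.
Variable R : realType.
Context d1 (T1 : measurableType d1) (P1 : probability T1 R) (S1 : set T1).
Context d2 (T2 : measurableType d2) (P2 : probability T2 R) (S2 : set T2).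
Hypotheses (mS1 : measurable S1) (PS1 : P1 S1 = 1%E).
Hypotheses (mS2 : measurable S2) (PS2 : P2 S2 = 1%E).
Variables (X : T1 -> R) (Y : T2 -> R).
Hypotheses (gX : good S1 X) (X01 : forall x, S1 x -> 0 <= X x <= 1).
Hypotheses (gY : good S2 Y) (Y01 : forall x, S2 x -> 0 <= Y x <= 1).
Variables (tau : nat) (C1 C2 : R).
Hypotheses (C10 : 0 < C1) (C20 : 0 < C2).
Hypothesis hC1 : (fun s : nat => s%:R ^+ tau * Ex P1 S1 (fun x => X x ^+ s) : R) @ \oo --> C1.
Hypothesis hC2 : (fun s : nat => s%:R ^+ tau * Ex P2 S2 (fun x => Y x ^+ s) : R) @ \oo --> C2.

(* Karamata: the functional [weighted] has the same limit on polynomials for X and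
   for Y up to the factor C1 / C2, hence also on a Lipschitz cutoff between b' and b. *)
Lemma tail_comparison b' b e : 0 < b' -> b' < b -> 0 < e ->
  \forall s \near \oo,
    s%:R ^+ tau * tailp P1 S1 (fun x => X x ^+ s) b / C1 <=
    s%:R ^+ tau * tailp P2 S2 (fun x => Y x ^+ s) b' / C2 + e.
Proof.
move=> b'0 bb' e0.
have [g [L L0 [gL g1 gb gb']]] := lipschitz_cutoff b'0 bb'.
(* Each side loses [eta] to the polynomial limit and [2 * eta] to the approximation, since the
   scaled moments are eventually below [2 * C1] and [2 * C2]. *)
pose eta := e / 6; have eta0 : 0 < eta by rewrite divr_gt0.
have [q hq] := lipschitz_poly_approx L0 eta0 gL.
set l := \sum_(i < size q) q`_i / i.+1%:R ^+ tau.
have w1 : (fun s => weighted P1 S1 X tau s (horner q)) @ \oo --> C1 * l.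
  exact: (weighted_poly mS1 PS1).
have w2 : (fun s => weighted P2 S2 Y tau s (horner q)) @ \oo --> C2 * l.
  exact: (weighted_poly mS2 PS2).
have hh1 : C1 < 2 * C1 by move: C10; lra.
have hh2 : C2 < 2 * C2 by move: C20; lra.
near=> s.
have st0 : 0 <= s%:R ^+ tau :> R by exact: exprn_ge0.
have t1 : s%:R ^+ tau * tailp P1 S1 (fun x => X x ^+ s) b <= weighted P1 S1 X tau s g.
  rewrite /weighted ler_wpM2l //; apply: le_Ex => //.
  - by apply: good_tail => //; exact: goodX.
  - exact: good_weighted_lip gL.
  - move=> x /X01 /andP[x0 x1]; rewrite indicE; case: (boolP (_ \in _)).
      by rewrite inE /= => /gb ->.
    by move=> _; case/andP: (g1 (X x ^+ s) (exprn_ge0 s x0)).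
have t2 : weighted P2 S2 Y tau s g <= s%:R ^+ tau * tailp P2 S2 (fun x => Y x ^+ s) b'.
  rewrite /weighted ler_wpM2l //; apply: le_Ex => //.
  - exact: good_weighted_lip gL.
  - by apply: good_tail => //; exact: goodX.
  - move=> x /Y01 /andP[x0 x1]; rewrite indicE; case: (boolP (_ \in _)).
      by move=> _; case/andP: (g1 (Y x ^+ s) (exprn_ge0 s x0)).
    rewrite notin_setE /= => /negP; rewrite -ltNge => /ltW /gb' ->.
    by rewrite mulr0.
have q1 : weighted P1 S1 X tau s g <= weighted P1 S1 X tau s (horner q)
    + eta * (s%:R ^+ tau * Ex P1 S1 (fun x => X x ^+ s)).
  by apply: weighted_close => //; [exact: good_weighted_lip gL|exact: good_weighted_poly].
have q2 : weighted P2 S2 Y tau s (horner q) <= weighted P2 S2 Y tau s g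
    + eta * (s%:R ^+ tau * Ex P2 S2 (fun x => Y x ^+ s)).
  apply: weighted_close => //; [exact: good_weighted_poly|exact: good_weighted_lip gL|].
  by move=> y; rewrite distrC; exact: hq.
have m1 : s%:R ^+ tau * Ex P1 S1 (fun x => X x ^+ s) <= 2 * C1.
  near: s; exact: (cvgr_le _ hC1 _ hh1).
have m2 : s%:R ^+ tau * Ex P2 S2 (fun x => Y x ^+ s) <= 2 * C2.
  near: s; exact: (cvgr_le _ hC2 _ hh2).
have c1 : weighted P1 S1 X tau s (horner q) <= C1 * (l + eta).
  near: s; apply: (cvgr_le _ w1); rewrite ltr_pM2l //; lra.
have c2 : C2 * (l - eta) <= weighted P2 S2 Y tau s (horner q).
  near: s; apply: (cvgr_ge _ w2); rewrite ltr_pM2l //; lra.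
rewrite ler_pdivrMr // mulrDl mulrAC.
set A := s%:R ^+ tau * tailp P2 _ _ _ in t2 *.
have hA : C2 * (l - 3 * eta) <= A by nra.
have hA' : l - 3 * eta <= A / C2 by rewrite ler_pdivlMr // mulrC.
have hB : s%:R ^+ tau * tailp P1 S1 (fun x => X x ^+ s) b <= C1 * (l + 3 * eta) by nra.
apply: le_trans hB _; have -> : e = 6 * eta by rewrite /eta; field.
have hA2 := ler_wpM2l (ltW C10) hA'.
have -> : A * C1 / C2 = C1 * (A / C2) by ring.
by move: hA2; lra.
Unshelve. all: by end_near. Qed.

End TailComparison.

(** * The Beta(1, t + 1) law: explicit moments and tails *)

Section BetaReference.
Variables (R : realType) (t : nat).
Local Notation T2 := (measurableTypeR R).
Local Notation P2 := (beta_prob 1 t.+1 : probability T2 R).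
Local Notation S2 := (`[0%R, 1%R]%classic : set T2).
Local Notation leb := (@lebesgue_measure R).

Lemma good_beta : good S2 (fun x : T2 => x : R).
Proof.
split; first exact: measurable_id.
by exists 1 => x; rewrite /= in_itv /= => /andP[x0 x1]; rewrite ger0_norm.
Qed.

Lemma beta01 (x : R) : S2 x -> 0 <= x <= 1.
Proof. by rewrite /= in_itv. Qed.

Lemma beta_pdf01 x : S2 x -> beta_pdf 1 t.+1 x = t.+1%:R * (1 - x) ^+ t.
Proof.
move=> Sx; rewrite /beta_pdf patchE mem_set // beta_fun1Sn invrK mulrC.
by rewrite /= XMonemX0n.
Qed.

Lemma beta_moment s :
  Ex P2 S2 (fun x => x ^+ s) = t.+1%:R * beta_fun s.+1 t.+1.
Proof.
have gs := goodX s good_beta.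
have mS2 : measurable S2 by exact: measurable_itv.
have ig := good_intg (P := P2) mS2 gs.
rewrite /Ex /Rintegral integral_beta_prob //; first last.
- by case/integrableP : ig.
- by case/integrableP : ig.
transitivity (\int[leb]_(x in S2) (t.+1%:R * XMonemX s t x)).
  rewrite /Rintegral; congr fine; apply: eq_integral => x; rewrite inE => Sx.
  rewrite beta_pdf01 // -EFinM; congr (_%:E).
  by rewrite /XMonemX /= mulrCA.
rewrite RintegralZl //; last exact: integrable_XMonemX.
by congr (_ * _); rewrite /beta_fun -Rintegral_mkcond.
Qed.

(** The moment is [(t + 1)! s! / (s + t + 1)!], to which [cvg_fact] applies. *)
Lemma beta_moment_cvg :
  (fun s : nat => s%:R ^+ t.+1 * Ex P2 S2 (fun x => x ^+ s) : R) @ \oo --> (t.+1`!%:R : R).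
Proof.
have := @cvg_fact R 0 t.+1 => /(@cvgMr _ _ _ _ _ t.+1`!%:R); rewrite mulr1.
under eq_fun => s.
  rewrite (_ : _ * _ = s%:R ^+ t.+1 * Ex P2 S2 (fun x => x ^+ s)); first over.
  rewrite beta_moment beta_fun_fact addn0 add0n addnS natrM factS natrM.
  by ring.
by [].
Qed.

Lemma beta_tail c : 0 <= c <= 1 -> tailp P2 S2 (fun x : T2 => x : R) c = (1 - c) ^+ t.+1.
Proof.
move=> /andP[c0 c1]; have mI : measurable ([set x : T2 | c <= x] `&` S2).
  apply: measurableI; last exact: measurable_itv.
  rewrite (_ : [set _ | _] = `[c, +oo[%classic); first exact: measurable_itv.
  by apply/seteqP; split => x /=; rewrite in_itv /= andbT.
have mS2 : measurable S2 by exact: measurable_itv.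
rewrite /tailp Ex_indic //.
have -> : [set x : T2 | c <= x] `&` S2 = `[c, 1]%classic.
  apply/seteqP; split => x /=; rewrite !in_itv /=; first by move=> [-> /andP[_ ->]].
  by move=> /andP[h1 h2]; split => //; rewrite h2 (le_trans c0).
have eb := @integral_beta_pdf R 1 t.+1 `[c, 1]%classic (measurable_itv _).
transitivity (fine (\int[leb]_(x in `[c, 1%R]) (beta_pdf 1 t.+1 x)%:E)%E); first by rewrite eb.
move: c1; rewrite le_eqVlt => /predU1P[->|c1].
  by rewrite set_itv1 integral_set1 subrr expr0n.
transitivity (fine (\int[leb]_(x in `[c, 1%R]) (t.+1%:R * (1 - x) ^+ t)%:E)%E).
  congr fine; apply: eq_integral => x; rewrite inE /= in_itv /= => /andP[h1 h2].
  by rewrite beta_pdf01 //= in_itv /= h2 (le_trans c0).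
rewrite (@continuous_FTC2 _ _ (fun x => (unstable.onem x) ^+ t.+1 * -1)) //=.
- by rewrite unstable.onem1 expr0n /= mul0r mulrN1 sub0r opprK.
- apply: continuous_in_subspaceT => x _; apply: cvgMr; exact: continuous_onemXn.
- split.
  + by move=> y _; apply: derivableM => //=; exact: onemXn_derivable.
  + apply: cvg_at_right_filter; apply: cvgM; last exact: cvg_cst.
    exact: continuous_onemXn.
  + apply: cvg_at_left_filter; apply: cvgM; last exact: cvg_cst.
    exact: continuous_onemXn.
- move=> x _; rewrite derive1Mr //; last exact: onemXn_derivable.
  by rewrite derive_onemXn /=; ring.
Qed.

Lemma beta_tailX s c : 0 < c ->
  tailp P2 S2 (fun x : T2 => x ^+ s.+1 : R) (expR (- c)) = (1 - expR (- (c / s.+1%:R))) ^+ t.+1.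
Proof.
move=> c0.
have s0 : (0 : R) < s.+1%:R by rewrite ltr0n.
rewrite -beta_tail; last first.
  by rewrite expR_ge0 /= -expR0 ler_expR lerNl oppr0 divr_ge0 // ltW.
apply: eq_Ex => x /beta01/andP[x0 x1].
rewrite !indicE; congr (_%:R); congr nat_of_bool; apply/idP/idP; rewrite !inE /=.
  move=> h; rewrite -(@ler_pXn2r _ s.+1) ?nnegrE ?expR_ge0 //.
  by rewrite -expRM_natl mulrN mulrCA divff ?mulr1 // gt_eqF.
move=> h; have : expR (- (c / s.+1%:R)) ^+ s.+1 <= x ^+ s.+1.
  by rewrite ler_pXn2r ?nnegrE ?expR_ge0.
by rewrite -expRM_natl mulrN mulrCA divff ?mulr1 // gt_eqF.
Qed.

End BetaReference.

Section TailLimit.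
Context d (T : measurableType d) (R : realType) (P : probability T R) (S : set T).
Hypotheses (mS : measurable S) (PS : P S = 1%E).
Variable X : T -> R.
Hypotheses (gX : good S X) (X01 : forall x, S x -> 0 <= X x <= 1).
Variables (t : nat) (C : R).
Hypotheses (C0 : 0 < C).
Hypothesis hC : (fun s : nat => s%:R ^+ t.+1 * Ex P S (fun x => X x ^+ s) : R) @ \oo --> C.

Let K : R := C / t.+1`!%:R.
Let K0 : 0 < K. Proof. by rewrite divr_gt0 // ltr0n fact_gt0. Qed.
Let f0 : (0 : R) < t.+1`!%:R. Proof. by rewrite ltr0n fact_gt0. Qed.

(** The threshold [expR (- 1)] for [X ^ s] is compared with the slightly lower [expR (- (1 + dl))]
    for the Beta law, whose tail there is at most [((1 + dl) / s)^(t+1)]. *)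
Lemma tail_eventually_le e : 0 < e ->
  \forall s \near \oo, s%:R ^+ t.+1 * tailp P S (fun x => X x ^+ s) (expR (- 1)) <= K * (1 + e).
Proof.
move=> e0.
have mS2 : measurable (`[0%R, 1%R]%classic : set (measurableTypeR R)) by exact: measurable_itv.
have hd : exists2 dl : R, 0 < dl & (1 + dl) ^+ t.+1 <= 1 + e / 2.
  have hc : (fun x : R => (1 + x) ^+ t.+1) @ 0^'+ --> ((1 + 0) ^+ t.+1 : R).
    apply: cvg_at_right_filter; apply: (cvg_comp (fun x : R => 1 + x) (fun x => x ^+ t.+1)).
      by apply: cvgD; [exact: cvg_cst|exact: cvg_id].
    exact: exprn_continuous.
  have : \forall x \near 0^'+, (1 + x) ^+ t.+1 <= 1 + e / 2.
    by apply: (cvgr_le _ hc); rewrite addr0 expr1n; lra.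
  move=> h; have [x [x0 hx]] : exists x : R, 0 < x /\ (1 + x) ^+ t.+1 <= 1 + e / 2.
    near (0 : R)^'+ => x; exists x; split; first by [].
    by near: x.
  by exists x.
have [dl dl0 hdl] := hd.
have b'0 : 0 < expR (- (1 + dl)) by exact: expR_gt0.
have bb : expR (- (1 + dl)) < expR (-1) by rewrite ltr_expR; lra.
have e20 : 0 < e / (2 * t.+1`!%:R) by rewrite divr_gt0 // mulr_gt0.
have := tail_comparison mS PS mS2 (beta_prob01 1 t.+1) gX X01 (@good_beta R) (@beta01 R)
  C0 f0 hC (@beta_moment_cvg R t) b'0 bb e20.
apply: filterS2 (nbhs_infty_gt 0) => s; case: s => // s _.
rewrite beta_tailX; last by lra.
set A := _ * tailp _ _ _ _ => h.
have s0 : (0 : R) < s.+1%:R by rewrite ltr0n.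
have h2 : s.+1%:R ^+ t.+1 * (1 - expR (- ((1 + dl) / s.+1%:R))) ^+ t.+1 <= 1 + e / 2.
  apply: le_trans hdl; rewrite -exprMn ler_pXn2r ?nnegrE //; try lra.
    have := expR_ge1Dx (- ((1 + dl) / s.+1%:R)); set u := (1 + dl) / s.+1%:R => h3.
    have -> : 1 + dl = s.+1%:R * u by rewrite /u mulrCA divff ?mulr1 // gt_eqF.
    by rewrite ler_pM2l //; lra.
  apply: mulr_ge0; first exact: ltW.
  by rewrite subr_ge0 -[leRHS]expR0 ler_expR oppr_le0 divr_ge0 //; lra.
have h3 : A / C <= (1 + e) / t.+1`!%:R.
  apply: le_trans h _.
  have -> : (1 + e) / t.+1`!%:R = (1 + e / 2) / t.+1`!%:R + e / (2 * t.+1`!%:R).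
    by field; rewrite gt_eqF.
  by rewrite lerD2r ler_pM2r ?invr_gt0.
rewrite ler_pdivrMr // in h3; apply: le_trans h3 _.
by rewrite /K le_eqVlt; apply/orP; left; apply/eqP; field; rewrite gt_eqF.
Unshelve. all: by end_near. Qed.

Lemma tail_eventually_ge e : 0 < e ->
  \forall s \near \oo, K * (1 - e) <= s%:R ^+ t.+1 * tailp P S (fun x => X x ^+ s) (expR (- 1)).
Proof.
move=> e0.
have mS2 : measurable (`[0%R, 1%R]%classic : set (measurableTypeR R)) by exact: measurable_itv.
(* Squared: one [1 - dl] comes from the threshold [expR (- (1 - dl))], the other from
   [1 - expR (- v) >= (1 - dl) * v] for [0 < v <= dl]. *)
have hd : exists dl : R, [/\ 0 < dl, dl < 1 & 1 - e / 2 <= ((1 - dl) * (1 - dl)) ^+ t.+1].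
  have hc : (fun x : R => ((1 - x) * (1 - x)) ^+ t.+1) @ 0^'+ --> (((1 - 0) * (1 - 0)) ^+ t.+1 : R).
    apply: cvg_at_right_filter; apply: (cvg_comp (fun x : R => (1 - x) * (1 - x)) (fun x => x ^+ t.+1)).
      by apply: cvgM; apply: cvgB; by [exact: cvg_cst|exact: cvg_id].
    exact: exprn_continuous.
  have h : \forall x \near 0^'+, 1 - e / 2 <= ((1 - x) * (1 - x)) ^+ t.+1.
    by apply: (cvgr_ge _ hc); rewrite subr0 mulr1 expr1n; lra.
  near (0 : R)^'+ => x; exists x; split; first by [].
    by near: x; exact: nbhs_right_lt.
  by near: x.
have [dl [dl0 dl1 hdl]] := hd.
have b'0 : 0 < expR (- 1) :> R by exact: expR_gt0.
have bb : expR (- 1) < expR (- (1 - dl)) by rewrite ltr_expR; lra.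
have e20 : 0 < e / (2 * t.+1`!%:R) by rewrite divr_gt0 // mulr_gt0.
have := tail_comparison mS2 (beta_prob01 1 t.+1) mS PS (@good_beta R) (@beta01 R) gX X01
  f0 C0 (@beta_moment_cvg R t) hC b'0 bb e20.
apply: filterS2 (nbhs_infty_ger dl^-1) => s; case: s => [|s].
  by rewrite /= => h; have := invr_gt0 dl; rewrite dl0; lra.
rewrite /= => hs.
rewrite beta_tailX; last by lra.
set A := _ * tailp _ _ _ _ => h.
have s0 : (0 : R) < s.+1%:R by rewrite ltr0n.
have h2 : 1 - e / 2 <= s.+1%:R ^+ t.+1 * (1 - expR (- ((1 - dl) / s.+1%:R))) ^+ t.+1.
  apply: le_trans hdl _; set v := (1 - dl) / s.+1%:R.
  have v0 : 0 < v by rewrite divr_gt0 //; lra.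
  have sv : s.+1%:R * v = 1 - dl by rewrite /v mulrCA divff ?mulr1 // gt_eqF.
  have vdl : v <= dl.
    rewrite ler_pdivrMr //.
    by move: hs; rewrite -[dl^-1]div1r ler_pdivrMr // => hs; lra.
  have h5 : v * (1 - dl) <= 1 - expR (- v).
    have := expR_ge1Dx v; rewrite expRN => h6.
    have : (expR v)^-1 <= (1 + v)^-1 by rewrite lef_pV2 ?posrE //; lra.
    move=> h7; have h8 : (1 + v) * (1 + v)^-1 = 1 by rewrite divff //; lra.
    have : 0 < (1 + v)^-1 by rewrite invr_gt0; lra.
    by nra.
  rewrite -exprMn ler_pXn2r ?nnegrE //.
  - by rewrite -[X in X * _ <= _]sv -mulrA ler_pM2l.
  - by apply: mulr_ge0; lra.
  - by apply: mulr_ge0; nra.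
have h3 : (1 - e / 2) / t.+1`!%:R <= A / C + e / (2 * t.+1`!%:R).
  by apply: le_trans h; rewrite ler_pM2r ?invr_gt0.
have -> : K * (1 - e) = ((1 - e / 2) / t.+1`!%:R - e / (2 * t.+1`!%:R)) * C.
  by rewrite /K; field; rewrite gt_eqF.
by rewrite -ler_pdivlMr // lerBlDr.
Unshelve. all: by end_near. Qed.

Variable de : T -> R.
Hypotheses (gde : good S de).
Hypothesis (hde : forall x, S x -> 1 - de x <= X x <= expR (- de x)).

Definition ballp (r : R) : R := Ex P S (\1_[set x | de x <= r]).

Lemma good_ball r : good S (\1_[set x | de x <= r] : T -> R).
Proof.
apply: good_indic; rewrite setIC.
have := proj1 gde mS `]-oo, r]%classic (measurable_itv _).
by congr measurable; apply/seteqP; split => x /= [h1]; rewrite in_itv /=.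
Qed.

(** [de x <= 1 / (s + 2)] gives [X x >= (s + 1) / (s + 2) >= exp (- 1 / (s + 1))], hence the shift
    between the radius and the power. *)
Lemma ball_le_tail s r : r <= s.+2%:R^-1 ->
  ballp r <= tailp P S (fun x => X x ^+ s.+1) (expR (- 1)).
Proof.
move=> hr; apply: le_Ex => //; first exact: good_ball.
  by apply: good_tail => //; exact: goodX.
move=> x Sx; rewrite !indicE; case: (boolP (_ \in _)) => [|_]; last by case: (_ \in _).
rewrite inE /= => dr; rewrite mem_set //=.
have /andP[h1 _] := hde Sx.
have s0 : (0 : R) < s.+1%:R by rewrite ltr0n.
have s2 : (0 : R) < s.+2%:R by rewrite ltr0n.
have es : s.+2%:R = s.+1%:R + 1 :> R by rewrite natr1.
have hX : expR (- s.+1%:R^-1) <= X x.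
  have h2 : s.+1%:R / s.+2%:R <= X x.
    have -> : s.+1%:R / s.+2%:R = 1 - s.+2%:R^-1 :> R by apply: (mulIf (lt0r_neq0 s2)); rewrite mulrBl mul1r mulVf ?divfK ?gt_eqF // es; ring.
    by move: h1 dr hr; move: (s.+2%:R^-1) => u; lra.
  apply: le_trans h2; rewrite expRN -[leRHS]invrK lef_pV2 ?posrE ?expR_gt0 ?invr_gt0 ?divr_gt0 //.
  have := expR_ge1Dx (s.+1%:R^-1 : R).
  by rewrite invf_div es mulrDl divff ?gt_eqF // mul1r.
apply: le_trans (_ : expR (- s.+1%:R^-1) ^+ s.+1 <= _).
  by rewrite -expRM_natl mulrN mulfV ?gt_eqF.
by rewrite ler_pXn2r ?nnegrE ?expR_ge0 // (le_trans _ hX) // expR_ge0.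
Qed.

Lemma tail_le_ball s r : s.+1%:R^-1 <= r ->
  tailp P S (fun x => X x ^+ s.+1) (expR (- 1)) <= ballp r.
Proof.
move=> hr; apply: le_Ex => //; last 2 first.
- exact: good_ball.
- move=> x Sx; rewrite !indicE; case: (boolP (_ \in _)) => [|_]; last by case: (_ \in _).
  rewrite inE /= => tX; rewrite mem_set //=.
  have /andP[_ h1] := hde Sx; have /andP[X0 _] := X01 Sx.
  have s0 : (0 : R) < s.+1%:R by rewrite ltr0n.
  apply: le_trans hr; rewrite -[leRHS]mul1r ler_pdivlMr // mulrC.
  rewrite -lerN2 -ler_expR; apply: le_trans tX _.
  rewrite -mulrN expRM_natl ler_pXn2r ?nnegrE ?expR_ge0 //.
- by apply: good_tail => //; exact: goodX.
Qed.

(** Takes [s] near [1 / r] in the two tail comparisons; rounding changes [s r] by at most a multiple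
    of [r], which costs factors tending to 1. *)
Lemma ball_asymptotics e : 0 < e -> exists2 r0, 0 < r0 & forall r, 0 < r -> r <= r0 ->
  K * (1 - e) * r ^+ t.+1 <= ballp r <= K * (1 + e) * r ^+ t.+1.
Proof.
(* Ensures [(1 - e) (1 + e1) <= 1 - e1] and [1 + e1 <= (1 + e) (1 - e1)], which absorb tail error
   and rounding together. *)
move=> e0; pose e1 := Num.min e 1 / 4.
have m0 : 0 < Num.min e 1 by rewrite lt_min e0 ltr01.
have me : Num.min e 1 <= e by rewrite ge_min lexx.
have m1 : Num.min e 1 <= 1 by rewrite ge_min lexx orbT.
have e10 : 0 < e1 by rewrite divr_gt0.
have [N1 _ hN1] := tail_eventually_le e10.
have [N2 _ hN2] := tail_eventually_ge e10.
have hc1 : (fun x : R => (1 - 2 * x) ^+ t.+1) @ 0^'+ --> ((1 - 2 * 0) ^+ t.+1 : R).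
  apply: cvg_at_right_filter; apply: (cvg_comp (fun x : R => 1 - 2 * x) (fun x => x ^+ t.+1)).
    by apply: cvgB; [exact: cvg_cst|apply: cvgMr; exact: cvg_id].
  exact: exprn_continuous.
have hc2 : (fun x : R => (1 + x) ^+ t.+1) @ 0^'+ --> ((1 + 0) ^+ t.+1 : R).
  apply: cvg_at_right_filter; apply: (cvg_comp (fun x : R => 1 + x) (fun x => x ^+ t.+1)).
    by apply: cvgD; [exact: cvg_cst|exact: cvg_id].
  exact: exprn_continuous.
have h1 : \forall x \near 0^'+, 1 - e1 <= (1 - 2 * x) ^+ t.+1.
  by apply: (cvgr_ge _ hc1); rewrite mulr0 subr0 expr1n; lra.
have h2 : \forall x \near 0^'+, (1 + x) ^+ t.+1 <= 1 + e1.
  by apply: (cvgr_le _ hc2); rewrite addr0 expr1n; lra.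
have [r0 [r00 hr0]] : exists r0 : R, 0 < r0 /\ forall r, 0 < r -> r <= r0 ->
   [/\ 1 - e1 <= (1 - 2 * r) ^+ t.+1, (1 + r) ^+ t.+1 <= 1 + e1,
       r <= 1 / 4, (N1 + 3)%:R <= r^-1 & N2%:R <= r^-1].
  have [e3 /= e30 he3] := h1; have [e4 /= e40 he4] := h2.
  pose A := (N1 + N2 + 4)%:R : R; have A0 : 0 < A by rewrite ltr0n addn_gt0 orbT.
  exists (Num.min (Num.min (e3 / 2) (e4 / 2)) A^-1); split.
    by rewrite !lt_min !divr_gt0 //= invr_gt0.
  move=> r r0; rewrite !le_min => /andP[/andP[r3 r4] rA].
  have rA' : A <= r^-1 by rewrite -[A]invrK lef_pV2 ?posrE ?invr_gt0.
  split.
  - by apply: he3 => //=; rewrite sub0r normrN ger0_norm ?(ltW r0) //; lra.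
  - by apply: he4 => //=; rewrite sub0r normrN ger0_norm ?(ltW r0) //; lra.
  - by apply: le_trans rA _; rewrite div1r lef_pV2 ?posrE // /A ler_nat leq_addl.
  - by apply: le_trans rA'; rewrite /A ler_nat leq_add // leq_addr.
  - by apply: le_trans rA'; rewrite /A ler_nat -addnA addnCA leq_addr.
exists r0 => // r rp rr0; have [q1 q2 q3 q4 q5] := hr0 r rp rr0.
have ir0 : 0 < r^-1 by rewrite invr_gt0.
have rr : r^-1 * r = 1 by rewrite mulVf // gt_eqF.
have tr_ge : (Num.truncn r^-1)%:R <= r^-1 by rewrite truncn_le ltW.
have tr_lt := truncnS_gt r^-1.
have r2 : 0 < 1 - 2 * r by lra.
set s0 := Num.truncn r^-1 in tr_ge tr_lt.
apply/andP; split.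
  have hs : s0.+1%:R^-1 <= r by rewrite -[leRHS]invrK lef_pV2 ?posrE // ltW.
  apply: le_trans (tail_le_ball hs).
  have := hN2 s0.+1; rewrite /= => hh.
  have N2s : (N2 <= s0.+1)%N by rewrite -(ler_nat R) (le_trans q5) // ltW.
  have {hh} := hh N2s; set tl := tailp _ _ _ _ => hh.
  have hsr : s0.+1%:R * r <= 1 + r.
    by rewrite -(natr1 s0) mulrDl mul1r lerD2r -[leRHS]rr ler_pM2r.
  have p1 : (s0.+1%:R * r) ^+ t.+1 <= 1 + e1.
    apply: le_trans q2; rewrite ler_pXn2r ?nnegrE ?mulr_ge0 //; try lra; exact: ltW.
  have tl0 : 0 <= tl by apply: Ex_ge0 => x _; rewrite indicE; case: (_ \in _).
  have p0 : 0 < r ^+ t.+1 by rewrite exprn_gt0.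
  have h3 : K * (1 - e1) * r ^+ t.+1 <= tl * (1 + e1).
    apply: le_trans (_ : s0.+1%:R ^+ t.+1 * tl * r ^+ t.+1 <= _); first by rewrite ler_pM2r.
    by rewrite mulrAC -exprMn mulrC ler_wpM2l.
  rewrite -(@ler_pM2r _ (1 + e1)); last by lra.
  apply: le_trans h3; rewrite mulrAC ler_pM2r // -mulrA ler_pM2l //.
  rewrite /e1; move: m0 me m1; move: (Num.min e 1) => v; nra.
(* The upper bound uses the power [s0 - 1]; the margin keeps it positive and beyond [N1]. *)
have s0N : (N1 + 3 <= s0)%N by rewrite -ltnS -(ltr_nat R) (le_lt_trans q4).
case: s0 s0N tr_ge tr_lt => [|[|s]]; [by rewrite addn3|by rewrite addn3|].
move=> s0N tr_ge tr_lt.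
have hs : r <= s.+2%:R^-1 by rewrite -[leLHS]invrK lef_pV2 ?posrE.
apply: le_trans (ball_le_tail hs) _.
have N1s : (N1 <= s.+1)%N by rewrite addn3 !ltnS in s0N; exact: leqW (ltnW s0N).
have := hN1 s.+1 N1s; set tl := tailp _ _ _ _ => hh.
have hsr : 1 - 2 * r <= s.+1%:R * r.
  rewrite -[X in X - _ <= _]rr -mulrBl ler_pM2r //.
  by move: tr_lt; rewrite -(natr1 s.+2) -(natr1 s.+1); lra.
have p1 : 1 - e1 <= (s.+1%:R * r) ^+ t.+1.
  apply: le_trans q1 _; rewrite ler_pXn2r ?nnegrE ?mulr_ge0 //; by [exact: ltW|].
have tl0 : 0 <= tl by apply: Ex_ge0 => x _; rewrite indicE; case: (_ \in _).
have p0 : 0 < r ^+ t.+1 by rewrite exprn_gt0.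
have h3 : tl * (1 - e1) <= K * (1 + e1) * r ^+ t.+1.
  apply: le_trans (_ : s.+1%:R ^+ t.+1 * tl * r ^+ t.+1 <= _); last by rewrite ler_pM2r.
  by rewrite mulrAC -exprMn [leRHS]mulrC ler_wpM2l.
rewrite -(@ler_pM2r _ (1 - e1)); last by rewrite /e1; lra.
apply: le_trans h3 _; rewrite [leRHS]mulrAC ler_pM2r // -[leRHS]mulrA ler_pM2l //.
rewrite /e1; move: m0 me m1; move: (Num.min e 1) => v; nra.
Qed.

End TailLimit.

(** * Volume of balls *)

Section GrassBalls.
Variables (R : realType) (n m k : nat).
Hypotheses (m0 : (0 < m)%N) (mn : (m < n)%N) (k0 : (0 < k)%N).
Local Notation C := R[i].
Local Notation cRe := (@complex.Re R).
Local Notation toC := (real_complex R).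
Local Notation T := (GT R k n).
Local Notation S := (grassk R k n m : set T).
Variable mu : probability T R.
Hypothesis hmu : uniform_grassk R k n m mu.
Let mS : measurable S. Proof. exact: grassk_measurable (ltnW mn). Qed.
Let PS : mu S = 1%E. Proof. by case: hmu. Qed.
Local Notation E := (Ex mu S).
Local Notation w := (widen_ord (ltnW mn)).

Definition basept : T := [ffun=> proj0 R n m].

Lemma basept_in : S basept.
Proof. by move=> i; rewrite ffunE; apply: grass_proj0; exact: ltnW. Qed.

Lemma trace_proj0 (P : 'M[C]_n) : \tr (proj0 R n m *m P) = \tr (mxsub w w P).
Proof.
rewrite /mxtrace (bigID (fun i : 'I_n => (i < m)%N)) /= [X in _ + X]big1 ?addr0.
  rewrite (big_ord_narrow (ltnW mn)); apply: eq_bigr => i _.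
  rewrite !mxE (bigD1 (w i)) //= big1 ?addr0 => [|j /negbTE ji].
    by rewrite !mxE eqxx /= ltn_ord mul1r.
  have ji' : ((w i : nat) == j) = false by rewrite eq_sym -ji.
  by rewrite !mxE ji' mul0r.
move=> i /negbTE im; rewrite mxE big1 // => j _.
by rewrite !mxE im andbF mul0r.
Qed.

Lemma dc2_base x : S x -> dc2 R basept x = \sum_i (m%:R - cRe (\tr (mxsub w w (x i)))).
Proof.
move=> Sx; apply: eq_bigr => i _; rewrite ffunE (frob2_proj _ (Sx i)) ?trace_proj0 //.
exact: grass_proj0 (ltnW mn).
Qed.

Lemma lead_bounds (P : 'M[C]_n) : grass R n m P ->
  let d := m%:R - cRe (\tr (mxsub w w P)) in
  [/\ 0 <= lead mn P <= 1, 0 <= d <= m%:R & 1 - d <= lead mn P <= expR (- d)].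
Proof.
move=> /grass_hermitian[aP PP _] d.
have wi : injective w by move=> a b /(congr1 val) /= /val_inj.
have [r [r01 dr tr]] := compress_spectrum wi aP PP.
have dE : d = \sum_i (1 - r i).
  by rewrite /d tr /= sumrB sumr_const card_ord.
rewrite /lead dr /=; split.
- apply/andP; split; first by apply: prodr_ge0 => i _; case/andP: (r01 i).
  by apply: prodr_ile1 => i _; exact: r01.
- rewrite dE; apply/andP; split.
    by apply: sumr_ge0 => i _; case/andP: (r01 i); lra.
  have -> : m%:R = \sum_(i < m) (1 : R) by rewrite sumr_const card_ord.
  by apply: ler_sum => i _; case/andP: (r01 i); lra.
- by rewrite dE; exact: prod_ge_1sub.
Qed.

Lemma leadprod01 x : S x -> 0 <= leadprod mn x <= 1.
Proof.
move=> Sx; have h i : 0 <= lead mn (x i) <= 1 by case: (lead_bounds (Sx i)).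
apply/andP; split; first by apply: prodr_ge0 => i _; case/andP: (h i).
by apply: prodr_ile1 => i _; exact: h.
Qed.

(** The sandwich of [lead_bounds] in each factor, combined by [prod_ge_1sub] from below and by the
    exponential of a sum from above. *)
Lemma leadprod_dc2 x : S x ->
  1 - dc2 R basept x <= leadprod mn x <= expR (- dc2 R basept x).
Proof.
move=> Sx; rewrite dc2_base //.
have h i : 0 <= lead mn (x i) <= 1 by case: (lead_bounds (Sx i)).
have h' i : 1 - (m%:R - cRe (\tr (mxsub w w (x i)))) <= lead mn (x i)
    <= expR (- (m%:R - cRe (\tr (mxsub w w (x i))))) by case: (lead_bounds (Sx i)).
apply/andP; split.
  have /andP[h1 _] := prod_ge_1sub (index_enum _) h.
  apply: le_trans h1; rewrite lerD2l lerN2; apply: ler_sum => i _.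
  by case/andP: (h' i); lra.
rewrite -sumrN expR_sum; apply: ler_prod => i _.
by case/andP: (h i) => -> _; case/andP: (h' i).
Qed.

Lemma dc2_base_bound x : S x -> 0 <= dc2 R basept x <= (k * m)%:R.
Proof.
move=> Sx; rewrite dc2_base //.
have h i : 0 <= m%:R - cRe (\tr (mxsub w w (x i))) <= m%:R by case: (lead_bounds (Sx i)).
apply/andP; split; first by apply: sumr_ge0 => i _; case/andP: (h i).
have -> : (k * m)%:R = \sum_(i < k) (m%:R : R) by rewrite sumr_const card_ord natrM mulr_natl.
by apply: ler_sum => i _; case/andP: (h i).
Qed.

Lemma dc2_uact (U : 'I_k -> 'M[C]_n) (x y : T) : (forall i, unitary R (U i)) ->
  dc2 R (uact R U x) (uact R U y) = dc2 R x y.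
Proof.
move=> hU; apply: eq_bigr => i _; rewrite !ffunE; congr (_ / _).
by rewrite -mulmxBl -mulmxBr frob2_unitary.
Qed.

Lemma dc2_sym (x y : T) : dc2 R x y = dc2 R y x.
Proof.
apply: eq_bigr => i _; congr (_ / _); apply: eq_bigr => a _; apply: eq_bigr => b _.
by rewrite !mxE !cReD !cImD !cReN !cImN; ring.
Qed.

Lemma grassk_trans (p : T) : S p ->
  exists2 U : 'I_k -> 'M[C]_n, (forall i, unitary R (U i)) & p = uact R U basept.
Proof.
move=> Sp.
have /choice[U hU] : forall i, exists U : 'M[C]_n, unitary R U /\ p i = U *m proj0 R n m *m adjmx R U.
  by move=> i; have [U hU e] := grass_trans (ltnW mn) (Sp i); exists U.
exists U; first by move=> i; case: (hU i).
by apply/ffunP => i; rewrite !ffunE; case: (hU i).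
Qed.

Lemma dc2_bound (p x : T) : S p -> S x -> 0 <= dc2 R p x <= (k * m)%:R.
Proof.
move=> Sp Sx; have [U hU ->] := grassk_trans Sp.
have hU' i : unitary R (adjmx R (U i)) by exact: unitary_adj.
rewrite -(dc2_uact _ _ hU') uactK //; apply: dc2_base_bound.
exact: (grassk_uact hU').
Qed.

Lemma good_dc2 (p : T) : S p -> good S (fun x : T => dc2 R p x).
Proof.
move=> Sp; split; first by apply: measurable_funTS; exact: dc2_measurable.
by exists (k * m)%:R => x Sx; have /andP[h1 h2] := dc2_bound Sp Sx; rewrite ger0_norm.
Qed.

Definition ballF (r : R) : R := ballp mu S (fun x : T => dc2 R basept x) r.

(** Some tuple of unitaries carries [basept] to [p], preserving both distances and [mu]. *)
Lemma ball_center (p : T) r : S p -> ballp mu S (fun x : T => dc2 R p x) r = ballF r.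
Proof.
move=> Sp; have [U hU ->] := grassk_trans Sp.
rewrite /ballF /ballp.
rewrite -(Ex_uact (ltnW mn) hmu hU (f := \1_[set x : T | dc2 R (uact R U basept) x <= r])).
- apply: eq_Ex => x _; rewrite !indicE; congr (_%:R); congr nat_of_bool.
  by apply/idP/idP; rewrite !inE /= dc2_uact.
- apply: measurable_indic.
  rewrite -[X in measurable X]setTI; have := dc2_measurable (uact R U basept) measurableT (measurable_itv `]-oo, r]).
  by congr measurable; apply/seteqP; split => x /= [_]; rewrite in_itv /=.
- apply: good_ball => //; apply: good_dc2; exact: (grassk_uact hU basept_in).
Qed.

(** The limit of [s^tau] times the moment of order s of [leadprod], for tau = k m (n-m); by
    [eta_grE] it is [(t! eta)^k] with t = m (n-m). *)
Definition volconst : R := (\prod_(j < m) ((n - j.+1)`!%:R / (m - j.+1)`!%:R)) ^+ k.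

Lemma volconst_gt0 : 0 < volconst.
Proof.
by apply: exprn_gt0; apply: prodr_gt0 => i _; rewrite divr_gt0 // ltr0n fact_gt0.
Qed.

Lemma ballF_asymptotics e : 0 < e -> exists2 r0, 0 < r0 & forall r, 0 < r -> r <= r0 ->
  volconst / (k * (m * (n - m)))`!%:R * (1 - e) * r ^+ (k * (m * (n - m))) <= ballF r
   <= volconst / (k * (m * (n - m)))`!%:R * (1 + e) * r ^+ (k * (m * (n - m))).
Proof.
move=> e0.
have hC := @cvg_ratio_pow R n m k mn; rewrite -/volconst in hC.
have : (0 < k * (m * (n - m)))%N by rewrite !muln_gt0 k0 m0 subn_gt0.
move: hC; case: (k * (m * (n - m)))%N => // t hC _.
have gl : good S (fun x : T => leadprod mn x).
  apply: good_prod => i; have : cgood m (fun x : T => \det (mxsub w w (x i))) by exact: cgood_minor.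
  by case/cgood_good.
have hC' : (fun s : nat => s%:R ^+ t.+1 * E (fun x : T => leadprod mn x ^+ s) : R) @ \oo --> volconst.
  rewrite (_ : (fun s : nat => _) = fun s => s%:R ^+ t.+1 * ratio R n m s ^+ k) //.
  by apply/funext => s; rewrite (leadprod_moment mn hmu).
exact: (ball_asymptotics mS PS gl leadprod01 volconst_gt0 hC' (good_dc2 basept_in) leadprod_dc2 e0).
Qed.

End GrassBalls.
Lemma indic_setE (U : Type) (R : realType) (p : pred U) x : \1_[set y | p y] x = (p x)%:R :> R.
Proof. by rewrite indicE; congr (_%:R); congr nat_of_bool; apply/idP/idP; rewrite inE. Qed.

Section Swap.
Context {d : measure_display} {T : measurableType d} {R : realType}.
Variables (mu : probability T R) (S : set T).
Hypotheses (mS : measurable S) (PS : mu S = 1%E).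

(** Tonelli on the whole product, for [f] cut off by the indicator of [S] in both variables. The
    first conjunct makes the averaged quantities usable in further expectations. *)
Lemma Ex_swap (f : T * T -> R) : measurable_fun setT f -> (forall z, 0 <= f z <= 1) ->
  good S (fun P => Ex mu S (fun x => f (P, x))) /\
  Ex mu S (fun P => Ex mu S (fun x => f (P, x))) = Ex mu S (fun x => Ex mu S (fun P => f (P, x))).
Proof.
move=> mf f01.
have f0 z : 0 <= f z by case/andP: (f01 z).
have gf1 P : good S (fun x => f (P, x)).
  split; last by exists 1 => x _; case/andP: (f01 (P, x)) => h1 h2; rewrite ger0_norm.
  apply: measurable_funTS; apply: (measurableT_comp mf); exact: pair1_measurable.
have gf2 x : good S (fun P => f (P, x)).
  split; last by exists 1 => P _; case/andP: (f01 (P, x)) => h1 h2; rewrite ger0_norm.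
  apply: measurable_funTS; apply: (measurableT_comp mf); exact: pair2_measurable.
pose g (z : T * T) : \bar R := (f z * \1_S z.1 * \1_S z.2)%:E.
have g0 z : (0 <= g z)%E.
  by rewrite lee_fin !mulr_ge0 // indicE; case: (_ \in _).
have mg : measurable_fun setT g.
  apply/measurable_EFinP; apply: measurable_funM; first apply: measurable_funM => //.
    by apply: (measurableT_comp (measurable_indic mS)); exact: measurable_fst.
  by apply: (measurableT_comp (measurable_indic mS)); exact: measurable_snd.
have i1 P : S P -> (\int[mu]_x g (P, x) = (Ex mu S (fun x => f (P, x)))%:E)%E.
  move=> SP; rewrite /Ex /Rintegral fineK; last first.
    by apply: integrable_fin_num => //; exact: (good_intg mS (gf1 P)).
  rewrite [RHS]integral_mkcond; apply: eq_integral => x _.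
  rewrite /g /= patchE !indicE (mem_set SP) mulr1.
  by case: (x \in S); rewrite ?mulr1 ?mulr0.
have i1' P : ~ S P -> (\int[mu]_x g (P, x) = 0)%E.
  move=> SP; apply: integral0_eq => x _.
  by rewrite /g /= [X in _ * X * _]indicE memNset // mulr0 mul0r.
have i2 x : S x -> (\int[mu]_P g (P, x) = (Ex mu S (fun P => f (P, x)))%:E)%E.
  move=> Sx; rewrite /Ex /Rintegral fineK; last first.
    by apply: integrable_fin_num => //; exact: (good_intg mS (gf2 x)).
  rewrite [RHS]integral_mkcond; apply: eq_integral => P _.
  rewrite /g /= patchE !indicE (mem_set Sx) mulr1.
  by case: (P \in S); rewrite ?mulr1 ?mulr0.
have i2' x : ~ S x -> (\int[mu]_P g (P, x) = 0)%E.
  move=> Sx; apply: integral0_eq => P _.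
  by rewrite /g /= [X in _ * _ * X]indicE memNset // mulr0.
have bd P : 0 <= Ex mu S (fun x => f (P, x)) <= 1.
  apply/andP; split; first by apply: Ex_ge0 => x _.
  rewrite -[leRHS](Ex_cst mS PS 1); apply: le_Ex => //; first exact: good_cst.
  by move=> x _; case/andP: (f01 (P, x)).
split.
  split; last by exists 1 => P _; case/andP: (bd P) => h1 h2; rewrite ger0_norm.
  apply/measurable_EFinP; apply: (eq_measurable_fun (fubini_F mu g)).
    by move=> P; rewrite inE => SP; rewrite /fubini_F i1.
  by apply: measurable_funTS; exact: measurable_fun_fubini_tonelli_F.
have := fubini_tonelli (m1 := mu) (m2 := mu) g mg g0.
move=> h.
transitivity (fine (\int[mu]_(P in S) (Ex mu S (fun x => f (P, x)))%:E)); first by [].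
transitivity (fine (\int[mu]_(x in S) (Ex mu S (fun P => f (P, x)))%:E)); last by [].
congr fine.
transitivity (\int[mu]_P \int[mu]_x g (P, x))%E.
  rewrite integral_mkcond; apply: eq_integral => P _; rewrite patchE.
  by have [SP|SP] := pselect (S P); [rewrite (mem_set SP) (i1 P SP)|rewrite (memNset SP) (i1' P SP)].
rewrite h; rewrite [RHS]integral_mkcond; apply: eq_integral => x _; rewrite patchE.
by have [Sx|Sx] := pselect (S x); [rewrite (mem_set Sx) (i2 x Sx)|rewrite (memNset Sx) (i2' x Sx)].
Qed.

End Swap.

(** * Codes *)

Section Codes.
Variables (R : realType) (n m k : nat).
Hypotheses (m0 : (0 < m)%N) (mn : (m < n)%N) (k0 : (0 < k)%N).
Local Notation T := (GT R k n).
Local Notation S := (grassk R k n m : set T).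
Variable mu : probability T R.
Hypothesis hmu : uniform_grassk R k n m mu.
Let mS : measurable S. Proof. exact: grassk_measurable (ltnW mn). Qed.
Let PS : mu S = 1%E. Proof. by case: hmu. Qed.
Local Notation E := (Ex mu S).
Local Notation F := (ballF m mu).
Local Notation M := ((k * m)%:R : R).

Lemma big_min_EFin (I : eqType) (r : seq I) (f : I -> R) (B : R) :
  (0 < size r)%N -> (forall i, f i <= B) ->
  (\big[Order.min/+oo%E]_(i <- r) (f i)%:E = (\big[Order.min/B]_(i <- r) f i)%:E)%E.
Proof.
move=> r0 fB; elim: r r0 => // i [|j r] IH _.
  by rewrite !big_cons !big_nil (min_idPl _) ?leey // (min_idPl _).
by rewrite big_cons IH // [in RHS]big_cons EFin_min.
Qed.

(** The seed [M = k m] bounds every squared distance on [S] ([dc2_bound]), so for a nonempty code in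
    [S] the minimum agrees there with the one seeded at [+oo]. *)
Definition mind K (c : 'I_K -> T) (x : T) : R := \big[Num.min/M]_(j < K) dc2 R (c j) x.

Lemma mind_le K (c : 'I_K -> T) x j : mind c x <= dc2 R (c j) x.
Proof. by rewrite /mind (bigD1 j) //= ge_min lexx. Qed.

Lemma mind_ex K (c : 'I_K -> T) x : (0 < K)%N -> (forall j, S (c j)) -> S x ->
  exists j, mind c x = dc2 R (c j) x.
Proof.
move=> K0 Sc Sx; have [j hj] : exists j, forall i, dc2 R (c j) x <= dc2 R (c i) x.
  pose j := [arg min_(i < Ordinal K0 | true) dc2 R (c i) x]%O.
  by exists j => i; rewrite /j; case: arg_minP => // j' _ h; exact: h.
exists j; apply/eqP; rewrite eq_le mind_le /=.
apply: le_bigmin => [|i _]; last exact: hj.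
by case/andP: (dc2_bound mn (Sc j) Sx).
Qed.

Lemma good_mind K (c : 'I_K -> T) : (forall j, S (c j)) -> good S (mind c).
Proof.
move=> Sc; rewrite /mind; elim: (index_enum _) => [|j r IH].
  apply: (good_ext (f := fun=> M)) => [x _|]; [by rewrite big_nil|exact: good_cst].
apply: (good_ext (f := fun x : T => Num.min (dc2 R (c j) x) (\big[Num.min/M]_(i <- r) dc2 R (c i) x))).
  by move=> x _; rewrite big_cons.
have gd := good_dc2 mn (Sc j); split.
  by apply: measurable_minr; [case: gd|case: IH].
have [_ [A hA]] := gd; have [_ [B hB]] := IH.
exists (A + B) => x Sx; have := hA x Sx; have := hB x Sx.
by rewrite minElt; case: ifP => _ h1 h2; have := normr_ge0 (dc2 R (c j) x);
  have := normr_ge0 (\big[Num.min/M]_(i <- r) dc2 R (c i) x); lra.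
Qed.

Lemma integral_code K (c : 'I_K -> T) : (0 < K)%N -> (forall j, S (c j)) ->
  (\int[mu]_(x in S) \big[Order.min/+oo%E]_(j < K) (dc2 R (c j) x)%:E = (E (mind c))%:E)%E.
Proof.
move=> K0 Sc; rewrite /Ex /Rintegral fineK; last first.
  by apply: integrable_fin_num => //; exact: (good_intg mS (good_mind Sc)).
apply: eq_integral => x; rewrite inE => Sx; apply: big_min_EFin.
  by rewrite -[index_enum _]enumT size_enum_ord.
by move=> j; case/andP: (dc2_bound mn (Sc j) Sx).
Qed.

Lemma distortion_ge K b : (0 < K)%N ->
  (forall c : 'I_K -> T, (forall j, S (c j)) -> b <= E (mind c)) ->
  (b%:E <= distortion R k n m mu K)%E.
Proof.
move=> K0 h; apply: le_ereal_inf_tmp => _ [c [_ Sc] <-].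
by rewrite integral_code // lee_fin; exact: h.
Qed.

Lemma distortion_le K (c : 'I_K -> T) : (0 < K)%N -> injective c -> (forall j, S (c j)) ->
  (distortion R k n m mu K <= (E (mind c))%:E)%E.
Proof.
by move=> K0 ci Sc; apply: ereal_inf_lbound; exists c => //; rewrite integral_code.
Qed.

(** With [upper_layers], the lower and upper Riemann sums of the layer-cake formula for [y]
    truncated at [N h]. *)
Lemma lower_layers (h y : R) N : 0 <= h -> 0 <= y ->
  \sum_(i < N) h * (i.+1%:R * h < y)%R%:R <= Num.min y (N%:R * h).
Proof.
move=> h0 y0; elim: N => [|N IH]; first by rewrite big_ord0 mul0r le_min y0 lexx.
rewrite big_ord_recr /=; move: IH; rewrite !le_min => /andP[h1 h2].
rewrite -natr1 mulrDl mul1r; case: ltP => h3 /=; rewrite ?mulr1 ?mulr0 ?addr0.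
  by apply/andP; split; lra.
by apply/andP; split; lra.
Qed.

Lemma upper_layers (h y : R) N : 0 <= h -> 0 <= y ->
  Num.min y (N%:R * h) <= \sum_(i < N) h * (i%:R * h < y)%R%:R.
Proof.
move=> h0 y0; elim: N => [|N IH]; first by rewrite big_ord0 mul0r ge_min lexx orbT.
rewrite big_ord_recr /=; move: IH; rewrite !ge_min => IH.
rewrite -natr1 mulrDl mul1r; case: ltP => h3 /=; rewrite ?mulr1 ?mulr0 ?addr0.
  by case/orP: IH => IH; apply/orP; [left|right]; lra.
by case/orP: IH => IH; apply/orP; left; lra.
Qed.

Lemma good_dc2_ball (p : T) r : S p -> good S (\1_[set x : T | dc2 R p x <= r] : T -> R).
Proof. by move=> Sp; apply: good_ball => //; exact: good_dc2. Qed.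

(** Union bound: 1 minus the number of codewords within [r] of [x] is at most the indicator of
    [r < mind c x], and every ball of radius [r] has mass [F r] wherever its centre in [S]. *)
Lemma code_lower K (c : 'I_K -> T) (a : R) N : (0 < K)%N -> 0 < a -> (forall j, S (c j)) ->
  \sum_(i < N) (a * (1 - K%:R * F (i.+1%:R * a))) <= E (mind c).
Proof.
move=> K0 a0 Sc.
have gb j r : good S (\1_[set x | dc2 R (c j) x <= r] : T -> R).
  exact: good_dc2_ball.
pose f (i : 'I_N) (x : T) : R := a * (1 - \sum_(j < K) \1_[set x | dc2 R (c j) x <= i.+1%:R * a] x).
have gs (i : 'I_N) : good S (fun x => \sum_(j < K) \1_[set x | dc2 R (c j) x <= i.+1%:R * a] x : R).
  by apply: good_sum => j; exact: gb.
have gf i : good S (f i).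
  by apply: goodZ; apply: goodB; [exact: good_cst|exact: gs].
have -> : \sum_(i < N) (a * (1 - K%:R * F (i.+1%:R * a))) = E (fun x => \sum_(i < N) f i x).
  rewrite (Ex_sum mS PS) //; apply: eq_bigr => i _.
  rewrite /f ExZ //; last by apply: goodB; [exact: good_cst|exact: gs].
  rewrite ExB //; last exact: good_cst.
  rewrite (Ex_cst mS PS) (Ex_sum mS PS) // (eq_bigr (fun=> F (i.+1%:R * a))).
    by rewrite sumr_const card_ord mulr_natl.
  by move=> j _; rewrite -(ball_center mn hmu (p := c j)).
apply: le_Ex => //; [exact: good_sum|exact: good_mind|].
move=> x Sx; have [j ej] := mind_ex K0 Sc Sx.
have y0 : 0 <= mind c x by rewrite ej; case/andP: (dc2_bound mn (Sc j) Sx).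
apply: le_trans (_ : \sum_(i < N) a * (i.+1%:R * a < mind c x)%R%:R <= _).
  apply: ler_sum => i _; rewrite ler_pM2l //.
  have p0 l : 0 <= \1_[set x | dc2 R (c l) x <= i.+1%:R * a] x :> R.
    by rewrite indicE; case: (_ \in _).
  case: ltP => h /=; first by rewrite gerBl; apply: sumr_ge0 => l _; exact: p0.
  rewrite subr_le0 (bigD1 j) //= indicE mem_set /=; last by rewrite -ej.
  by rewrite lerDl; apply: sumr_ge0 => l _; exact: p0.
have := lower_layers N (ltW a0) y0; rewrite le_min => /andP[h _]; exact: h.
Qed.

(** Balls control one variable at a time; joint measurability goes through the entries of both
    points. *)
Lemma dc2_pair_measurable : measurable_fun setT (fun z : T * T => dc2 R z.1 z.2).
Proof.
have mc (g : T * T -> T) (mg : measurable_fun setT g) i a b :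
    measurable_fun setT (fun z => complex.Re (g z i a b)) /\
    measurable_fun setT (fun z => complex.Im (g z i a b)).
  split; [exact: (measurableT_comp (Re_measurable i a b) mg)|
          exact: (measurableT_comp (Im_measurable i a b) mg)].
have c1 := mc _ measurable_fst; have c2 := mc _ measurable_snd.
rewrite /dc2 /frob2; apply: measurable_sum => i; apply: measurable_funM; last exact: measurable_cst.
apply: measurable_sum => a; apply: measurable_sum => b.
apply: measurable_funD; apply: measurable_funX.
  rewrite (_ : (fun _ => _) = fun z : T * T => complex.Re (z.1 i a b) - complex.Re (z.2 i a b)).
    by apply: measurable_funB; [case: (c1 i a b)|case: (c2 i a b)].
  by apply/funext => z; rewrite !mxE cReD cReN.
rewrite (_ : (fun _ => _) = fun z : T * T => complex.Im (z.1 i a b) - complex.Im (z.2 i a b)).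
  by apply: measurable_funB; [case: (c1 i a b)|case: (c2 i a b)].
by apply/funext => z; rewrite !mxE cImD cImN.
Qed.

Lemma ballF_small eta : 0 < eta -> exists2 r, 0 < r & F r <= eta.
Proof.
move=> eta0; have [r0 r00 h] := ballF_asymptotics m0 mn k0 hmu ltr01.
have tau0 : (0 < k * (m * (n - m)))%N by rewrite !muln_gt0 k0 m0 subn_gt0.
move: h tau0; case: (k * (m * (n - m)))%N => // t h _.
pose c : R := volconst R n m k / t.+1`!%:R * (1 + 1).
have c0 : 0 < c.
  by rewrite /c; apply: mulr_gt0; [apply: divr_gt0; [exact: volconst_gt0|rewrite ltr0n fact_gt0]|lra].
(* As [r <= 1] and the exponent is positive, [r ^+ t.+1 <= r], so [c * r <= eta] suffices. *)
pose r := Num.min (Num.min r0 1) (eta / c).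
have rp : 0 < r by rewrite !lt_min r00 ltr01 divr_gt0.
have r1 : r <= 1 by rewrite !ge_min lexx orbT.
have rr : r <= r0 by rewrite !ge_min lexx.
exists r => //; have /andP[_ h2] := h r rp rr; apply: le_trans h2 _.
  apply: le_trans (_ : c * r <= _).
    by rewrite ler_pM2l // exprS ler_piMr ?exprn_ile1 // ltW.
  by rewrite mulrC -ler_pdivlMr // /r ge_min lexx orbT.
Qed.

Lemma ballF_ge0 r : 0 <= F r.
Proof. by apply: Ex_ge0 => x _; rewrite indicE; case: (_ \in _). Qed.
Lemma ballF_le1 r : F r <= 1.
Proof.
rewrite -[leRHS](Ex_cst mS PS 1); apply: le_Ex => //.
  by apply: good_dc2_ball; exact: basept_in.
exact: good_cst.
Qed.
Lemma ballF_mono r r' : r <= r' -> F r <= F r'.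
Proof.
move=> rr; apply: le_Ex => //.
- by apply: good_dc2_ball; exact: basept_in.
- by apply: good_dc2_ball; exact: basept_in.
- move=> x _; rewrite !indicE; case: (boolP (_ \in _)) => [|_]; last by case: (_ \in _).
  by rewrite inE /= => h; rewrite mem_set //=; exact: le_trans rr.
Qed.

Section Greedy.
Variables (h : R) (N : nat).
Hypothesis h0 : 0 <= h.

Definition far (r : R) (z : T * T) : R := \1_[set z : T * T | r < dc2 R z.1 z.2] z.
Definition uncov (cs : seq T) (r : R) (x : T) : R := \prod_(c <- cs) far r (c, x).
(* Upper bound for the distortion, in expectation, of the code cs completed by j
   independent uniform codewords. *)
Definition layered (j : nat) (cs : seq T) : R :=
  \sum_(i < N) h * (1 - F (i%:R * h)) ^+ j * E (uncov cs (i%:R * h)).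

Lemma far01 r z : 0 <= far r z <= 1.
Proof. by rewrite /far indicE; case: (_ \in _); rewrite ?lexx ?ler01. Qed.
Lemma far_measurable r : measurable_fun setT (far r).
Proof.
apply: measurable_indic; have := dc2_pair_measurable measurableT (measurable_itv `]r, +oo[).
by rewrite setTI; congr measurable; apply/seteqP; split => z /=; rewrite in_itv /= andbT.
Qed.
Lemma uncov01 cs r x : 0 <= uncov cs r x <= 1.
Proof.
apply/andP; split; first by apply: prodr_ge0 => c _; case/andP: (far01 r (c, x)).
by apply: prodr_ile1 => c _; exact: far01.
Qed.
Lemma uncov_measurable cs r : measurable_fun setT (uncov cs r).
Proof.
rewrite /uncov; apply: measurable_prod => c _.
apply: (measurableT_comp (far_measurable r)); exact: pair1_measurable.
Qed.
Lemma good_uncov cs r : good S (uncov cs r).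
Proof.
split; first by apply: measurable_funTS; exact: uncov_measurable.
by exists 1 => x _; case/andP: (uncov01 cs r x) => h1 h2; rewrite ger0_norm.
Qed.

(** After Fubini, for fixed [x] the points [P] farther than [r] from [x] have mass [1 - F r], by
    symmetry of the distance and [ball_center]. *)
Lemma uncov_average cs r :
  good S (fun P => E (uncov (P :: cs) r)) /\
  E (fun P => E (uncov (P :: cs) r)) = (1 - F r) * E (uncov cs r).
Proof.
pose f (z : T * T) := far r z * uncov cs r z.2.
have mf : measurable_fun setT f.
  apply: measurable_funM; first exact: far_measurable.
  by apply: (measurableT_comp (uncov_measurable cs r)); exact: measurable_snd.
have f01 z : 0 <= f z <= 1.
  have := far01 r z; have := uncov01 cs r z.2; rewrite /f => /andP[a0 a1] /andP[b0 b1].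
  by rewrite mulr_ge0 // mulr_ile1.
have [g1 e1] := Ex_swap mS PS mf f01.
have eu P : uncov (P :: cs) r = fun x => f (P, x).
  by apply/funext => x; rewrite /uncov big_cons.
split; first by apply: good_ext g1 => P _; rewrite eu.
transitivity (E (fun P => E (fun x => f (P, x)))); first by apply: eq_Ex => P _; rewrite eu.
rewrite e1; transitivity (E (fun x => (1 - F r) * uncov cs r x)); last first.
  by have gu := good_uncov cs r; rewrite (ExZ mS (1 - F r) gu).
apply: eq_Ex => x Sx; rewrite /f /=.
have gb : good S (\1_[set P : T | dc2 R x P <= r] : T -> R).
  exact: good_dc2_ball.
transitivity (E (fun P => uncov cs r x * (1 - \1_[set P : T | dc2 R x P <= r] P))).
  apply: eq_Ex => P _; rewrite mulrC; congr (_ * _).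
  rewrite /far !indic_setE /= (dc2_sym P x) leNgt.
  by case: (r < dc2 R x P); rewrite ?subr0 ?subrr.
have g1' : good S (fun=> 1 : R) by exact: good_cst.
rewrite (ExZ mS (uncov cs r x) (goodB g1' gb)) (ExB mS g1' gb) (Ex_cst mS PS) mulrC.
by rewrite -(ball_center mn hmu r Sx).
Qed.

Lemma layered_ge0 j cs : 0 <= layered j cs.
Proof.
apply: sumr_ge0 => i _; apply: mulr_ge0.
  by apply: mulr_ge0 => //; apply: exprn_ge0; rewrite subr_ge0 ballF_le1.
by apply: Ex_ge0 => x _; case/andP: (uncov01 cs (i%:R * h) x).
Qed.

Lemma layered_average j cs :
  good S (fun P => layered j (P :: cs)) /\ E (fun P => layered j (P :: cs)) = layered j.+1 cs.
Proof.
have g (i : 'I_N) : good S (fun P => h * (1 - F (i%:R * h)) ^+ j * E (uncov (P :: cs) (i%:R * h))).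
  by apply: goodZ; case: (uncov_average cs (i%:R * h)).
split; first exact: good_sum.
rewrite /layered (Ex_sum mS PS) //; apply: eq_bigr => i _.
have [g1 e1] := uncov_average cs (i%:R * h).
by rewrite ExZ // e1 exprSr; ring.
Qed.

(** The mean over [P] is known from [layered_average]. Points within [r] of the code are discarded
    to force distinctness; if all others exceeded [v + eta], the mean would exceed [v]. *)
Lemma greedy_step j cs eta : 0 < eta -> (forall c, c \in cs -> S c) ->
  exists P, [/\ S P, P \notin cs & layered j (P :: cs) <= layered j.+1 cs + eta].
Proof.
move=> eta0 Scs; set v := layered j.+1 cs.
have v0 : 0 <= v by exact: layered_ge0.
(* [F r] is made so small that the discarded mass times [v + eta] is at most [eta / 2]. *)
have D0 : 0 < 2 * (size cs).+1%:R * (v + eta) by rewrite !mulr_gt0 // ltr_wpDl.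
have [r r0 Fr] := ballF_small (divr_gt0 eta0 D0).
have [[P [SP hP]]|hn] := pselect (exists P, S P /\ ((forall c, c \in cs -> r < dc2 R c P) /\
    layered j (P :: cs) <= v + eta)).
  exists P; split => //; last by case: hP.
  apply/negP => Pcs; have := proj1 hP P Pcs.
  have -> : dc2 R P P = 0.
    rewrite /dc2 big1 // => i _; rewrite subrr /frob2 big1 ?mul0r // => a _.
    by rewrite big1 // => b _; rewrite mxE /= expr0n addr0.
  by rewrite ltNge ltW.
exfalso; have [g e] := layered_average j cs; rewrite -/v in e.
pose ind (i : 'I_(size cs)) : T -> R := \1_[set x | dc2 R (nth point cs i) x <= r].
have Si (i : 'I_(size cs)) : S (nth point cs i) by apply: Scs; exact: mem_nth.
have gi i : good S (ind i) by exact: good_dc2_ball.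
have gb : good S (fun P => \sum_i ind i P) by exact: good_sum.
have ind0 i P : 0 <= ind i P by rewrite /ind indicE; case: (_ \in _).
have : E (fun P => (v + eta) * (1 - \sum_i ind i P)) <= v.
  rewrite -[leRHS]e; apply: le_Ex => //.
    by apply: goodZ; apply: goodB => //; exact: good_cst.
  move=> P SP; have [[i hi]|hc] := pselect (exists i, ind i P = 1).
    apply: le_trans (layered_ge0 j (P :: cs)); apply: mulr_ge0_le0.
      by apply: addr_ge0 => //; exact: ltW.
    by rewrite subr_le0 (bigD1 i) //= hi lerDl; apply: sumr_ge0.
  apply: le_trans (_ : v + eta <= _).
    by rewrite ler_piMr ?addr_ge0 ?(ltW eta0) // gerBl; apply: sumr_ge0.
  rewrite ltW // ltNge; apply/negP => le; apply: hn; exists P; split => //; split => // c ccs.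
  rewrite ltNge; apply/negP => le2; apply: hc.
  have ic : (index c cs < size cs)%N by rewrite index_mem.
  by exists (Ordinal ic); rewrite /ind indicE mem_set //= nth_index.
rewrite ExZ //; last by apply: goodB => //; exact: good_cst.
rewrite ExB //; last exact: good_cst.
rewrite (Ex_cst mS PS) (Ex_sum mS PS) // (eq_bigr (fun=> F r)); last first.
  by move=> i _; rewrite -(ball_center mn hmu r (Si i)).
rewrite sumr_const card_ord -mulr_natl => le.
have w0 : 0 < v + eta by rewrite ltr_wpDl.
have : F r * (2 * (size cs).+1%:R * (v + eta)) <= eta by rewrite -ler_pdivlMr.
have := mulr_ge0 (ballF_ge0 r) (ltW w0); rewrite -natr1.
by move: le; set s := (size cs)%:R; move=> le hF; lra.
Qed.

Lemma greedy_code j cs eta : 0 < eta -> uniq cs -> (forall c, c \in cs -> S c) ->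
  exists cs', [/\ uniq cs', forall c, c \in cs' -> S c, size cs' = (size cs + j)%N &
    layered 0 cs' <= layered j cs + j%:R * eta].
Proof.
move=> eta0; elim: j cs => [|j IH] cs ucs Scs.
  by exists cs; split; rewrite ?addn0 // mul0r addr0.
have [P [SP Pcs hP]] := greedy_step j eta0 Scs.
have [|c|cs' [u' S' s' l']] := IH (P :: cs).
- by rewrite /= Pcs.
- by rewrite inE => /predU1P[->|/Scs].
exists cs'; split => //; first by rewrite s' /= addSnnS.
by rewrite -natr1 mulrDl mul1r; lra.
Qed.

(** Starts at the empty code, where [uncov] is 1 and [layered K] is the displayed sum, and ends at
    [K] words, where [layered 0] dominates the distortion by [upper_layers]; [N%:R * h = M] makes
    the layers reach the largest distance. Each word costs [eta / K]. *)
Lemma distortion_greedy K eta : (0 < K)%N -> N%:R * h = M -> 0 < eta ->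
  (distortion R k n m mu K <= (\sum_(i < N) h * (1 - F (i%:R * h)) ^+ K + eta)%:E)%E.
Proof.
move=> K0 Nh eta0; have eK : 0 < eta / K%:R by rewrite divr_gt0 // ltr0n.
have [|c|cs [ucs Scs scs lcs]] := greedy_code K (cs := [::]) eK => //.
rewrite add0n in scs; pose c (j : 'I_K) : T := nth point cs j.
have Sc j : S (c j) by apply: Scs; apply: mem_nth; rewrite scs.
have ci : injective c.
  by move=> i j /eqP; rewrite /c nth_uniq ?scs // => /eqP ij; exact: val_inj.
apply: le_trans (distortion_le K0 ci Sc) _; rewrite lee_fin.
have -> : \sum_(i < N) h * (1 - F (i%:R * h)) ^+ K = layered K [::].
  apply: eq_bigr => i _; rewrite (_ : uncov _ _ = fun=> 1) ?(Ex_cst mS PS) ?mulr1 //.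
  by apply/funext => x; rewrite /uncov big_nil.
rewrite mulrCA divff ?mulr1 ?pnatr_eq0 -?lt0n // in lcs.
apply: le_trans lcs; rewrite /layered.
have gu (i : 'I_N) : good S (fun x => h * uncov cs (i%:R * h) x).
  by apply: goodZ; exact: good_uncov.
rewrite (eq_bigr (fun i : 'I_N => E (fun x => h * uncov cs (i%:R * h) x))); last first.
  by move=> i _; rewrite expr0 mulr1 ExZ //; exact: good_uncov.
rewrite -(Ex_sum mS PS) //; apply: le_Ex => //; [exact: good_mind|exact: good_sum|].
move=> x Sx; have [j ej] := mind_ex K0 Sc Sx.
have /andP[y0 yM] := dc2_bound mn (Sc j) Sx; rewrite -ej in y0 yM.
have := upper_layers N h0 y0; rewrite Nh (min_idPl yM) => le; apply: le_trans le _.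
apply: ler_sum => i _; apply: ler_wpM2l => //; case: ltP => hi /=; last first.
  by case/andP: (uncov01 cs (i%:R * h) x).
rewrite /uncov big_seq big1 // => d dcs; rewrite /far indicE mem_set //=.
apply: lt_le_trans hi _.
have id : (index d cs < K)%N by rewrite -scs index_mem.
by have := mind_le c x (Ordinal id); rewrite /c /= nth_index.
Qed.

End Greedy.
End Codes.

(** * The Gamma function *)

Section GammaFunction.
Variable R : realType.
Implicit Types (s a b u v x : R) (n N : nat).
Local Notation leb := (@lebesgue_measure R).
Local Notation gint s := (fun x : R => powR x (s - 1) * expR (- x)).

Lemma powR_continuous p x : 0 < x -> {for x, continuous ((@powR R) ^~ p)}.
Proof.
move=> x0; apply: differentiable_continuous; apply/derivable1_diffP.
by have [] := is_derive1_powR p x0.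
Qed.

Lemma gint_ge0 s x : (0 <= (gint s x)%:E)%E.
Proof. by rewrite lee_fin mulr_ge0 ?powR_ge0 ?expR_ge0. Qed.

Lemma measurable_gint s (D : set R) : measurable_fun D (fun x => (gint s x)%:E).
Proof.
apply: measurable_funTS; apply/measurable_EFinP; apply: measurable_funM.
  exact: measurable_powR.
by apply: measurableT_comp => //; exact: measurable_funN.
Qed.

Lemma integral_powR s a b : 0 < s -> 0 < a -> a < b ->
  (\int[leb]_(x in `[a, b]) (powR x (s - 1))%:E = ((powR b s - powR a s) / s)%:E)%E.
Proof.
move=> s0 a0 ab; rewrite (@continuous_FTC2 _ _ (fun x => powR x s / s)) //.
- by rewrite -EFinB -mulrBl.
- apply: continuous_in_subspaceT => x; rewrite inE /= in_itv /= => /andP[ax _].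
  by apply: powR_continuous; exact: lt_le_trans ax.
- have cF x : 0 < x -> {for x, continuous (fun x : R => powR x s / s)}.
    by move=> x0; apply: cvgMl; exact: powR_continuous.
  split=> [x||]; first 1 last.
  + exact: cvg_at_right_filter (cF _ a0).
  + exact: cvg_at_left_filter (cF _ (lt_trans a0 ab)).
  rewrite in_itv /= => /andP[ax _]; apply: derivableM => //.
  by have [] := is_derive1_powR s (lt_trans a0 ax).
- move=> x; rewrite in_itv /= => /andP[ax _].
  have x0 := lt_trans a0 ax.
  have h := is_derive1_powR s x0.
  have -> : (fun x : R => powR x s / s) = (fun x => s^-1 *: powR x s).
    by apply/funext => y; rewrite mulrC.
  rewrite derive1E derive_val /GRing.scale /= mulrA mulVf ?mul1r //.
  by rewrite gt_eqF.
Qed.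

(** Only the exponential is frozen, at its minimum over the cell; the power, singular at 0 when
    [s < 1], is integrated exactly. *)
Lemma gint_cell s u v : 0 < s -> 0 < u -> u < v ->
  ((expR (- v) * ((powR v s - powR u s) / s))%:E <=
   \int[leb]_(x in `[u, v]) (gint s x)%:E)%E.
Proof.
move=> s0 u0 uv; rewrite EFinM -integral_powR //.
have mp : measurable_fun `[u, v]%classic (fun x => (powR x (s - 1))%:E).
  by apply: measurable_funTS; apply/measurable_EFinP; exact: measurable_powR.
rewrite -ge0_integralZl_EFin ?expR_ge0 //; last first.
  by move=> x _; rewrite lee_fin powR_ge0.
apply: ge0_le_integral => //.
- by move=> x _; rewrite lee_fin mulr_ge0 ?powR_ge0 ?expR_ge0.
- exact: measurable_funeM.
- exact: measurable_gint.
move=> x /=; rewrite in_itv /= => /andP[ux xv].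
by rewrite lee_fin mulrC ler_wpM2l ?powR_ge0 // ler_expR lerN2.
Qed.

Lemma gint_cells s (u : nat -> R) N : 0 < s -> 0 < u 0%N -> (forall i, u i < u i.+1) ->
  ((\sum_(i < N) expR (- u i.+1) * ((powR (u i.+1) s - powR (u i) s) / s))%:E <=
   \int[leb]_(x in `]0%R, u N]) (gint s x)%:E)%E.
Proof.
move=> s0 u0 uu; have up i : 0 < u i by elim: i => // i IH; exact: lt_trans (uu i).
elim: N => [|N IH]; first by rewrite big_ord0; apply: integral_ge0 => x _; exact: gint_ge0.
have e : `]0%R, u N.+1]%classic = `]0%R, u N]%classic `|` `]u N, u N.+1]%classic.
  apply/seteqP; split => x /=; rewrite !in_itv /=.
    by move=> /andP[-> ->]; case: (leP x (u N)) => _; [left|right].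
  by case=> /andP[h1 h2]; rewrite ?(lt_trans (up N) h1) ?h1 ?h2 //= (le_trans h2) // ltW.
rewrite e ge0_integral_setU //; last 3 first.
- exact: measurable_gint.
- by move=> x _; exact: gint_ge0.
- rewrite disj_set2E; apply/eqP/seteqP; split => x //= [].
  by rewrite !in_itv /= => /andP[_ h1] /andP[h2 _]; move: h2; rewrite ltNge h1.
rewrite big_ord_recr /= EFinD leeD // integral_itv_obnd_cbnd; last exact: measurable_gint.
exact: gint_cell.
Qed.

(** At most [1 / s] over []0, 1]] and, by comparison with the exponential density, at most 1 beyond.
    Finiteness matters because [fine] in [Gamma] would send an infinite integral to 0. *)
Lemma Gamma_lty s : 0 < s <= 1 ->
  (\int[leb]_(x in [set x : R | (0 < x)%R]) (gint s x)%:E < +oo)%E.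
Proof.
move=> /andP[s0 s1]; pose A n := `[(n.+2%:R^-1 : R), +oo[%classic.
have n0 n : 0 < (n.+2%:R^-1 : R) by rewrite invr_gt0 ltr0n.
have n1 n : (n.+2%:R^-1 : R) < 1 by rewrite invf_lt1 ?ltr1n ?ltr0n.
have -> : [set x : R | (0 < x)%R] = \bigcup_n A n.
  apply/seteqP; split => x /=.
    move=> x0; exists (Num.truncn x^-1) => //; rewrite /A /= in_itv /= andbT.
    rewrite invf_ple ?posrE ?ltr0n //; apply: le_trans (ltW (truncnS_gt _)) _.
    by rewrite ler_nat.
  by move=> [n _]; rewrite /A /= in_itv /= andbT; exact: lt_le_trans.
have nA : nondecreasing_seq A.
  move=> i j ij; apply/subsetPset => x; rewrite /A /= !in_itv /= !andbT; apply: le_trans.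
  by rewrite lef_pV2 ?posrE ?ltr0n // ler_nat !ltnS.
have mA n : measurable (A n) by exact: measurable_itv.
have cv : (\int[leb]_(x in A n) (gint s x)%:E)%E @[n --> \oo] -->
    (\int[leb]_(x in \bigcup_n A n) (gint s x)%:E)%E.
  apply: ge0_nondecreasing_set_cvg_integral => //.
    by move=> n; exact: measurable_gint.
  by move=> n x _; exact: gint_ge0.
apply: le_lt_trans (ltry (s^-1 + 1)); rewrite -(cvg_lim _ cv) //.
apply: lime_le; first by apply/cvg_ex; eexists; exact: cv.
apply: nearW => n.
have e : A n = `[n.+2%:R^-1, 1%R]%classic `|` `]1%R, +oo[%classic.
  apply/seteqP; split => x /=; rewrite /A /= !in_itv /= !andbT.
    by move=> ->; case: (leP x 1) => _; [left|right].
  by case=> [/andP[]|h] //; exact: le_trans (ltW (n1 n)) (ltW h).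
rewrite e ge0_integral_setU //; last 3 first.
- exact: measurable_gint.
- by move=> x _; exact: gint_ge0.
- rewrite disj_set2E; apply/eqP/seteqP; split => x //= [].
  by rewrite !in_itv /= => /andP[_ h1] /andP[h2 _]; move: h2; rewrite ltNge h1.
rewrite EFinD leeD //.
  apply: (@le_trans _ _ (\int[leb]_(x in `[(n.+2%:R^-1)%R, 1%R]) (powR x (s - 1))%:E)%E).
    apply: ge0_le_integral => //.
    - by move=> x _; exact: gint_ge0.
    - exact: measurable_gint.
    - by apply: measurable_funTS; apply/measurable_EFinP; exact: measurable_powR.
    move=> x /=; rewrite in_itv /= => /andP[h1 h2].
    rewrite lee_fin ler_piMr ?powR_ge0 // expR_le1 oppr_le0.
    by apply: le_trans h1; exact: ltW.
  rewrite integral_powR // lee_fin powR1 ler_pdivrMr // mulVf ?gt_eqF //.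
rewrite -(integral_exponential_pdf (ltr01 : 0 < 1 :> R)).
apply: (@le_trans _ _ (\int[leb]_(x in `]1%R, +oo[) (exponential_pdf 1 x)%:E)%E).
  apply: ge0_le_integral => //.
  - by move=> x _; exact: gint_ge0.
  - exact: measurable_gint.
  - by apply: measurable_funTS; apply/measurable_EFinP; exact: measurable_exponential_pdf.
  move=> x /=; rewrite in_itv /= andbT => x1.
  rewrite lee_fin exponential_pdfE ?mul1r; last exact: le_trans (ltW x1).
  rewrite mulN1r ler_piMl ?expR_ge0 // -[leRHS](powRr0 x).
  by apply: ler_powR; [exact: ltW|rewrite subr_le0].
apply: ge0_subset_integral => //.
  by apply/measurable_EFinP; exact: measurable_exponential_pdf.
by move=> x _; rewrite lee_fin exponential_pdf_ge0.
Qed.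

Lemma GammaE s : 0 < s <= 1 ->
  ((Gamma R s)%:E = \int[leb]_(x in [set x : R | (0 < x)%R]) (gint s x)%:E)%E.
Proof.
move=> hs; rewrite /Gamma fineK // ge0_fin_numE ?Gamma_lty //.
by apply: integral_ge0 => x _; exact: gint_ge0.
Qed.

Lemma Gamma_ge_cells s (u : nat -> R) N : 0 < s <= 1 -> 0 < u 0%N -> (forall i, u i < u i.+1) ->
  \sum_(i < N) expR (- u i.+1) * ((powR (u i.+1) s - powR (u i) s) / s) <= Gamma R s.
Proof.
move=> hs u0 uu; have /andP[s0 _] := hs.
rewrite -lee_fin GammaE //; apply: le_trans (gint_cells N s0 u0 uu) _.
have -> : [set x : R | (0 < x)%R] = `]0%R, +oo[%classic.
  by apply/seteqP; split => x /=; rewrite in_itv /= andbT.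
apply: ge0_subset_integral => //.
- exact: measurable_gint.
- by move=> x _; exact: gint_ge0.
- by move=> x /=; rewrite !in_itv /= => /andP[->].
Qed.

Lemma Gamma_gt0 s : 0 < s <= 1 -> 0 < Gamma R s.
Proof.
move=> hs; have /andP[s0 _] := hs.
have := @Gamma_ge_cells s (fun i => i.+1%:R) 1 hs ltr01.
rewrite big_ord1 /=; move=> h; apply: lt_le_trans (h _); last first.
  by move=> i; rewrite ltr_nat.
apply: mulr_gt0; first exact: expR_gt0.
by apply: divr_gt0 => //; rewrite subr_gt0 gt0_ltr_powR ?nnegrE // ltr1n.
Qed.

(** The sum of the [n! / i! x^i] for [i <= n], chosen so that [- gpol n * exp (- x)] is an
    antiderivative of [x^n exp (- x)]. *)
Fixpoint gpol n : {poly R} := if n is n'.+1 then 'X^n + n%:R *: gpol n' else 1.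

Lemma gpol_deriv n : (gpol n)^`() = gpol n - 'X^n.
Proof.
elim: n => [|n IH] /=; first by rewrite derivC expr0 subrr.
rewrite derivD derivXn derivZ IH /= scalerBr !scaler_nat addrC subrK.
by rewrite [RHS]addrAC subrr add0r.
Qed.

Lemma gpol0 n : (gpol n).[0] = n`!%:R.
Proof.
elim: n => [|n IH] /=; first by rewrite hornerE fact0.
by rewrite !hornerE IH expr0n /= add0r factS natrM.
Qed.

Lemma powXexpR_cvg0 n : x ^+ n * expR (- x) @[x --> (+oo : set_system R)] --> (0 : R).
Proof.
apply/cvgr0Pnorm_le => e e0; near=> x.
have x0 : 0 < x by near: x; by apply: nbhs_pinfty_gt; exact: num_real.
have xe : n.+1`!%:R / e <= x by near: x; by apply: nbhs_pinfty_ge; exact: num_real.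
rewrite ger0_norm ?mulr_ge0 ?expR_ge0 ?exprn_ge0 ?(ltW x0) // expRN ler_pdivrMr ?expR_gt0 //.
have := expR_ge1Dxn n (ltW x0); rewrite exprSr => h.
have f0 : 0 < n.+1`!%:R :> R by rewrite ltr0n fact_gt0.
have h2 : x ^+ n * x / n.+1`!%:R <= expR x by lra.
apply: le_trans (_ : e * (x ^+ n * x / n.+1`!%:R) <= _); last by rewrite ler_pM2l.
rewrite (_ : e * _ = x ^+ n * (x / (n.+1`!%:R / e))); last by field; rewrite !gt_eqF.
by rewrite ler_peMr ?exprn_ge0 ?(ltW x0) // ler_pdivlMr ?mul1r // divr_gt0.
Unshelve. all: by end_near. Qed.

Lemma gpol_cvg0 (p : {poly R}) : p.[x] * expR (- x) @[x --> (+oo : set_system R)] --> (0 : R).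
Proof.
rewrite (_ : (fun x => _) = fun x => \sum_(i < size p) p`_i * (x ^+ i * expR (- x))).
  elim: (index_enum _) => [|i s IH].
    by under eq_fun do rewrite big_nil; exact: cvg_cst.
  under eq_fun do rewrite big_cons.
  have h : p`_i * (x ^+ i * expR (- x)) @[x --> (+oo : set_system R)] --> p`_i * 0.
    by apply: cvgMr; exact: powXexpR_cvg0.
  by have hh := cvgD h IH; rewrite mulr0 addr0 in hh; exact: hh.
by apply/funext => x; rewrite horner_coef mulr_suml; apply: eq_bigr => i _; rewrite mulrA.
Qed.

Lemma Gamma_nat n : Gamma R (n%:R + 1) = n`!%:R.
Proof.
rewrite /Gamma addrK.
have -> : [set x : R | (0 < x)%R] = `]0%R, +oo[%classic.
  by apply/seteqP; split => x /=; rewrite in_itv /= andbT.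
rewrite integral_itv_obnd_cbnd; last first.
  by have := @measurable_gint (n%:R + 1) `]0%R, +oo[%classic; rewrite addrK.
have e : (\int[leb]_(x in `[0%R, +oo[) (powR x n%:R * expR (- x))%:E =
    \int[leb]_(x in `[0%R, +oo[) (x ^+ n * expR (- x))%:E)%E.
  by apply: eq_integral => x; rewrite inE /= in_itv /= andbT => x0; rewrite powR_mulrn.
have dF (x : R) : is_derive x 1 (fun x => - ((gpol n).[x] * expR (- x))) (x ^+ n * expR (- x)).
  have h1 : is_derive x 1 (horner (gpol n)) ((gpol n).[x] - x ^+ n).
    split; first exact: derivable_horner.
    by rewrite -derive1E -derivE gpol_deriv !hornerE.
  apply: (is_derive_eq (_ : is_derive x 1 (- (horner (gpol n) * (fun x => expR (- x)))) _)).
  by rewrite /GRing.scale /= ; ring.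
rewrite e (@ge0_continuous_FTC2y _ _ (fun x => - ((gpol n).[x] * expR (- x))) _ 0) //.
- by rewrite /= add0r oppr0 expR0 mulr1 gpol0 opprK.
- by move=> x x0; rewrite mulr_ge0 ?exprn_ge0 ?expR_ge0.
- apply: continuous_subspaceT => x; apply: cvgM; first exact: exprn_continuous.
  by apply: continuous_comp; [exact: opp_continuous|exact: continuous_expR].
- by rewrite -oppr0; apply: cvgN; exact: gpol_cvg0.
- have c0 : {for (0 : R), continuous (fun x => - ((gpol n).[x] * expR (- x)))}.
    by apply: differentiable_continuous; apply/derivable1_diffP; have [] := dF 0.
  exact: cvg_at_right_filter c0.
- by move=> x _; rewrite derive1E; have := dF x => h; rewrite derive_val.
Qed.

End GammaFunction.
Lemma bernoulli_succ (R : realType) (x : R) t : 0 <= x ->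
  x ^+ t.+1 + t.+1%:R * x ^+ t <= (x + 1) ^+ t.+1.
Proof.
move=> x0; elim: t => [|t IH]; first by rewrite expr0 !expr1 mulr1.
rewrite [leRHS]exprS; apply: le_trans (ler_wpM2l _ IH); last by rewrite addr_ge0.
have := exprn_ge0 t x0; rewrite !exprS -!natr1 => h.
have := ler0n R t; move: (t%:R : R) (x ^+ t) h => a b b0 a0.
by have := mulr_ge0 a0 b0; lra.
Qed.

(** Telescoping of [bernoulli_succ], which keeps two terms of a binomial expansion. *)
Lemma sum_pow_le (R : realType) t N :
  \sum_(i < N) i.+1%:R ^+ t <= N.+1%:R ^+ t.+1 / t.+1%:R :> R.
Proof.
elim: N => [|N IH]; first by rewrite big_ord0 divr_ge0 ?exprn_ge0.
rewrite big_ord_recr /=; apply: le_trans (lerD IH (lexx _)) _.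
have h := bernoulli_succ t (ler0n R N.+1); rewrite natr1 in h.
rewrite -(ler_pM2r (ltr0Sn R t)) mulrDl !mulfVK ?pnatr_eq0 //; lra.
Qed.

(** * Rates *)

Section Rates.
Variables (R : realType) (F : R -> R) (D : nat -> \bar R) (tau : nat) (M K0 : R).
Hypotheses (tau0 : (0 < tau)%N) (K00 : 0 < K0) (M0 : 0 < M).
Hypothesis F01 : forall r, 0 <= F r <= 1.
Hypothesis Fmono : forall r r', r <= r' -> F r <= F r'.
Hypothesis Fasym : forall e, 0 < e -> exists2 r0, 0 < r0 & forall r, 0 < r -> r <= r0 ->
  K0 * (1 - e) * r ^+ tau <= F r <= K0 * (1 + e) * r ^+ tau.
Hypothesis Dlow : forall K a N, (0 < K)%N -> 0 < a ->
  ((\sum_(i < N) a * (1 - K%:R * F (i.+1%:R * a)))%:E <= D K)%E.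
Hypothesis Dup : forall K N eta h, (0 < K)%N -> 0 <= h -> N%:R * h = M -> 0 < eta ->
  (D K <= (\sum_(i < N) h * (1 - F (i%:R * h)) ^+ K + eta)%:E)%E.
Local Notation p := (tau%:R^-1 : R).
Local Notation rate K := (powR (K%:R * K0) (- p)).

Let tauR : 0 < tau%:R :> R. Proof. by rewrite ltr0n. Qed.
Let p0 : 0 < p. Proof. by rewrite invr_gt0. Qed.
Let p1 : p <= 1. Proof. by rewrite invf_le1 // ler1n. Qed.

(** The empty sum in [Dlow] bounds [D K] from below, a single layer of height [M] in [Dup] from
    above. *)
Lemma D_fin K : (0 < K)%N -> D K = (fine (D K))%:E.
Proof.
move=> kp; rewrite fineK // fin_real //; apply/andP; split.
  apply: lt_le_trans (Dlow 0 kp ltr01); exact: ltNyr.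
apply: le_lt_trans (Dup (N := 1) kp (ltW M0) (mul1r M) ltr01) _; exact: ltry.
Qed.

Lemma powR_root (x : R) : 0 < x -> (powR x p) ^+ tau = x.
Proof.
by move=> x0; rewrite -powR_mulrn ?powR_ge0 // -powRrM mulVf ?gt_eqF // powRr1 // ltW.
Qed.

Lemma powR_rootN (x : R) : 0 < x -> (powR x (- p)) ^+ tau = x^-1.
Proof. by move=> x0; rewrite powRN exprVn powR_root. Qed.

(** The Riemann sums tend to the integral of [1 - (r / w)^tau] over [[0, w]], which is
    [tau / (tau + 1) * w]. *)
Lemma distortion_lower K w : (0 < K)%N -> 0 < w ->
  (forall r, 0 < r -> r <= w -> K%:R * F r <= (r / w) ^+ tau) ->
  tau%:R / (tau%:R + 1) * w <= fine (D K).
Proof.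
move=> kp w0 hF.
have hN n : w * (1 - (1 + harmonic n) ^+ tau.+1 / tau.+1%:R) <= fine (D K).
  set N := n.+1; have N0 : 0 < N%:R :> R by rewrite ltr0n.
  have a0 : 0 < w / N%:R by exact: divr_gt0.
  have := Dlow N kp a0; rewrite (D_fin kp) lee_fin; apply: le_trans.
  apply: (@le_trans _ _ (\sum_(i < N) w / N%:R * (1 - (i.+1%:R / N%:R) ^+ tau))).
    rewrite -mulr_sumr sumrB sumr_const card_ord.
    rewrite (eq_bigr (fun i : 'I_N => i.+1%:R ^+ tau / N%:R ^+ tau)); last first.
      by move=> i _; rewrite expr_div_n.
    rewrite -mulr_suml -[leRHS]mulrA ler_pM2l //.
    have := sum_pow_le R tau N; set X := \sum_(i < N) _ => hX.
    have -> : N%:R^-1 * (N%:R - X / N%:R ^+ tau) = 1 - X * (N%:R ^+ tau.+1)^-1.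
      by rewrite mulrBr mulVf ?gt_eqF // mulrCA -invfM -exprS.
    have -> : 1 + harmonic n = N.+1%:R / N%:R :> R.
      by rewrite /harmonic /= -/N -[N.+1%:R]natr1 mulrDl divff ?mul1r // gt_eqF.
    by rewrite expr_div_n lerD2l lerN2 mulrAC ler_pM2r // invr_gt0 exprn_gt0.
  apply: ler_sum => i _; rewrite ler_pM2l // lerD2l lerN2.
  have e : i.+1%:R / N%:R = i.+1%:R * (w / N%:R) / w :> R by field; rewrite !gt_eqF.
  rewrite [in leRHS]e; apply: hF; first by rewrite mulr_gt0 // ltr0n.
  by rewrite mulrCA ger_pMr // ler_pdivrMr // mul1r ler_nat.
have cv : w * (1 - (1 + harmonic n) ^+ tau.+1 / tau.+1%:R) @[n --> \oo] -->
    w * (1 - (1 + 0) ^+ tau.+1 / tau.+1%:R).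
  apply: cvgMr; apply: cvgB; first exact: cvg_cst.
  apply: cvgMl; apply: (cvg_comp (fun n => 1 + harmonic n) (fun x : R => x ^+ tau.+1)).
    by apply: cvgD; [exact: cvg_cst|exact: cvg_harmonic].
  exact: exprn_continuous.
have : w * (1 - (1 + 0) ^+ tau.+1 / tau.+1%:R) <= fine (D K).
  by apply: (cvgr_to_le cv); apply: nearW.
rewrite addr0 expr1n div1r => h.
apply: le_trans h; rewrite -natr1 le_eqVlt; apply/orP; left; apply/eqP; field.
by rewrite natr1 pnatr_eq0.
Qed.

(** [w] solves [K K0 (1 + e) w^tau = 1] and lies below [r0] for large [K]. Dropping [1 + e] from the
    base costs [(1 + e)^p <= 1 + e], as [p <= 1]. *)
Lemma lower_rate e : 0 < e ->
  \forall K \near \oo, tau%:R / (tau%:R + 1) * rate K <= (1 + e) * fine (D K).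
Proof.
move=> e0; have [r0 r00 hF] := Fasym e0.
near=> K.
have kp : (0 < K)%N by near: K; exact: nbhs_infty_gt.
have kR : 0 < K%:R :> R by rewrite ltr0n.
have Kb : (r0 ^+ tau * (K0 * (1 + e)))^-1 <= K%:R by near: K; exact: nbhs_infty_ger.
have c0 : 0 < K0 * (1 + e) by rewrite mulr_gt0 // addr_gt0.
have x0 : 0 < K%:R * (K0 * (1 + e)) by exact: mulr_gt0.
set w := powR (K%:R * (K0 * (1 + e))) (- p).
have w0 : 0 < w by exact: powR_gt0.
have wr : w <= r0.
  rewrite -(@ler_pXn2r _ tau) ?nnegrE ?(ltW w0) ?(ltW r00) // powR_rootN //.
  rewrite invf_ple ?posrE ?exprn_gt0 // -ler_pdivrMr // -invfM //.
have h : tau%:R / (tau%:R + 1) * w <= fine (D K).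
  apply: distortion_lower => // r rp rw.
  have /andP[_ hr] := hF r rp (le_trans rw wr).
  by rewrite expr_div_n powR_rootN // invrK [leRHS]mulrCA ler_pM2l // mulrC.
apply: le_trans (ler_wpM2l _ h); last by rewrite addr_ge0 // ltW.
have t0 : 0 <= tau%:R / (tau%:R + 1) :> R by rewrite divr_ge0 ?addr_ge0.
rewrite [leRHS]mulrCA ler_wpM2l //.
rewrite /w mulrA [in leRHS]powRM ?mulr_ge0 ?addr_ge0 ?(ltW K00) ?(ltW e0) //.
rewrite mulrCA ler_peMr ?powR_ge0 // powRN -ler_pdivrMr ?invr_gt0 ?powR_gt0 ?addr_gt0 //.
by rewrite div1r invrK ler1_powR // lerDl ltW.
Unshelve. all: by end_near. Qed.

(* Riemann sums of exp(- a x^tau), compared cell by cell with the Gamma integral at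
   u = a x^tau; the two cells next to the singularity at 0 cost 2 h. *)
Lemma gamma_sum a h N : 0 < a -> 0 < h ->
  \sum_(i < N) h * expR (- (a * (i%:R * h) ^+ tau)) <= 2 * h + Gamma R p * p * powR a (- p).
Proof.
move=> a0 h0; pose u i : R := a * (i.+1%:R * h) ^+ tau.
have up i : 0 < u i by rewrite mulr_gt0 // exprn_gt0 // mulr_gt0 // ltr0n.
have uu i : u i < u i.+1.
  rewrite ltr_pM2l // ltrXn2r -?lt0n // ?mulr_ge0 ?(ltW h0) //.
  by rewrite ltr_pM2r // ltr_nat.
have hp : 0 < p <= 1 by rewrite p0 p1.
have cells K : \sum_(i < K) h * expR (- u i.+1) <= Gamma R p * p * powR a (- p).
  (* The increments of [u^p] are the constant [a^p h], so each Gamma cell is a Riemann cell up to a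
     fixed factor. *)
  have up' i : powR (u i) p = powR a p * (i.+1%:R * h).
    rewrite powRM ?(ltW a0) ?exprn_ge0 ?mulr_ge0 ?(ltW h0) //.
    by rewrite -powR_mulrn ?mulr_ge0 ?(ltW h0) // -powRrM divff ?gt_eqF // powRr1 ?mulr_ge0 ?(ltW h0).
  have := Gamma_ge_cells K hp (up 0%N) uu.
  have ap : 0 < powR a p by exact: powR_gt0.
  rewrite powRN -mulrA -ler_pdivrMr ?mulr_gt0 ?invr_gt0 // => hc.
  apply: le_trans hc; rewrite mulr_suml; apply: ler_sum => i _.
  rewrite !up' -[i.+2%:R]natr1 le_eqVlt; apply/orP; left; apply/eqP; field.
  by rewrite !gt_eqF.
have G0 := cells 0%N; rewrite big_ord0 in G0.
have e1 x : 0 <= x -> h * expR (- x) <= h.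
  by move=> x0; rewrite ler_piMr ?(ltW h0) // expR_le1 oppr_le0.
have e2 i : h * expR (- (a * (i%:R * h) ^+ tau)) <= h.
  by apply: e1; rewrite mulr_ge0 ?exprn_ge0 ?mulr_ge0 // ltW.
case: N => [|[|N]]; rewrite ?big_ord0 ?big_ord1.
- by rewrite addr_ge0 // mulr_ge0 // ltW.
- by have := e2 0%N; lra.
rewrite big_ord_recl; have := e2 0%N; rewrite big_ord_recl; have := e2 1%N.
by have := cells N; rewrite /u /=; lra.
Qed.

(** From [(1 - F)^K <= exp (- K F)]: up to [r0] the power law bounds [F] from below, and beyond [r0]
    monotonicity gives a constant exponential, summed over total length [M]. *)
Lemma distortion_upper K c r0 : (0 < K)%N -> 0 < c -> 0 < r0 ->
  (forall r, 0 < r -> r <= r0 -> c * r ^+ tau <= F r) ->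
  fine (D K) <= Gamma R p * p * powR (K%:R * c) (- p) + M * expR (- (K%:R * (c * r0 ^+ tau))).
Proof.
move=> kp c0 r00 hF; apply/ler_addgt0Pr => e e0.
have kR : 0 < K%:R :> R by rewrite ltr0n.
(* Fine enough for the [2 * h] of [gamma_sum] and the [e / 2] of [Dup] to add up to at most [e]. *)
pose N := (Num.truncn (4 * M / e)).+1.
have N0 : 0 < N%:R :> R by rewrite ltr0n.
pose h := M / N%:R.
have h0 : 0 < h by exact: divr_gt0.
have Nh : N%:R * h = M by rewrite mulrCA divff ?mulr1 // gt_eqF.
have he : 4 * h <= e.
  have hN : 4 * M / e < N%:R by exact: truncnS_gt.
  by rewrite mulrA ler_pdivrMr // [leRHS]mulrC -ler_pdivrMr // ltW.
have e20 : 0 < e / 2 by rewrite divr_gt0.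
have := Dup kp (ltW h0) Nh e20; rewrite (D_fin kp) lee_fin => le; apply: le_trans le _.
have term i : (1 - F (i%:R * h)) ^+ K <=
    expR (- (K%:R * c * (i%:R * h) ^+ tau)) + expR (- (K%:R * (c * r0 ^+ tau))).
  have /andP[f0 f1] := F01 (i%:R * h).
  apply: (@le_trans _ _ (expR (- (K%:R * F (i%:R * h))))).
    rewrite -mulrN expRM_natl lerXn2r ?nnegrE ?subr_ge0 ?expR_ge0 //.
    exact: expR_ge1Dx.
  have [ih0|ih0] := leP (i%:R * h) 0.
    have -> : i%:R * h = 0 by apply/eqP; rewrite eq_le ih0 mulr_ge0 // ltW.
    rewrite expr0n eqn0Ngt tau0 mulr0 oppr0 expR0.
    apply: (@le_trans _ _ 1); last by rewrite lerDl expR_ge0.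
    by rewrite expR_le1 oppr_le0 mulr_ge0 //; case/andP: (F01 0).
  have [ir|ir] := leP (i%:R * h) r0.
    rewrite -[leLHS]addr0 lerD ?expR_ge0 // ler_expR lerN2 -mulrA ler_pM2l //.
    exact: hF.
  rewrite -[leLHS]add0r lerD ?expR_ge0 // ler_expR lerN2 ler_pM2l //.
  by apply: le_trans (hF r0 r00 (lexx _)) _; apply: Fmono; exact: ltW.
have sumle : \sum_(i < N) h * (1 - F (i%:R * h)) ^+ K <=
    \sum_(i < N) h * expR (- (K%:R * c * (i%:R * h) ^+ tau)) +
    M * expR (- (K%:R * (c * r0 ^+ tau))).
  set Z := expR (- (K%:R * (c * _))) in term *.
  have -> : M * Z = \sum_(i < N) h * Z by rewrite sumr_const card_ord -mulr_natl mulrA Nh.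
  rewrite -big_split /=; apply: ler_sum => i _.
  by rewrite -mulrDr ler_pM2l.
have := gamma_sum N (mulr_gt0 kR c0) h0; lra.
Qed.

(** The tail is exponentially small while [rate K] is at least [1 / (K K0)] once [K K0 >= 1], as
    [p <= 1]; it is absorbed by half of [e]. The other half pays for [c = K0 / q] in place of
    [K0]. *)
Lemma upper_rate e : 0 < e ->
  \forall K \near \oo, fine (D K) <= (1 + e) * (Gamma R p * p * rate K).
Proof.
move=> e0; set q := 1 + e / 2; have q1 : 1 < q by rewrite ltrDl divr_gt0.
have q0 : 0 < q by exact: lt_trans q1.
have e1 : 0 < 1 - q^-1 by rewrite subr_gt0 invf_lt1.
have [r0 r00 hF] := Fasym e1.
have hp : 0 < p <= 1 by rewrite p0 p1.
set c := K0 / q; have c0 : 0 < c by exact: divr_gt0.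
set rho := c * r0 ^+ tau; have rho0 : 0 < rho by rewrite mulr_gt0 // exprn_gt0.
set G := Gamma R p * p; have G0 : 0 < G by rewrite mulr_gt0 // Gamma_gt0.
near=> K.
have kp : (0 < K)%N by near: K; exact: nbhs_infty_gt.
have kR : 0 < K%:R :> R by rewrite ltr0n.
have K1 : K0^-1 <= K%:R by near: K; exact: nbhs_infty_ger.
(* Exactly what brings [M * 4 / y^2], with [y = K rho], below [e / 2 * G / (K K0)]; the bound used
   is [exp (- y) <= 4 / y^2]. *)
have K2 : 8 * M * K0 / (rho ^+ 2 * e * G) <= K%:R by near: K; exact: nbhs_infty_ger.
have := @distortion_upper K c r0 kp c0 r00.
have hF' r : 0 < r -> r <= r0 -> c * r ^+ tau <= F r.
  by move=> rp rr; have /andP[] := hF r rp rr; rewrite subKr.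
move=> /(_ hF'); rewrite -/G -/rho => h; apply: le_trans h _.
have x1 : 1 <= K%:R * K0 by rewrite -ler_pdivrMr // div1r.
have x0 : 0 < K%:R * K0 by exact: mulr_gt0.
have main : powR (K%:R * c) (- p) <= q * rate K.
  rewrite /c mulrA powRM ?(ltW x0) ?invr_ge0 ?(ltW q0) // mulrC ler_wpM2r ?powR_ge0 //.
  by rewrite -{1}(powR_inv1 (ltW q0)) -powRrM mulN1r opprK ler1_powR // ltW.
have tail : M * expR (- (K%:R * rho)) <= e / 2 * (G * rate K).
  have y0 : 0 < K%:R * rho by exact: mulr_gt0.
  have ey : expR (- (K%:R * rho)) <= 4 / (K%:R * rho) ^+ 2.
    rewrite expRN -[leRHS]invrK lef_pV2 ?posrE ?expR_gt0 ?invr_gt0 ?divr_gt0 ?exprn_gt0 //.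
    have := expR_ge1Dx (K%:R * rho / 2) => hx.
    rewrite (_ : expR _ = expR (K%:R * rho / 2) ^+ 2); last first.
      by rewrite -expRM_natl; congr expR; field.
    rewrite invf_div (_ : _ / 4 = (K%:R * rho / 2) ^+ 2); last by field.
    by rewrite lerXn2r ?nnegrE ?expR_ge0 //; [apply: divr_ge0 => //; exact: ltW|lra].
  have rl : (K%:R * K0)^-1 <= rate K.
    by rewrite -powR_inv1 ?(ltW x0) // ler_powR // lerN2.
  apply: (@le_trans _ _ (e / 2 * (G * (K%:R * K0)^-1))); last first.
    by rewrite ler_pM2l ?divr_gt0 // ler_pM2l.
  apply: le_trans (ler_wpM2l (ltW M0) ey) _.
  have B0 : 0 < rho ^+ 2 * e * G by apply: mulr_gt0 => //; apply: mulr_gt0 => //; exact: exprn_gt0.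
  rewrite ler_pdivrMr // in K2.
  have -> : M * (4 / (K%:R * rho) ^+ 2) = 8 * M * K0 / (2 * K%:R ^+ 2 * K0 * rho ^+ 2).
    by field; rewrite !gt_eqF.
  have d0 : 0 < 2 * K%:R ^+ 2 * K0 * rho ^+ 2.
    by apply: mulr_gt0; [rewrite !mulr_gt0 // exprn_gt0|exact: exprn_gt0].
  rewrite ler_pdivrMr //.
  rewrite (_ : e / 2 * _ * _ = K%:R * (rho ^+ 2 * e * G)) //.
  by field; rewrite !gt_eqF.
have := ler_wpM2l (ltW G0) main.
rewrite (_ : G * (q * rate K) = G * rate K + e / 2 * (G * rate K)); last by rewrite /q; ring.
by lra.
Unshelve. all: by end_near. Qed.

End Rates.

Section VolumeConstant.
Variable R : realType.

Lemma prod_fact_rev a b :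
  \prod_(j < a) ((a + b - j.+1)`!%:R : R) = \prod_(j < a) (b + j)`!%:R.
Proof.
rewrite (reindex_inj rev_ord_inj) /=; apply: eq_bigr => j _.
by congr (_`!%:R); have := ltn_ord j; lia.
Qed.

(** In terms of superfactorials the quotient is symmetric in [a] and [b], which is why the two cases
    of [eta_gr] give the same number. *)
Lemma prod_fact_ratio a b :
  \prod_(j < a) ((a + b - j.+1)`!%:R / (a - j.+1)`!%:R : R) =
  \prod_(j < a + b) j`!%:R / (\prod_(j < a) j`!%:R * \prod_(j < b) j`!%:R).
Proof.
have f0 c : \prod_(j < c) (j`!%:R : R) != 0.
  by apply/prodf_neq0 => j _; rewrite pnatr_eq0 -lt0n fact_gt0.
rewrite big_split /= prod_fact_rev prodfV.
have := prod_fact_rev a 0; rewrite addn0 => ->.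
rewrite addnC big_split_ord /= (eq_bigr (fun j : 'I_b => j`!%:R)) // .
by field; rewrite !f0.
Qed.

Lemma eta_grE n m : (m < n)%N ->
  (m * (n - m))`!%:R * eta_gr R n m =
  \prod_(j < m) ((n - j.+1)`!%:R / (m - j.+1)`!%:R).
Proof.
move=> mn; have t0 : (m * (n - m))`!%:R != 0 :> R by rewrite pnatr_eq0 -lt0n fact_gt0.
have e : n = (m + (n - m))%N by rewrite subnKC // ltnW.
rewrite /eta_gr; case: ifP => _; rewrite mulrA divff // mul1r big_add1 big_mkord //=.
have h1 := prod_fact_ratio (n - m) m; have h2 := prod_fact_ratio m (n - m).
rewrite -e in h2; rewrite addnC -e in h1.
by rewrite h1 h2; congr (_ / _); rewrite mulrC.
Qed.

Lemma eta_gr_volconst n m k : (m < n)%N ->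
  Gamma R ((m * (n - m))%:R + 1) ^+ k / Gamma R ((k * (m * (n - m)))%:R + 1) *
    eta_gr R n m ^+ k = volconst R n m k / (k * (m * (n - m)))`!%:R.
Proof.
by move=> mn; rewrite !Gamma_nat mulrAC -exprMn eta_grE.
Qed.

Lemma powR2_log2 (K : nat) (x : R) : (0 < K)%N ->
  powR 2 (- log2 R K%:R / x) = powR K%:R (- x^-1).
Proof.
move=> K0; rewrite /powR !gt_eqF ?ltr0n // /log2; congr expR.
have l2 : ln 2 != 0 :> R by rewrite gt_eqF // ln_gt0 // ltr1n.
by rewrite mulNr !mulNr mulrAC divfK // mulrC.
Qed.

(** [limn_esup] is an infimum over neighbourhoods of infinity, so a single one with supremum at most
    [1 + e] suffices. *)
Lemma limn_esup_le1 (u : nat -> R) :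
  (forall e, 0 < e -> \forall n \near \oo, u n <= 1 + e) ->
  (limn_esup (fun n => (u n)%:E) <= 1)%E.
Proof.
move=> hu; apply/lee_addgt0Pr => e e0; apply: ge_ereal_inf.
exists (ereal_sup ((fun n => (u n)%:E) @` [set n | u n <= 1 + e])).
  by exists [set n | u n <= 1 + e] => //; exact: hu.
by apply: ge_ereal_sup => _ [n /= un <-]; rewrite lee_fin.
Qed.

End VolumeConstant.

Unset Implicit Arguments.

Theorem theorem2 (R : realType) (n m k : nat)
  (hm : (1 <= m)%N) (hmn : (m < n)%N) (hk : (1 <= k)%N)
  (mu : probability (GT R k n) R) (hmu : uniform_grassk R k n m mu) :
  let t := (m * (n - m))%N in
  let kt : R := (k * t)%N%:R in
  let A : R := powR (Gamma R (t%:R + 1) ^+ k / Gamma R (kt + 1) * eta_gr R n m ^+ k)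
                    (- kt^-1) in
  let Dstar : nat -> R := fun K => fine (distortion R k n m mu K) in
  (limn_esup (fun K : nat =>
      ((kt / (kt + 1) * A * powR 2 (- log2 R K%:R / kt)) / Dstar K)%:E)
     <= 1)%E /\
  (limn_esup (fun K : nat =>
      (Dstar K / (Gamma R (kt^-1) / kt * A * powR 2 (- log2 R K%:R / kt)))%:E)
     <= 1)%E.
Proof.
move=> t kt A Dstar.
have tau0 : (0 < k * t)%N by rewrite !muln_gt0 hk hm subn_gt0.
pose K0 : R := volconst R n m k / (k * t)`!%:R.
have K00 : 0 < K0 by apply: divr_gt0; [exact: volconst_gt0|rewrite ltr0n fact_gt0].
have M0 : 0 < (k * m)%:R :> R by rewrite ltr0n muln_gt0 hk.
have F01 r : 0 <= ballF m mu r <= 1 by rewrite ballF_ge0 ballF_le1.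
have Fmono r r' : r <= r' -> ballF m mu r <= ballF m mu r' by exact: ballF_mono.
(* Identifies the rate: [K0] is the base of the power in [A], and [2^(- log2 K / kt)] is
   [K^(- 1 / kt)]. *)
have rateE K : (0 < K)%N -> A * powR 2 (- log2 R K%:R / kt) = powR (K%:R * K0) (- kt^-1).
  move=> Kp; rewrite /A eta_gr_volconst // powR2_log2 // -/t -/K0 [in RHS]mulrC [in RHS]powRM // ltW //.
have kt0 : 0 < kt by rewrite ltr0n.
have lowD K a N : (0 < K)%N -> 0 < a ->
    ((\sum_(i < N) a * (1 - K%:R * ballF m mu (i.+1%:R * a)))%:E <= distortion R k n m mu K)%E.
  move=> Kp a0; apply: distortion_ge => // c Sc; exact: code_lower.
have upD K N eta h : (0 < K)%N -> 0 <= h -> N%:R * h = (k * m)%:R -> 0 < eta ->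
    (distortion R k n m mu K <= (\sum_(i < N) h * (1 - ballF m mu (i%:R * h)) ^+ K + eta)%:E)%E.
  by move=> Kp h0 Nh e0; exact: distortion_greedy.
have Fas e : 0 < e -> exists2 r0, 0 < r0 & forall r, 0 < r -> r <= r0 ->
    K0 * (1 - e) * r ^+ (k * t) <= ballF m mu r <= K0 * (1 + e) * r ^+ (k * t).
  exact: ballF_asymptotics.
split; apply: limn_esup_le1 => e e0; near=> K.
  have Kp : (0 < K)%N by near: K; exact: nbhs_infty_gt.
  have h : kt / (kt + 1) * powR (K%:R * K0) (- kt^-1) <= (1 + e) * Dstar K.
    by near: K; exact: (lower_rate tau0 K00 M0 Fas lowD upD e0).
  rewrite -(mulrA (kt / (kt + 1)) A) rateE //.
  have x0 : 0 < kt / (kt + 1) * powR (K%:R * K0) (- kt^-1).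
    by rewrite mulr_gt0 ?divr_gt0 ?addr_gt0 // powR_gt0 // mulr_gt0 // ltr0n.
  (* Positivity of [Dstar K], required to clear the denominator, follows from the lower bound
     itself. *)
  have D0 : 0 < Dstar K by rewrite -(pmulr_rgt0 _ (_ : 0 < 1 + e)) ?addr_gt0 // (lt_le_trans x0).
  by rewrite ler_pdivrMr.
have Kp : (0 < K)%N by near: K; exact: nbhs_infty_gt.
have h : Dstar K <= (1 + e) * (Gamma R kt^-1 * kt^-1 * powR (K%:R * K0) (- kt^-1)).
  near: K; exact: (upper_rate tau0 K00 M0 F01 Fmono Fas lowD upD e0).
rewrite -(mulrA (Gamma R kt^-1 / kt) A) rateE // ler_pdivrMr // mulr_gt0 //.
  by rewrite divr_gt0 // Gamma_gt0 // invr_gt0 kt0 invf_le1 // ler1n.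
by rewrite powR_gt0 // mulr_gt0 // ltr0n.
Unshelve. all: by end_near. Qed.
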